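(* Let $T>0$, $H\in(0,1)$, $\varepsilon\in(0,H)$, and let $U^H_t=\int_0^tL_H(t,s)\,dZ_s$, $t\in[0,T]$, where $L_H$ is the sub-fractional kernel $$L_H(t,s)=C_0\,s^{\frac32-H}\left(t^{-1}(t^2-s^2)^{H-\frac12}+\int_s^tz^{-2}(z^2-s^2)^{H-\frac12}\,dz\right)$$ with a constant $C_0>0$, and $Z$ is a Lévy process with characteristic triplet $(a,0,\pi)$, $\pi$ symmetric. 1. Let $0<\int_{\mathbb R}x^2\,\pi(dx)<\infty$. Then there is a constant $C$ such that for all $0\le s<t\le T$ $$\mathbf E|U^H_t-U^H_s|^2\le C(t-s)^{2(H-\varepsilon)}.$$ If $H\in(\frac12,1)$, then the trajectories of $U^H$ (up to modification) are $\varkappa$-Hölder continuous for any $\varkappa\in(0,H-\frac12)$. 2. Let $Z$ be a Brownian motion. Then for all $p\ge2$ there is a constant $C$ such that for all $0\le s<t\le T$ $$\mathbf E|U^H_t-U^H_s|^p\le C(t-s)^{p(H-\varepsilon)},$$ and the trajectories of $U^H$ (up to modification) are $\varkappa$-Hölder continuous for any $\varkappa\in(0,H)$.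
   Context: $Z$ satisfies $\mathbf E e^{i\mu Z_t}=e^{t\Psi(\mu)}$ with $\Psi(\mu)=-\frac{a\mu^2}2+\int_{\mathbb R}(e^{i\mu x}-1-i\mu\tau(x))\pi(dx)$, where $\tau(x)=x$ for $|x|\le1$, $\tau(x)=x/|x|$ for $|x|>1$, $a\ge0$, and $\pi$ is a symmetric Lévy measure ($\pi(\{0\})=0$, $\int(x^2\wedge1)\pi(dx)<\infty$); the drift is zero. The integral with respect to $Z$ is understood (Rajput–Rosiński) as the limit in probability of integrals of elementary functions. Constants $C$ do not depend on $s,t$. *)

(* Defs.v *)
From HB Require Import structures.
From mathcomp Require Import all_boot all_order all_algebra.
From mathcomp Require Import all_classical all_reals all_analysis.
From mathcomp.real_closed Require Import complex.
Set Implicit Arguments.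
Unset Strict Implicit.
Unset Printing Implicit Defensive.
Import Order.TTheory GRing.Theory Num.Theory.
Import numFieldNormedType.Exports.
Import HBSimple.
Local Open Scope classical_set_scope.
Local Open Scope ring_scope.

Definition cexp (R : realType) (z : R[i]) : R[i] :=
  Complex (expR (complex.Re z) * cos (complex.Im z))
          (expR (complex.Re z) * sin (complex.Im z)).

(* The integral of a complex function whose real and imaginary parts are
   integrable; nothing is claimed otherwise. *)
Definition cintegral d (T : measurableType d) (R : realType)
    (mu : {measure set T -> \bar R}) (f : T -> R[i]) : R[i] :=
  Complex (\int[mu]_x complex.Re (f x)) (\int[mu]_x complex.Im (f x)).

Section levy_exponent.
Variable R : realType.

Definition truncation (x : R) : R := if `|x| <= 1 then x else x / `|x|.

Definition levy_measure (pi : {measure set (measurableTypeR R) -> \bar R}) :=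
  pi [set 0] = 0%E /\
  (\int[pi]_x (Num.min (x ^+ 2) 1)%:E < +oo)%E.

Definition symmetric_measure
    (pi : {measure set (measurableTypeR R) -> \bar R}) :=
  forall B : set R, measurable B -> pi (-%R @^-1` B) = pi B.

Definition levy_exponent (a : R)
    (pi : {measure set (measurableTypeR R) -> \bar R}) (mu : R) : R[i] :=
  Complex (- (a * mu ^+ 2 / 2)) 0 +
  cintegral pi (fun x : measurableTypeR R =>
    cexp (Complex 0 (mu * x)) - 1 - Complex 0 (mu * truncation x)).

End levy_exponent.

Section processes.
Context d (Omega : measurableType d) (R : realType) (P : probability Omega R).

Definition charfun (X : {RV P >-> R}) (mu : R) : R[i] :=
  cintegral P (fun w => cexp (Complex 0 (mu * X w))).

Definition cvg_in_probability (X_ : nat -> Omega -> R) (X : Omega -> R) :=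
  forall e : R, 0 < e ->
    P [set w | e <= `|X_ n w - X w|] @[n --> \oo] --> 0%E.

Definition mutually_independent (I : eqType) (X : I -> Omega -> R) :=
  forall (J : seq I) (B : I -> set R), uniq J ->
    (forall i, measurable (B i)) ->
    (P (\bigcap_(i in [set` J]) X i @^-1` B i) =
     \prod_(i <- J) P (X i @^-1` B i))%E.

(* Processes on [0, +oo[ are families indexed by R; the values at negative
   times are irrelevant. *)

(* Any finite family of successive times is the beginning of a nondecreasing
   sequence, so that sequences of times are enough. *)
Definition independent_increments (Z : R -> {RV P >-> R}) :=
  forall t : nat -> R, 0 <= t 0%N ->
    {homo t : m n / (m <= n)%N >-> m <= n} ->
    mutually_independent (fun k w => Z (t k.+1) w - Z (t k) w).

Record levy_process (Z : R -> {RV P >-> R}) : Prop := {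
  levy_start : {ae P, forall w, Z 0 w = 0} ;
  levy_independent_increments : independent_increments Z ;
  levy_stationary_increments : forall s h, 0 <= s -> 0 <= h ->
    forall B : set R, measurable B ->
      P [set w | B (Z (s + h) w - Z s w)] = P [set w | B (Z h w)] ;
  levy_stochastically_continuous : forall t e, 0 <= t -> 0 < e ->
    P [set w | e <= `|Z s w - Z t w|]
      @[s --> within [set s | 0 <= s] (nbhs t)] --> 0%E ;
  levy_cadlag : {ae P, forall w,
    (forall t, 0 <= t -> Z s w @[s --> t^'+] --> Z t w) /\
    (forall t, 0 < t -> cvg (Z s w @[s --> t^'-])) }
}.

(* The characteristic triplet (a, 0, pi), with respect to [truncation]. *)
Definition has_triplet (Z : R -> {RV P >-> R}) (a : R)
    (pi : {measure set (measurableTypeR R) -> \bar R}) :=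
  forall t mu, 0 <= t ->
    charfun (Z t) mu = cexp (Complex t 0 * levy_exponent a pi mu).

(* Brownian motion of variance a per unit of time. *)
Record brownian_motion (a : R) (Z : R -> {RV P >-> R}) : Prop := {
  brownian_start : {ae P, forall w, Z 0 w = 0} ;
  brownian_independent_increments : independent_increments Z ;
  brownian_gaussian_increments : forall s t, 0 <= s -> s < t ->
    forall B : set R, measurable B ->
      P [set w | B (Z t w - Z s w)] =
      normal_prob 0 (Num.sqrt (a * (t - s))) B ;
  brownian_continuous : {ae P, forall w,
    {within [set t | 0 <= t], continuous (fun t => Z t w)} }
}.

(* The independently scattered random measure L generated by Z on the Borel
   subsets of ]0, T]; only the values of L on these sets are relevant. *)
Record generated_random_measure (Z : R -> {RV P >-> R}) (T : R)
    (L : set R -> {RV P >-> R}) : Prop := {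
  random_measure_independent : forall A : nat -> set R,
    (forall n, measurable (A n)) -> (forall n, A n `<=` `]0, T]) ->
    trivIset setT A -> mutually_independent (fun n => L (A n)) ;
  random_measure_sigma_additive : forall A : nat -> set R,
    (forall n, measurable (A n)) -> (forall n, A n `<=` `]0, T]) ->
    trivIset setT A ->
    {ae P, forall w,
      (\sum_(k < n) L (A k) w) @[n --> \oo] --> L (\bigcup_k A k) w} ;
  random_measure_increment : forall s t, 0 <= s -> s <= t -> t <= T ->
    {ae P, forall w, L `]s, t]%classic w = Z t w - Z s w}
}.

(* \int_A f dL for f = \sum_x x \1_(f = x) elementary. *)
Definition elementary_integral (L : set R -> {RV P >-> R})
    (f : {sfun measurableTypeR R >-> R}) (A : set R) (w : Omega) : R :=
  \sum_(x \in range f) x * L (A `&` f @^-1` [set x]) w.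

(* Rajput-Rosinski: X = \int_D f dL. The control measure of a random measure
   generated by a Levy process is a multiple of the Lebesgue measure. *)
Definition is_stochastic_integral (L : set R -> {RV P >-> R}) (D : set R)
    (f : R -> R) (X : {RV P >-> R}) :=
  exists f_ : nat -> {sfun measurableTypeR R >-> R},
    [/\ {ae (@lebesgue_measure R), forall s, D s ->
           f_ n s @[n --> \oo] --> f s},
        (forall A : set R, measurable A -> A `<=` D ->
           exists Y : {RV P >-> R},
             cvg_in_probability (fun n => elementary_integral L (f_ n) A) Y) &
        cvg_in_probability (fun n => elementary_integral L (f_ n) D) X].

(* U_t = \int_0^t K(t, s) dZ_s for t in [0, T]; L is determined by Z up to
   null events. *)
Definition volterra_process (Z : R -> {RV P >-> R}) (T : R)
    (K : R -> R -> R) (U : R -> {RV P >-> R}) :=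
  exists2 L : set R -> {RV P >-> R}, generated_random_measure Z T L &
    forall t, 0 <= t <= T -> is_stochastic_integral L `]0, t]%classic (K t) (U t).

Definition modification (T : R) (U V : R -> {RV P >-> R}) :=
  forall t, 0 <= t <= T -> {ae P, forall w, U t w = V t w}.

End processes.

Definition holder_continuous (R : realType) (T kappa : R) (f : R -> R) :=
  exists K : R, forall s t, 0 <= s <= T -> 0 <= t <= T ->
    `|f t - f s| <= K * `|t - s| `^ kappa.

(* Since 0 `^ x = 0 for x != 0, the values at s = 0 and s = t are conventional;
   they do not affect integrals over ]0, t]. *)
Definition subfractional_kernel (R : realType) (C0 H t s : R) : R :=
  C0 * s `^ (3 / 2 - H) *
  (t^-1 * (t ^+ 2 - s ^+ 2) `^ (H - 1 / 2) +
   \int[lebesgue_measure]_(z in `[s, t])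
     (z ^- 2 * (z ^+ 2 - s ^+ 2) `^ (H - 1 / 2))).

(* Main.v *)
(** Everything is read off characteristic functions. Let [psi] be the real Lévy
symbol, [E cos (mu Z_t) = exp (- t psi mu)]. A Dynkin argument carries this
formula from intervals to all Borel sets, hence
[E cos (mu \int f dL) = exp (- \int psi (mu f))] for step functions [f]. As
[psi (x + y) <= 2 psi x + 2 psi y] and [psi x <= kap x ^ 2], Fatou's lemma gives,
in the limit, [E cos (mu (U_t - U_s)) >= exp (- 2 kap mu ^ 2 \int g ^ 2)] with [g]
the increment of the kernel; the second difference at [mu = 0] bounds the second
moment. For a Brownian motion, [psi] is a multiple of [x ^ 2] and the increments
are Gaussian, so that higher differences bound all moments.

The kernel increment is estimated by hand: below [s] it is a single integral
over [[s, t]], and above [s] it is dominated by powers of [t - u] and [u - s].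
The Hölder continuity follows from the moment bounds by the Kolmogorov
criterion. *)
Require Import Defs.
From HB Require Import structures.
From mathcomp Require Import all_boot all_order all_algebra.
From mathcomp Require Import ring lra.
From mathcomp Require Import all_classical all_reals all_analysis.
From mathcomp Require Import measurable_realfun.
Set Implicit Arguments.
Unset Strict Implicit.
Unset Printing Implicit Defensive.
Import Order.TTheory GRing.Theory Num.Theory.
Import numFieldNormedType.Exports.
Import HBSimple HBNNSimple.
Local Open Scope classical_set_scope.
Local Open Scope ring_scope.

(** * Bounded random variables and independence *)

Section bounded_measurable.
Context d (Omega : measurableType d) (R : realType) (P : probability Omega R).

(** A stochastic integral is only given as a limit in probability of elementary integrals whose
    integrands converge almost everywhere; nothing bounds the exponents or the moments of the
    approximations in advance. Control comes from the convergence itself: being Cauchy in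
    probability forces the exponents of differences to 0, and the remainder is bounded by the limit
    integrand, at the cost of the factor 2 in the subadditivity of [psi]. A lower bound on the
    characteristic function suffices, so that without a Gaussian assumption the limit law is never
    identified. Symmetry keeps everything real: cosines carry the law, sines have mean 0. The loss
    [eps] arises below [s]: there the kernel increment is bounded by a multiple of
    [(s - u) ^ (H - 1/2 - th) * (t - s) ^ th], which is square integrable only for [th < H]. With
    second moments alone, the Kolmogorov criterion costs another 1/2 in the Hölder exponent;
    Gaussian moments of every order make this cost arbitrarily small. *)

Definition bounded_measurable (f : Omega -> R) :=
  measurable_fun setT f /\ exists M, forall w, `|f w| <= M.

Lemma bounded_measurable_integrable f :
  bounded_measurable f -> P.-integrable setT (EFin \o f).
Proof.
move=> [mf [M fM]]; apply: measurable_bounded_integrable => //.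
  by rewrite -ge0_fin_numE// fin_num_measure.
exists M; split; first exact: num_real.
by move=> y My x _ /=; apply: le_trans (fM x) (ltW My).
Qed.

Lemma bounded_measurable_cst c : bounded_measurable (fun=> c).
Proof. by split; [exact: measurable_cst|exists `|c|]. Qed.

Lemma bounded_measurableD f g : bounded_measurable f -> bounded_measurable g ->
  bounded_measurable (fun w => f w + g w).
Proof.
move=> [mf [M fM]] [mg [N gN]]; split; first exact: measurable_funD.
by exists (M + N) => w; rewrite (le_trans (ler_normD _ _))// lerD.
Qed.

Lemma bounded_measurableM f g : bounded_measurable f -> bounded_measurable g ->
  bounded_measurable (fun w => f w * g w).
Proof.
move=> [mf [M fM]] [mg [N gN]]; split; first exact: measurable_funM.
by exists (M * N) => w; rewrite normrM ler_pM.
Qed.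

Lemma bounded_measurableN f : bounded_measurable f ->
  bounded_measurable (fun w => - f w).
Proof.
move=> [mf [M fM]]; split; first exact: measurableT_comp.
by exists M => w; rewrite normrN.
Qed.

Lemma bounded_measurableB f g : bounded_measurable f -> bounded_measurable g ->
  bounded_measurable (fun w => f w - g w).
Proof.
by move=> bf bg; apply: bounded_measurableD => //; exact: bounded_measurableN.
Qed.

Lemma bounded_measurable_cos f : measurable_fun setT f ->
  bounded_measurable (fun w => cos (f w)).
Proof.
move=> mf; split; last by exists 1 => w; rewrite ler_norml cos_geN1 cos_le1.
apply: (measurableT_comp _ mf); apply: continuous_measurable_fun.
exact: continuous_cos.
Qed.

Lemma bounded_measurable_sin f : measurable_fun setT f ->
  bounded_measurable (fun w => sin (f w)).
Proof.
move=> mf; split; last by exists 1 => w; rewrite ler_norml sin_geN1 sin_le1.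
apply: (measurableT_comp _ mf); apply: continuous_measurable_fun.
exact: continuous_sin.
Qed.

Lemma bounded_measurable_indic (A : set Omega) : measurable A ->
  bounded_measurable (\1_A).
Proof.
move=> mA; split; first exact: measurable_indic.
by exists 1 => w; rewrite indicE; case: (_ \in _); rewrite ?normr1 ?normr0.
Qed.

Lemma Rintegral_probability_cst c : \int[P]_w c = c.
Proof.
rewrite Rintegral_cst//; have := probability_setT P.
by move=> /= ->; rewrite mulr1.
Qed.

Lemma Rintegral_indic (A : set Omega) : measurable A ->
  \int[P]_w (\1_A w) = fine (P A).
Proof. by move=> mA; rewrite /Rintegral integral_indic// setIT. Qed.

Lemma bounded_RintegralD f g : bounded_measurable f -> bounded_measurable g ->
  \int[P]_w (f w + g w) = \int[P]_w f w + \int[P]_w g w.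
Proof. by move=> bf bg; apply: RintegralD => //; exact: bounded_measurable_integrable. Qed.

Lemma bounded_RintegralB f g : bounded_measurable f -> bounded_measurable g ->
  \int[P]_w (f w - g w) = \int[P]_w f w - \int[P]_w g w.
Proof. by move=> bf bg; apply: RintegralB => //; exact: bounded_measurable_integrable. Qed.

Lemma bounded_RintegralZl c f : bounded_measurable f ->
  \int[P]_w (c * f w) = c * \int[P]_w f w.
Proof. by move=> bf; apply: RintegralZl => //; exact: bounded_measurable_integrable. Qed.

Lemma bounded_le_Rintegral f g : bounded_measurable f -> bounded_measurable g ->
  (forall w, f w <= g w) -> \int[P]_w f w <= \int[P]_w g w.
Proof.
by move=> bf bg fg; apply: le_Rintegral => //; exact: bounded_measurable_integrable.
Qed.

Lemma bounded_EFin_Rintegral f : bounded_measurable f ->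
  (\int[P]_w f w)%:E = (\int[P]_w (f w)%:E)%E.
Proof.
move=> /bounded_measurable_integrable fi.
by rewrite fineK//; exact: integrable_fin_num.
Qed.

Lemma ae_eq_Rintegral f g : measurable_fun setT f -> measurable_fun setT g ->
  {ae P, forall w, f w = g w} -> \int[P]_w f w = \int[P]_w g w.
Proof.
move=> mf mg fg; congr fine; apply: ae_eq_integral => //.
- exact/measurable_EFinP.
- exact/measurable_EFinP.
- by apply: filterS fg => w /= fgw _; rewrite fgw.
Qed.

Lemma bounded_measurable_sum (I : Type) (r : seq I) (F : I -> Omega -> R) :
  (forall i, bounded_measurable (F i)) ->
  bounded_measurable (fun w => \sum_(i <- r) F i w).
Proof.
move=> bF; elim: r => [|i r IH].
  by under eq_fun do rewrite big_nil; exact: bounded_measurable_cst.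
by under eq_fun do rewrite big_cons; exact: bounded_measurableD.
Qed.

Lemma bounded_Rintegral_sum (I : Type) (r : seq I) (F : I -> Omega -> R) :
  (forall i, bounded_measurable (F i)) ->
  \int[P]_w (\sum_(i <- r) F i w) = \sum_(i <- r) \int[P]_w F i w.
Proof.
move=> bF; elim: r => [|i r IH].
  by under eq_Rintegral do rewrite big_nil; rewrite Rintegral_probability_cst big_nil.
under eq_Rintegral do rewrite big_cons.
by rewrite bounded_RintegralD// ?IH ?big_cons//; exact: bounded_measurable_sum.
Qed.

Lemma bounded_cvg_Rintegral (f_ : nat -> Omega -> R) (f : Omega -> R) (M : R) :
  (forall n, measurable_fun setT (f_ n)) -> measurable_fun setT f ->
  (forall n w, `|f_ n w| <= M) ->
  {ae P, forall w, f_ n w @[n --> \oo] --> f w} ->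
  (\int[P]_w f_ n w) @[n --> \oo] --> \int[P]_w f w.
Proof.
move=> mf_ mf f_M f_f.
have bf_ n : bounded_measurable (f_ n) by split => //; exists M.
have [|||||fi _ h] := @dominated_convergence _ _ _ P setT measurableT
  (fun n => EFin \o f_ n) (EFin \o f) (EFin \o cst M).
- by move=> n; exact/measurable_EFinP.
- exact/measurable_EFinP.
- by apply: filterS f_f => w /= h _; apply: cvg_EFin => //; exact: nearW.
- exact: finite_measure_integrable_cst.
- by apply: nearW => w n _ /=; rewrite lee_fin.
rewrite /Rintegral.
apply: fine_cvg; rewrite fineK//; exact: integrable_fin_num.
Unshelve. all: by end_near.
Qed.

(** Passage from indicators to bounded functions of [X]: [g + M] is nonnegative, hence a limit of
    simple functions below it, for which the claim is linear. Dominated convergence concludes, and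
    the shift [M] drops out by the hypothesis at [B = setT]. *)
Lemma bounded_Rintegral_comp_eq0 (Y : Omega -> R) (X : {RV P >-> R})
    (g : R -> R) :
  bounded_measurable Y -> measurable_fun setT g -> (exists M, forall x, `|g x| <= M) ->
  (forall B : set R, measurable B -> \int[P]_w (Y w * \1_B (X w)) = 0) ->
  \int[P]_w (Y w * g (X w)) = 0.
Proof.
move=> bY mg [M gM] Y0.
have mI (B : set R) : measurable B ->
    bounded_measurable (fun w => Y w * \1_B (X w)).
  move=> mB; apply: bounded_measurableM => //.
  have := @bounded_measurable_indic (X @^-1` B) => /(_ _).
  rewrite (_ : \1_(X @^-1` B) = fun w => \1_B (X w)); last first.
    by apply/funext => w; rewrite !indicE; congr (_%:R); rewrite !mem_setE.
  by apply; rewrite -[X in measurable X]setTI; exact: measurable_funPT.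
have bM c : measurable_fun setT g -> bounded_measurable (fun w => c * g (X w)).
  move=> _; apply: bounded_measurableM; first exact: bounded_measurable_cst.
  by split; [exact: measurableT_comp|exists M => w].
pose h x := (g x + M)%:E.
have h0 x : setT x -> (0 <= h x)%E.
  by move=> _; rewrite lee_fin -lerBlDr sub0r; have := gM x; rewrite ler_norml => /andP[].
have mh : measurable_fun setT h.
  by apply/measurable_EFinP; apply: measurable_funD => //; exact: measurable_cst.
pose s' := nnsfun_approx measurableT mh.
pose s n : R -> R := s' n.
have s0 n : \int[P]_w (Y w * s n (X w)) = 0.
  have [r sE] : exists r : seq R, forall x,
      s n x = \sum_(y <- r) y * \1_(s n @^-1` [set y]) x.
    exists (finmap.enum_fset (fset_set (range (s' n)))) => x.
    by rewrite /s [in LHS](fimfunE (s' n) x) fsbig_finite.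
  under eq_Rintegral do rewrite sE mulr_sumr.
  have ms y : measurable (s n @^-1` [set y]) by exact: measurable_funPTI.
  rewrite bounded_Rintegral_sum => [|y].
    rewrite big1// => y _; under eq_Rintegral do rewrite mulrCA.
    rewrite bounded_RintegralZl; last exact: (mI _ (ms y)).
    by rewrite (Y0 _ (ms y)) mulr0.
  under eq_fun do rewrite mulrCA.
  by apply: bounded_measurableM; [exact: bounded_measurable_cst|exact: (mI _ (ms y))].
have [mY [N YN]] := bY.
have sh n x : 0 <= s n x <= g x + M.
  apply/andP; split; first exact: (@fun_ge0 _ _ (s' n)).
  rewrite -lee_fin /s nnsfun_approxE.
  exact: le_approx.
have M0 : 0 <= M by apply: le_trans (gM 0).
have : (\int[P]_w (Y w * s n (X w))) @[n --> \oo] --> \int[P]_w (Y w * (g (X w) + M)).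
  apply: (@bounded_cvg_Rintegral _ _ (N * (M + M))).
  - move=> n; apply: measurable_funM => //; exact: measurableT_comp.
  - apply: measurable_funM => //; apply: measurable_funD => //; exact: measurableT_comp.
  - move=> n w; rewrite normrM ler_pM//.
    have /andP[s1 s2] := sh n (X w); rewrite ger0_norm//.
    apply: le_trans s2 _; rewrite lerD2r.
    by apply: le_trans (ler_norm _) (gM _).
  - apply: nearW => w; apply: cvgM; first exact: cvg_cst.
    have := @cvg_nnsfun_approx _ _ _ _ measurableT _ mh h0 (X w) I.
    by move=> /fine_cvg.
under eq_fun do rewrite s0.
move=> /(cvg_lim (@Rhausdorff R)); rewrite lim_cst; last exact: Rhausdorff.
under eq_Rintegral do rewrite mulrDr.
have bYM : bounded_measurable (fun w => Y w * M).
  by apply: bounded_measurableM => //; exact: bounded_measurable_cst.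
rewrite bounded_RintegralD//; last first.
  by apply: bounded_measurableM => //; split; [exact: measurableT_comp|exists M].
have := Y0 setT measurableT.
under eq_Rintegral do rewrite indicT mulr1.
move=> EY0.
under [X in _ = _ + X -> _]eq_Rintegral do rewrite mulrC.
by rewrite bounded_RintegralZl// EY0 mulr0 addr0 => <-.
Qed.

End bounded_measurable.

Section independence.
Context d (Omega : measurableType d) (R : realType) (P : probability Omega R).

Lemma bounded_measurable_indic_comp (X : {RV P >-> R}) (B : set R) :
  measurable B -> bounded_measurable (fun w => \1_B (X w) : R).
Proof.
move=> mB; have := @bounded_measurable_indic _ _ R (X @^-1` B) => /(_ _).
rewrite (_ : \1_(X @^-1` B) = fun w => \1_B (X w) : R); last first.
  by apply/funext => w; rewrite !indicE; congr (_%:R); rewrite !mem_setE.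
by apply; rewrite -[X in measurable X]setTI; exact: measurable_funPT.
Qed.

Lemma Rintegral_indic_comp (X : {RV P >-> R}) (B : set R) : measurable B ->
  \int[P]_w (\1_B (X w) : R) = fine (P (X @^-1` B)).
Proof.
move=> mB; rewrite -Rintegral_indic; last first.
  by rewrite -[X in measurable X]setTI; exact: measurable_funPT.
by congr fine; apply: eq_integral => w _; rewrite !indicE !mem_setE.
Qed.

Lemma bounded_measurable_comp (X : {RV P >-> R}) (g : R -> R) :
  measurable_fun setT g -> (exists M, forall x, `|g x| <= M) ->
  bounded_measurable (fun w => g (X w)).
Proof.
by move=> mg [M gM]; split; [exact: measurableT_comp|exists M => w].
Qed.

(** By hypothesis [Y - c] integrates to 0 against every indicator of [X]. *)
Lemma bounded_Rintegral_comp (Y : Omega -> R) (X : {RV P >-> R})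
    (g : R -> R) (c : R) :
  bounded_measurable Y -> measurable_fun setT g ->
  (exists M, forall x, `|g x| <= M) ->
  (forall B : set R, measurable B ->
    \int[P]_w (Y w * \1_B (X w)) = c * fine (P (X @^-1` B))) ->
  \int[P]_w (Y w * g (X w)) = c * \int[P]_w g (X w).
Proof.
move=> bY mg gM YB; apply/eqP; rewrite -subr_eq0; apply/eqP.
have bc : @bounded_measurable _ Omega R (fun=> c) by exact: bounded_measurable_cst.
have bg := bounded_measurable_comp X mg gM.
rewrite -(bounded_RintegralZl P c bg) -bounded_RintegralB; first last.
- exact: bounded_measurableM.
- exact: bounded_measurableM.
under eq_Rintegral do rewrite -mulrBl.
apply: (@bounded_Rintegral_comp_eq0 _ _ _ P (fun w => Y w - c)) => //.
  exact: bounded_measurableB.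
move=> B mB; have bB := bounded_measurable_indic_comp X mB.
under eq_Rintegral do rewrite mulrBl.
rewrite bounded_RintegralB; first last.
- exact: bounded_measurableM.
- exact: bounded_measurableM.
by rewrite YB// bounded_RintegralZl// Rintegral_indic_comp// subrr.
Qed.

(** Real form of the product rule for characteristic functions: since every sine has mean 0, the
    addition formula for the cosine keeps only the product of cosines, and the one for the sine
    vanishes. *)
Lemma mutually_independent_trig (X : nat -> {RV P >-> R}) (c phi : nat -> R) :
  mutually_independent P (fun n => X n : Omega -> R) ->
  (forall i, \int[P]_w cos (c i * X i w) = phi i) ->
  (forall i, \int[P]_w sin (c i * X i w) = 0) ->
  forall n, \int[P]_w cos (\sum_(i < n) c i * X i w) = \prod_(i < n) phi i /\
            \int[P]_w sin (\sum_(i < n) c i * X i w) = 0.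
Proof.
move=> Xind Xcos Xsin.
pose S n w := \sum_(i < n) c i * X i w.
have mS n : measurable_fun setT (S n).
  by apply: measurable_sum => i; apply: measurable_funM => //.
pose I (J : seq nat) (B : nat -> set R) w : R := \prod_(i <- J) \1_(B i) (X i w).
have bI J B : (forall i, measurable (B i)) -> bounded_measurable (I J B).
  move=> mB; rewrite /I; elim: J => [|j J IH].
    by under eq_fun do rewrite big_nil; exact: bounded_measurable_cst.
  under eq_fun do rewrite big_cons; apply: bounded_measurableM => //.
  exact: bounded_measurable_indic_comp.
(* [S n] has to be independent of the variables still to come, so the induction carries the
   indicators of finitely many [X i] with [n <= i]; the empty [J] gives the claim. *)
have Sind n : forall J B, uniq J -> (forall i, i \in J -> (n <= i)%N) ->
    (forall i, measurable (B i)) ->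
  \int[P]_w (cos (S n w) * I J B w) =
    \prod_(i < n) phi i * \prod_(i <- J) fine (P (X i @^-1` B i)) /\
  \int[P]_w (sin (S n w) * I J B w) = 0.
  elim: n => [J B uJ _ mB|n IH J B uJ nJ mB].
    rewrite big_ord0 mul1r /S; split; last first.
      under eq_Rintegral do rewrite big_ord0 sin0 mul0r.
      by rewrite Rintegral_probability_cst.
    under eq_Rintegral do rewrite big_ord0 cos0 mul1r.
    have mX i : measurable (X i @^-1` B i).
      by rewrite -[X in measurable X]setTI; exact: measurable_funPT.
    have -> : I J B = \1_(\big[setI/setT]_(i <- J) (X i @^-1` B i)).
      apply/funext => w; rewrite /I indicE.
      elim: J {uJ} => [|j J IHJ]; first by rewrite !big_nil in_setT.
      rewrite !big_cons IHJ indicE in_setI -natrM mulnb.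
      by congr (_%:R); congr nat_of_bool; congr andb; rewrite mem_setE.
    rewrite Rintegral_indic; last exact: bigsetI_measurable.
    rewrite -bigcap_seq.
    rewrite Xind// -[RHS]/(fine (_%:E)) -prodEFin.
    by congr fine; apply: eq_bigr => i _; rewrite fineK// fin_num_measure.
  (* Adding the event that [X n] lies in [A] to those of [J] turns the induction hypothesis into a
     statement about indicators of [X n], which [bounded_Rintegral_comp] extends to cosine and
     sine. *)
  pose B' A i := if i == n then A else B i.
  have mB' A : measurable A -> forall i, measurable (B' A i).
    by move=> mA i; rewrite /B'; case: ifP.
  have nJ' : n \notin J by apply/negP => /nJ; rewrite ltnn.
  have unJ : uniq (n :: J) by rewrite /= nJ'.
  have nnJ i : i \in n :: J -> (n <= i)%N.
    by rewrite inE => /predU1P[->//|/nJ /ltnW].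
  have IB' A w : I (n :: J) (B' A) w = I J B w * \1_A (X n w).
    rewrite /I big_cons /B' eqxx mulrC; congr (_ * _).
    apply: eq_big_seq => i iJ; case: eqP => // iN.
    by move: iJ; rewrite iN (negbTE nJ').
  have PB' A : \prod_(i <- n :: J) fine (P (X i @^-1` B' A i)) =
      \prod_(i <- J) fine (P (X i @^-1` B i)) * fine (P (X n @^-1` A)).
    rewrite big_cons /B' eqxx mulrC; congr (_ * _).
    apply: eq_big_seq => i iJ; case: eqP => // iN.
    by move: iJ; rewrite iN (negbTE nJ').
  have bC : bounded_measurable (fun w => cos (S n w) * I J B w).
    by apply: bounded_measurableM; [exact: bounded_measurable_cos|exact: bI].
  have bS : bounded_measurable (fun w => sin (S n w) * I J B w).
    by apply: bounded_measurableM; [exact: bounded_measurable_sin|exact: bI].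
  have trigb (f : R -> R) : continuous f -> (forall x, -1 <= f x <= 1) ->
      measurable_fun setT (fun x => f (c n * x)) /\
      (exists M, forall x, `|f (c n * x)| <= M).
    move=> fc fb; split; last by exists 1 => x; rewrite ler_norml.
    apply: measurableT_comp; first exact: continuous_measurable_fun.
    exact: mulrl_measurable.
  have [mcos bcos] := trigb cos (@continuous_cos R) (fun x => introT andP (conj (cos_geN1 x) (cos_le1 x))).
  have [msin bsin] := trigb sin (@continuous_sin R) (fun x => introT andP (conj (sin_geN1 x) (sin_le1 x))).
  have hC (g : R -> R) : measurable_fun setT g -> (exists M, forall x, `|g x| <= M) ->
    \int[P]_w (cos (S n w) * I J B w * g (X n w)) =
    \prod_(i < n) phi i * \prod_(i <- J) fine (P (X i @^-1` B i)) * \int[P]_w g (X n w).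
    move=> mg bg; apply: bounded_Rintegral_comp => // A mA.
    have [+ _] := IH (n :: J) (B' A) unJ nnJ (mB' A mA).
    rewrite PB' mulrA => <-; apply: eq_Rintegral => w _.
    by rewrite IB' mulrA.
  have hS (g : R -> R) : measurable_fun setT g -> (exists M, forall x, `|g x| <= M) ->
    \int[P]_w (sin (S n w) * I J B w * g (X n w)) = 0.
    move=> mg bg; rewrite (@bounded_Rintegral_comp _ _ _ 0) ?mul0r// => A mA.
    have [_ +] := IH (n :: J) (B' A) unJ nnJ (mB' A mA).
    rewrite mul0r => <-; apply: eq_Rintegral => w _.
    by rewrite IB' mulrA.
  have SS w : S n.+1 w = S n w + c n * X n w by rewrite /S big_ord_recr.
  have bcX : bounded_measurable (fun w => cos (c n * X n w)).
    exact: (bounded_measurable_comp (X n) mcos bcos).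
  have bsX : bounded_measurable (fun w => sin (c n * X n w)).
    exact: (bounded_measurable_comp (X n) msin bsin).
  split.
    transitivity (\int[P]_w (cos (S n w) * I J B w * cos (c n * X n w) -
                             sin (S n w) * I J B w * sin (c n * X n w))).
      by apply: eq_Rintegral => w _; rewrite SS cosD; ring.
    rewrite bounded_RintegralB; [|exact: bounded_measurableM..].
    rewrite (hC (fun x => cos (c n * x)))// (hS (fun x => sin (c n * x)))//.
    by rewrite Xcos subr0 big_ord_recr/= mulrAC.
  transitivity (\int[P]_w (sin (S n w) * I J B w * cos (c n * X n w) +
                           cos (S n w) * I J B w * sin (c n * X n w))).
    by apply: eq_Rintegral => w _; rewrite SS sinD; ring.
  rewrite bounded_RintegralD; [|exact: bounded_measurableM..].
  rewrite (hC (fun x => sin (c n * x)))// (hS (fun x => cos (c n * x)))//.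
  by rewrite Xsin mulr0 addr0.
move=> n; have [] := Sind n [::] (fun=> setT) => //.
rewrite big_nil mulr1 => SC SS.
split; [apply: etrans SC|apply: etrans SS]; apply: eq_Rintegral => w _;
  by rewrite /I big_nil mulr1.
Qed.

Lemma independent_Rintegral_mul (X Y : {RV P >-> R}) (f g : R -> R) :
  measurable_fun setT f -> (exists M, forall x, `|f x| <= M) ->
  measurable_fun setT g -> (exists M, forall x, `|g x| <= M) ->
  (forall A B : set R, measurable A -> measurable B ->
    P (X @^-1` A `&` Y @^-1` B) = (P (X @^-1` A) * P (Y @^-1` B))%E) ->
  \int[P]_w (f (X w) * g (Y w)) = \int[P]_w f (X w) * \int[P]_w g (Y w).
Proof.
move=> mf bf mg bg XY.
have mX (Z : {RV P >-> R}) A : measurable A -> measurable (Z @^-1` A).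
  by move=> mA; rewrite -[X in measurable X]setTI; exact: measurable_funPT.
apply: bounded_Rintegral_comp => // [|B mB]; first exact: bounded_measurable_comp.
under eq_Rintegral do rewrite mulrC.
rewrite (@bounded_Rintegral_comp _ _ _ (fine (P (Y @^-1` B)))) 1?mulrC//.
  exact: bounded_measurable_indic_comp.
move=> A mA; rewrite -fineM ?fin_num_measure//; [|exact: mX..].
rewrite muleC -XY// -Rintegral_indic; last by apply: measurableI; exact: mX.
apply: eq_Rintegral => w _; rewrite !indicE in_setI -natrM mulnb andbC.
by congr (_%:R); congr nat_of_bool; congr andb; rewrite mem_setE.
Qed.

End independence.

(** * Characteristic functions of step integrals *)

Lemma cvg_cst_eq (R : realType) (x y : R) : (fun=> x) @ \oo --> y -> x = y.
Proof.
by move=> h; apply: (cvg_unique (@Rhausdorff R) _ h); exact: cvg_cst.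
Qed.

Section random_measure.
Context d (Omega : measurableType d) (R : realType) (P : probability Omega R).
Context (T : R) (T_gt0 : 0 < T) (Z : R -> {RV P >-> R})
  (L : set R -> {RV P >-> R}) (Lgen : generated_random_measure Z T L).
Context (psi : R -> R).
Hypothesis Z_cos : forall s t mu, 0 <= s -> s <= t ->
  \int[P]_w cos (mu * (Z t w - Z s w)) = expR (- ((t - s) * psi mu)).
Hypothesis Z_sin : forall s t mu, 0 <= s -> s <= t ->
  \int[P]_w sin (mu * (Z t w - Z s w)) = 0.

Local Notation D := (`]0, T]%classic : set R).
Local Notation leb := (@lebesgue_measure R).

(** Sigma-additivity for the constant empty sequence: the partial sums [n * L set0 w] converge, so
    their consecutive differences, all equal to [L set0 w], tend to 0. *)
Lemma random_measure0 : {ae P, forall w, L set0 w = 0}.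
Proof.
have := random_measure_sigma_additive Lgen (A := fun=> set0)
  (fun=> measurable0) (fun=> sub0set _) (@trivIset_set0 _ _ _).
rewrite bigcup0//; apply: filterS => w h.
have h1 : (\sum_(k < n.+1) L set0 w) @[n --> \oo] --> L set0 w.
  by rewrite (cvg_shiftS (fun n => \sum_(k < n) L set0 w)).
have := cvgB h1 h; rewrite subrr.
rewrite (_ : _ - _ = fun=> L set0 w); last first.
  by apply/funext => n; rewrite !fctE big_ord_recr/= addrAC subrr add0r.
by move=> /(_ _) /cvg_cst_eq; apply.
Qed.

Lemma random_measure_additive (A : nat -> set R) N :
  (forall n, measurable (A n)) -> (forall n, A n `<=` D) -> trivIset setT A ->
  (forall n, (N <= n)%N -> A n = set0) ->
  {ae P, forall w, L (\bigcup_k A k) w = \sum_(k < N) L (A k) w}.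
Proof.
move=> mA AD tA A0; have := random_measure_sigma_additive Lgen mA AD tA.
have L0 := random_measure0.
apply: filterS2 L0 => w L0 h.
have h' : (\sum_(k < N) L (A k) w : R) @[n --> \oo] --> \sum_(k < N) L (A k) w.
  exact: cvg_cst.
have e : \forall n \near \oo, \sum_(k < N) L (A k) w = \sum_(k < n) L (A k) w.
  exists N => // n /= Nn; rewrite -(subnKC Nn) big_split_ord/=.
  rewrite [X in _ + X]big1 ?addr0// => i _.
  by rewrite A0 ?leq_addr.
have := cvg_trans (near_eq_cvg e) h' => h''.
exact: (cvg_unique (@Rhausdorff R) h (h'' _)).
Qed.

Lemma random_measureU (A B : set R) : measurable A -> measurable B ->
  A `<=` D -> B `<=` D -> A `&` B = set0 ->
  {ae P, forall w, L (A `|` B) w = L A w + L B w}.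
Proof.
move=> mA mB AD BD AB.
have := @random_measure_additive (bigcup2 A B) 2.
rewrite bigcup2E => /(_ _ _ _ _)/Wrap[].
- by move=> [|[|n]] //=; exact: measurable0.
- by move=> [|[|n]] //=; exact: sub0set.
- by rewrite -trivIset_bigcup2.
- by move=> [|[|n]].
by apply: filterS => w; rewrite big_ord_recr big_ord1.
Qed.

(** [L] is only specified inside [D], whereas the Dynkin class lives on the whole line: hence the
    trace on [D]. The sine clause records the symmetry of the law, without which cosines alone would
    not be stable under complements and unions. *)
Definition has_exponent (A : set R) := forall mu,
  \int[P]_w cos (mu * L (A `&` D) w) =
    expR (- (fine (leb (A `&` D)) * psi mu)) /\
  \int[P]_w sin (mu * L (A `&` D) w) = 0.

Lemma lebesgue_measureID_fin (A : set R) : measurable A ->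
  leb (A `&` D) \is a fin_num.
Proof.
move=> mA; rewrite ge0_fin_numE//.
apply: (@le_lt_trans _ _ (leb D)).
  by apply: le_measure; rewrite ?inE//; exact: measurableI.
by rewrite lebesgue_measure_itv/= lte_fin T_gt0 ltry.
Qed.

Lemma has_exponent_ocitv (a b : R) : has_exponent (`]a, b]%classic).
Proof.
(* Clipping to [0, T]; the outer maximum in [t] makes ]s, t] empty when ]a, b] does not meet ]0,
   T]. *)
pose s := Num.min T (Num.max a 0); pose t := Num.max s (Num.min b T).
have s0 : 0 <= s by rewrite le_min (ltW T_gt0) le_max lexx orbT.
have st : s <= t by rewrite le_max lexx.
have sT : s <= T by rewrite ge_min lexx.
have tT : t <= T by rewrite ge_max sT ge_min lexx orbT.
move=> mu; have -> : `]a, b]%classic `&` D = `]s, t]%classic.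
  have sx x : (s < x) = (T < x) || ((a < x) && (0 < x)) by rewrite gt_min gt_max.
  have xt x : (x <= t) = (x <= s) || ((x <= b) && (x <= T)) by rewrite /t le_max [X in _ || X]le_min.
  apply/seteqP; split=> x /=; rewrite !in_itv/= xt.
    by move=> [/andP[ax xb] /andP[x0 xT]]; rewrite sx ax x0 xb xT !orbT.
  move=> /andP[sltx]; rewrite leNgt sltx/= => /andP[xb xT].
  by move: sltx; rewrite sx ltNge xT/= => /andP[ax x0]; split; apply/andP.
have Lst := random_measure_increment Lgen s0 st tT.
have mL B : measurable_fun setT (fun w => mu * L B w).
  by apply: measurable_funM.
have mZ : measurable_fun setT (fun w => mu * (Z t w - Z s w)).
  by apply: measurable_funM => //; exact: measurable_funB.
have -> : fine (leb `]s, t]%classic) = t - s.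
  rewrite lebesgue_measure_itv/= lte_fin; case: ltP => //= ts.
  by apply/eqP; rewrite eq_sym subr_eq0 eq_le st ts.
rewrite -(Z_cos mu s0 st); split; last first.
  rewrite -(Z_sin mu s0 st); apply: ae_eq_Rintegral.
  - by have [] := bounded_measurable_sin (mL `]s, t]%classic).
  - by have [] := bounded_measurable_sin mZ.
  - by apply: filterS Lst => w ->.
apply: ae_eq_Rintegral.
- by have [] := bounded_measurable_cos (mL `]s, t]%classic).
- by have [] := bounded_measurable_cos mZ.
- by apply: filterS Lst => w ->.
Qed.

Lemma has_exponentT : has_exponent setT.
Proof.
have := has_exponent_ocitv 0 T; rewrite /has_exponent setIid setTI.
by [].
Qed.

Lemma measurable_mul_random_measure A mu :
  measurable_fun setT (fun w => mu * L A w).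
Proof. exact: measurable_funM. Qed.

(** The characteristic function of [L D] is the product of those of two independent pieces; the
    factor belonging to [A] is an exponential, never 0, and can be cancelled. *)
Lemma has_exponentC A : measurable A -> has_exponent A -> has_exponent (~` A).
Proof.
move=> mA hA mu.
have mD : measurable D by exact: measurable_itv.
set B := A `&` D; set B' := ~` A `&` D.
have mB : measurable B by exact: measurableI.
have mB' : measurable B' by apply: measurableI => //; exact: measurableC.
have BB' : B `&` B' = set0 by rewrite /B /B' setIACA setICr set0I.
have BUB' : B `|` B' = D by rewrite /B /B' -setIUl setUv setTI.
have BD : B `<=` D by exact: subIsetr.
have B'D : B' `<=` D by exact: subIsetr.
have LD : {ae P, forall w, L D w = L B w + L B' w}.
  by rewrite -BUB'; exact: random_measureU.
have /= [hc hs] := hA mu; have := has_exponentT mu; rewrite setTI => -[Dc Ds].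
have ind : forall (E F : set R), measurable E -> measurable F ->
  P (L B @^-1` E `&` L B' @^-1` F) = (P (L B @^-1` E) * P (L B' @^-1` F))%E.
  move=> E F mE mF.
  have := random_measure_independent Lgen (A := bigcup2 B B').
  case/(_ _ _ _)/Wrap => [[|[|n]]//=|[|[|n]]//=||].
    by rewrite -trivIset_bigcup2.
  move=> /(_ [:: 0%N; 1%N] (fun n => if n == 0%N then E else F)).
  rewrite bigcap_seq !big_cons !big_nil mule1 setIT /=; apply => //.
  by move=> i; case: ifP.
have trig (f g : R -> R) : continuous f -> continuous g ->
    (forall x, -1 <= f x <= 1) -> (forall x, -1 <= g x <= 1) ->
  \int[P]_w (f (mu * L B w) * g (mu * L B' w)) =
  \int[P]_w f (mu * L B w) * \int[P]_w g (mu * L B' w).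
  move=> cf cg bf bg.
  apply: (@independent_Rintegral_mul _ _ _ P (L B) (L B')
    (fun x => f (mu * x)) (fun x => g (mu * x))) => //.
  - apply: measurableT_comp; first exact: continuous_measurable_fun.
    exact: mulrl_measurable.
  - by exists 1 => x; rewrite ler_norml.
  - apply: measurableT_comp; first exact: continuous_measurable_fun.
    exact: mulrl_measurable.
  - by exists 1 => x; rewrite ler_norml.
have cosb (x : R) : -1 <= cos x <= 1 by rewrite cos_geN1 cos_le1.
have sinb (x : R) : -1 <= sin x <= 1 by rewrite sin_geN1 sin_le1.
have mL B := measurable_mul_random_measure B mu.
have bc B := bounded_measurable_cos (mL B).
have bs B := bounded_measurable_sin (mL B).
have mLL : measurable_fun setT (fun w => mu * (L B w + L B' w)).
  by apply: measurable_funM => //; exact: measurable_funD.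
move: Dc; rewrite (@ae_eq_Rintegral _ _ _ P _ (fun w => cos (mu * (L B w + L B' w)))); first last.
- by apply: filterS LD => w ->.
- by have [] := bounded_measurable_cos mLL.
- by have [] := bc D.
under eq_Rintegral do rewrite mulrDr cosD.
rewrite bounded_RintegralB; [|exact: bounded_measurableM..].
rewrite (trig cos cos)// ?(trig sin sin)//; try exact: continuous_cos; try exact: continuous_sin.
rewrite hs mul0r subr0 hc => Dc.
move: Ds; rewrite (@ae_eq_Rintegral _ _ _ P _ (fun w => sin (mu * (L B w + L B' w)))); first last.
- by apply: filterS LD => w ->.
- by have [] := bounded_measurable_sin mLL.
- by have [] := bs D.
under eq_Rintegral do rewrite mulrDr sinD.
rewrite bounded_RintegralD; [|exact: bounded_measurableM..].
rewrite (trig sin cos)// ?(trig cos sin)//; try exact: continuous_cos; try exact: continuous_sin.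
rewrite hs mul0r add0r hc => /eqP.
rewrite mulf_eq0 gt_eqF ?expR_gt0//= => /eqP Ds; split=> //.
have lD : fine (leb D) = fine (leb B) + fine (leb B').
  rewrite -fineD; [|exact: lebesgue_measureID_fin|].
    by rewrite -BUB' measureU.
  by apply: lebesgue_measureID_fin; exact: measurableC.
apply: (mulfI (lt0r_neq0 (expR_gt0 (- (fine (leb B) * psi mu))))).
by rewrite Dc -expRD lD; congr expR; ring.
Qed.

(** Partial sums obey the product rule; bounded convergence passes to the limit in the expectations,
    and sigma-additivity of the Lebesgue measure in the exponents. *)
Lemma has_exponent_bigcup (F : (set R)^nat) :
  (forall n, measurable (F n)) -> trivIset setT F ->
  (forall n, has_exponent (F n)) -> has_exponent (\bigcup_k F k).
Proof.
move=> mF tF hF mu.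
have mD : measurable D by exact: measurable_itv.
pose G n := F n `&` D.
have mG n : measurable (G n) by exact: measurableI.
have GD n : G n `<=` D by exact: subIsetr.
have tG : trivIset setT G by exact: trivIset_setIr.
have -> : \bigcup_k F k `&` D = \bigcup_k G k by rewrite setI_bigcupl.
have ind := random_measure_independent Lgen mG GD tG.
have [Ec Es] := all_and2 (mutually_independent_trig (c := fun=> mu) ind
  (fun i => (hF i mu).1) (fun i => (hF i mu).2)).
have LG := random_measure_sigma_additive Lgen mG GD tG.
have mS n : measurable_fun setT (fun w => \sum_(i < n) mu * L (G i) w).
  by apply: measurable_sum => i; exact: measurable_mul_random_measure.
have mL B := measurable_mul_random_measure B mu.
have Gfin : leb (\bigcup_k G k) \is a fin_num.
  rewrite -setI_bigcupl; apply: lebesgue_measureID_fin.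
  exact: bigcup_measurable.
have lebG : (\sum_(i < n) fine (leb (G i))) @[n --> \oo] --> fine (leb (\bigcup_k G k)).
  have h : (\sum_(0 <= i < n) leb (G i))%E @[n --> \oo] -->
      (fine (leb (\bigcup_k G k)))%:E.
    rewrite fineK//.
    exact: (@measure_semi_sigma_additive _ _ _ leb G mG tG
              (bigcup_measurable (fun k _ => mG k))).
  move/fine_cvg : h.
  rewrite (_ : _ \o _ = fun n => \sum_(i < n) fine (leb (G i)))//.
  apply/funext => n /=; rewrite big_mkord -[RHS]/(fine (_%:E)) -sumEFin.
  congr fine; apply: eq_bigr => i _.
  by rewrite fineK//; exact: lebesgue_measureID_fin.
have LGmu : {ae P, forall w, (\sum_(i < n) mu * L (G i) w) @[n --> \oo] --> mu * L (\bigcup_k G k) w}.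
  apply: filterS LG => w h.
  under eq_fun do rewrite -mulr_sumr.
  by apply: cvgM => //; exact: cvg_cst.
split.
- have h1 : \int[P]_w cos (\sum_(i < n) mu * L (G i) w) @[n --> \oo] -->
      \int[P]_w cos (mu * L (\bigcup_k G k) w).
    apply: (@bounded_cvg_Rintegral _ _ _ P _ _ 1).
    + by move=> n; have [] := bounded_measurable_cos (mS n).
    + by have [] := bounded_measurable_cos (mL (\bigcup_k G k)).
    + by move=> n w; rewrite ler_norml cos_geN1 cos_le1.
    + apply: filterS LGmu => w h; apply: continuous_cvg h; exact: continuous_cos.
  have h2 : \int[P]_w cos (\sum_(i < n) mu * L (G i) w) @[n --> \oo] -->
      expR (- (fine (leb (\bigcup_k G k)) * psi mu)).
    under eq_fun do rewrite Ec -expR_sum.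
    apply: continuous_cvg; first exact: continuous_expR.
    under eq_fun do rewrite sumrN -mulr_suml.
    by apply: cvgN; apply: cvgM => //; exact: cvg_cst.
  exact: (cvg_unique (@Rhausdorff R) h1 h2).
- have h1 : \int[P]_w sin (\sum_(i < n) mu * L (G i) w) @[n --> \oo] -->
      \int[P]_w sin (mu * L (\bigcup_k G k) w).
    apply: (@bounded_cvg_Rintegral _ _ _ P _ _ 1).
    + by move=> n; have [] := bounded_measurable_sin (mS n).
    + by have [] := bounded_measurable_sin (mL (\bigcup_k G k)).
    + by move=> n w; rewrite ler_norml sin_geN1 sin_le1.
    + apply: filterS LGmu => w h; apply: continuous_cvg h; exact: continuous_sin.
  move: h1; under eq_fun do rewrite Es.
  by move=> /cvg_cst_eq.
Qed.

Lemma measurable_has_exponent A : measurable A -> has_exponent A.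
Proof.
move=> mA.
apply: (@dynkin_induction _ (measurableTypeR R) (@ocitv R) has_exponent) => //.
- exact: ocitvI.
- exact: has_exponentT.
- move=> B /ocitvP[->|[x _ ->]]; last exact: has_exponent_ocitv.
  by have := has_exponent_ocitv 0 0; rewrite set_itv_ge// bnd_simp ltxx.
- exact: has_exponentC.
- exact: has_exponent_bigcup.
Qed.

End random_measure.

(** * Step functions and their integrals *)

Section step_integral.
Context d (Omega : measurableType d) (R : realType) (P : probability Omega R).
Context (L : set R -> {RV P >-> R}).

(** The sets of the list may overlap, so that sums and multiples of step functions are
    concatenations and rescalings of lists. Disjointness is restored by [step_partition]. *)
Definition step_integral (s : seq (R * set R)) (w : Omega) : R :=
  \sum_(p <- s) p.1 * L p.2 w.

Definition step_fun (s : seq (R * set R)) (u : R) : R :=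
  \sum_(p <- s) p.1 * \1_(p.2) u.

Definition scale_step (c : R) (s : seq (R * set R)) :=
  [seq (c * p.1, p.2) | p <- s].

Fixpoint step_on (D : set R) (s : seq (R * set R)) : Prop :=
  if s is p :: s' then [/\ measurable p.2, p.2 `<=` D & step_on D s'] else True.

Lemma step_on_cat D s1 s2 : step_on D s1 -> step_on D s2 -> step_on D (s1 ++ s2).
Proof. by elim: s1 => //= p s1 IH [mp pD /IH s1D] /s1D. Qed.

Lemma step_on_scale D c s : step_on D s -> step_on D (scale_step c s).
Proof. by elim: s => //= p s IH [mp pD /IH sD]. Qed.

Lemma step_integral_cat s1 s2 w :
  step_integral (s1 ++ s2) w = step_integral s1 w + step_integral s2 w.
Proof. by rewrite /step_integral big_cat. Qed.

Lemma step_fun_cat s1 s2 u :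
  step_fun (s1 ++ s2) u = step_fun s1 u + step_fun s2 u.
Proof. by rewrite /step_fun big_cat. Qed.

Lemma step_integral_scale c s w :
  step_integral (scale_step c s) w = c * step_integral s w.
Proof.
by rewrite /step_integral big_map mulr_sumr; apply: eq_bigr => p _; rewrite mulrA.
Qed.

Lemma step_fun_scale c s u : step_fun (scale_step c s) u = c * step_fun s u.
Proof.
by rewrite /step_fun big_map mulr_sumr; apply: eq_bigr => p _; rewrite mulrA.
Qed.

Lemma measurable_step_integral s : measurable_fun setT (step_integral s).
Proof. by apply: measurable_sum => p; exact: measurable_funM. Qed.

End step_integral.

Section step_integral_law.
Context d (Omega : measurableType d) (R : realType) (P : probability Omega R).
Context (T : R) (T_gt0 : 0 < T) (Z : R -> {RV P >-> R})
  (L : set R -> {RV P >-> R}) (Lgen : generated_random_measure Z T L).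
Context (psi : R -> R).
Hypothesis Z_cos : forall s t mu, 0 <= s -> s <= t ->
  \int[P]_w cos (mu * (Z t w - Z s w)) = expR (- ((t - s) * psi mu)).
Hypothesis Z_sin : forall s t mu, 0 <= s -> s <= t ->
  \int[P]_w sin (mu * (Z t w - Z s w)) = 0.

Local Notation D := (`]0, T]%classic : set R).
Local Notation leb := (@lebesgue_measure R).

Lemma integral_indicR (m : {measure set (measurableTypeR R) -> \bar R})
    (A B : set (measurableTypeR R)) : measurable A -> measurable B ->
  (\int[m]_(x in A) (\1_B x)%:E)%E = m (B `&` A).
Proof. by move=> *; exact: integral_indic. Qed.

Lemma sum_double (F : nat -> R) N :
  \sum_(k < N.*2) F k = \sum_(k < N) (F k.*2 + F k.*2.+1).
Proof.
by elim: N => [|N IH]; rewrite ?big_ord0// doubleS !big_ord_recr/= IH addrA.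
Qed.

(** Independence requires disjoint cells, obtained by refining with one set at a time. They form an
    eventually empty sequence, the format in which [L] is axiomatized, and they cover [D] so that
    each [L A] splits over them. *)
Lemma step_partition (s : seq (R * set R)) : step_on D s ->
  exists N (B : nat -> set R) (c : nat -> R),
    [/\ [/\ forall k, measurable (B k), forall k, B k `<=` D &
            trivIset setT B],
        \bigcup_k B k = D, (forall k, (N <= k)%N -> B k = set0),
        {ae P, forall w, step_integral L s w = \sum_(k < N) c k * L (B k) w} &
        forall k u, B k u -> step_fun s u = c k].
Proof.
elim: s => [_|[c A] s IH /= [mA AD sD]].
  exists 1%N, (fun k => if k == 0%N then D else set0), (fun=> 0); split.
  - split.
    + by move=> [|k] //=; exact: measurable0.
    + by move=> [|k] //=; exact: sub0set.
    + by apply/trivIsetP => -[|i] [|j] //= _ _ _; rewrite ?setI0 ?set0I.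
  - apply/seteqP; split=> [u [[|k]]//|u Du].
    by exists 0%N.
  - by move=> [|k].
  - by apply: nearW => w; rewrite /step_integral big_nil big_ord1 mul0r.
  - by move=> k u _; rewrite /step_fun big_nil.
have [N [B [b [[mB BD tB] BUD B0 LB sB]]]] := IH sD.
(* Cell [k] splits into cell [2k] inside [A] and cell [2k + 1] outside; [c] is added to the
   coefficients of even cells only. *)
pose B' n := if odd n then B n./2 `\` A else B n./2 `&` A.
have odd2 k : odd k.*2 = false by rewrite odd_double.
have oddS2 k : odd k.*2.+1 by rewrite /= odd_double.
have B'E k : B' k.*2 = B k `&` A by rewrite /B' odd2 doubleK.
have B'O k : B' k.*2.+1 = B k `\` A by rewrite /B' oddS2 -[k.*2.+1]/(true + k.*2)%N half_bit_double.
exists N.*2, B', (fun n => b n./2 + if odd n then 0 else c); split.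
- split.
  + move=> k; rewrite /B'; case: ifP => _; first exact: measurableD.
    exact: measurableI.
  + by move=> k u; rewrite /B'; case: ifP => _ [/BD].
  + apply/trivIsetP => i j _ _ ij; rewrite -subset0 => u [].
    have hB n : B' n u -> B n./2 u by rewrite /B'; case: ifP => _ [].
    move=> Bi Bj; have ij2 : i./2 = j./2.
      by apply: tB => //; exists u; split; exact: hB.
    move: Bi Bj; rewrite /B'; case: ifP => oi; case: ifP => oj [_ Au] [_ Au'] //.
      by move/eqP : ij; apply; rewrite -(odd_double_half i) -(odd_double_half j) oi oj ij2.
    by move/eqP : ij; apply; rewrite -(odd_double_half i) -(odd_double_half j) oi oj ij2.
- rewrite -BUD; apply/seteqP; split=> u [k _].
    by rewrite /B'; case: ifP => _ [Bu _]; exists k./2.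
  move=> Bu; have [Au|Au] := pselect (A u).
    by exists k.*2 => //; rewrite B'E.
  by exists k.*2.+1 => //; rewrite B'O.
- move=> k Nk; rewrite /B' B0 ?set0I ?set0D ?if_same//.
  by rewrite -(doubleK N) half_leq.
- have LA : {ae P, forall w, L A w = \sum_(k < N) L (B k `&` A) w}.
    have := @random_measure_additive _ _ _ _ _ _ _ Lgen (fun k => B k `&` A) N.
    rewrite -setI_bigcupl BUD (setIidr AD); apply.
    + by move=> k; exact: measurableI.
    + by move=> k u [_ /AD].
    + exact: trivIset_setIr.
    + by move=> k /B0 ->; rewrite set0I.
  have LBA : {ae P, forall w, forall k, L (B k) w = L (B k `&` A) w + L (B k `\` A) w}.
    apply/ae_foralln => k.
    have UE : (B k `&` A) `|` (B k `\` A) = B k.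
      by rewrite setDE -setIUr setUv setIT.
    have := @random_measureU _ _ _ _ _ _ _ Lgen (B k `&` A) (B k `\` A).
    rewrite UE; apply.
    + exact: measurableI.
    + exact: measurableD.
    + by move=> u [/BD].
    + by move=> u [/BD].
    + by rewrite setDE setIACA setICr setI0.
  apply: filterS3 LB LA LBA => w LB LA LBA.
  rewrite /step_integral big_cons/= -/(step_integral L s w) LB LA.
  rewrite (sum_double (fun k => (b k./2 + (if odd k then 0 else c)) * L (B' k) w)).
  rewrite mulr_sumr -big_split/=; apply: eq_bigr => k _.
  rewrite odd2/= B'E B'O doubleK uphalf_double LBA.
  by ring.
- move=> k u; rewrite /B' => Bu; rewrite /step_fun big_cons/= -/(step_fun s u).
  move: Bu; case: ifP => _ [/sB -> Au].
    by rewrite indicE memNset// mulr0 add0r addr0.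
  by rewrite indicE mem_set// mulr1 addrC.
Qed.

Hypothesis psi_ge0 : forall x, 0 <= psi x.

(** On disjoint cells the integral is a sum of independent terms, whose exponents add up. Frequency
    1 is enough, since [scale_step] absorbs any other. Along a step function [psi] takes finitely
    many values, whence the measurability. *)
Lemma step_integral_cos (s : seq (R * set R)) : step_on D s ->
  measurable_fun D (psi \o step_fun s) /\
  exists J : R, [/\ 0 <= J, (\int[leb]_(u in D) (psi (step_fun s u))%:E = J%:E)%E &
    \int[P]_w cos (step_integral L s w) = expR (- J)].
Proof.
move=> sD; have [N [B [c [[mB BD tB] BUD B0 LB sB]]]] := step_partition sD.
have psiE u : D u -> psi (step_fun s u) = \sum_(k < N) psi (c k) * \1_(B k) u.
  rewrite -BUD => -[k _ Bku]; rewrite (sB _ _ Bku).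
  have kN : (k < N)%N by rewrite ltnNge; apply/negP => /B0 kB0; rewrite kB0 in Bku.
  rewrite (bigD1 (Ordinal kN))//= indicE mem_set// mulr1 big1 ?addr0// => i ik.
  rewrite indicE memNset ?mulr0// => Biu; move/eqP : ik; apply; apply/val_inj => /=.
  by apply: tB => //; exists u.
have mD : measurable D by exact: measurable_itv.
have mterm k : measurable_fun D (fun u => psi (c k) * \1_(B k) u).
  by apply: measurable_funM => //; exact: measurable_indic.
have mpsi : measurable_fun D (psi \o step_fun s).
  apply: (eq_measurable_fun (fun u => \sum_(k < N) psi (c k) * \1_(B k) u)).
    by move=> u; rewrite inE => /psiE /= ->.
  by apply: measurable_sum => k.
split => //.
have lebB k : leb (B k) \is a fin_num.
  by have := lebesgue_measureID_fin T_gt0 (mB k); rewrite setIidl.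
exists (\sum_(k < N) psi (c k) * fine (leb (B k))); split.
- by apply: sumr_ge0 => k _; rewrite mulr_ge0// fine_ge0.
- transitivity (\int[leb]_(u in D) (\sum_(k < N) (psi (c k) * \1_(B k) u)%:E))%E.
    by apply: eq_integral => u; rewrite inE sumEFin => /psiE ->.
  rewrite ge0_integral_sum//; first last.
  - by move=> k u _; rewrite lee_fin mulr_ge0// indicE.
  - by move=> k; apply/measurable_EFinP; exact: mterm.
  rewrite -sumEFin; apply: eq_bigr => k _.
  under eq_integral do rewrite EFinM.
  rewrite ge0_integralZl//; first last.
  - by rewrite lee_fin.
  - by apply/measurable_EFinP; exact: (@measurable_indic _ _ _ D _ (mB k)).
  transitivity ((psi (c k))%:E * leb (B k `&` D))%E.
    by congr (_ * _)%E; refine (eq_trans _ (integral_indicR leb mD (mB k))).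
  rewrite (setIidl (BD k)) EFinM fineK//.
- have ind := random_measure_independent Lgen mB BD tB.
  have hexp k : has_exponent T L psi (B k).
    by apply: measurable_has_exponent Z_cos Z_sin _ _.
  have Ec k : \int[P]_w cos (c k * L (B k) w) = expR (- (fine (leb (B k)) * psi (c k))).
    by have [+ _] := hexp k (c k); rewrite setIidl.
  have Es k : \int[P]_w sin (c k * L (B k) w) = 0.
    by have [_ +] := hexp k (c k); rewrite setIidl.
  have [+ _] := mutually_independent_trig ind Ec Es N.
  rewrite -expR_sum sumrN => E.
  under eq_bigr do rewrite mulrC.
  rewrite -E.
  apply: ae_eq_Rintegral.
  + by have [] := bounded_measurable_cos (measurable_step_integral L s).
  + have mS : measurable_fun setT (fun w => \sum_(i < N) c i * L (B i) w).
      by apply: measurable_sum => i; exact: measurable_funM.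
    by have [] := bounded_measurable_cos mS.
  + by apply: filterS LB => w ->.
Qed.

End step_integral_law.

(** * Fatou's lemma with an approximate lower bound *)

Section fatou_bound.
Context d (X : measurableType d) (R : realType) (m : {measure set X -> \bar R}).

(** No limit of [f_] is asked for, only that it eventually exceed [g - e]. This suits sequences
    built from [psi], which is not assumed continuous. *)
Lemma fatou_bound (D : set X) (f_ : nat -> X -> R) (g : X -> R) (C : \bar R) :
  measurable D -> (forall n, measurable_fun D (f_ n)) ->
  (forall n x, D x -> 0 <= f_ n x) ->
  measurable_fun D g -> (forall x, D x -> 0 <= g x) ->
  {ae m, forall x, D x -> forall e, 0 < e ->
    \forall n \near \oo, g x - e <= f_ n x} ->
  (\forall n \near \oo, (\int[m]_(x in D) (f_ n x)%:E <= C)%E) ->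
  (\int[m]_(x in D) (g x)%:E <= C)%E.
Proof.
move=> mD mf f0 mg g0 gf fC.
have mf' n : measurable_fun D (EFin \o f_ n) by exact/measurable_EFinP.
have lim0 x : D x -> (0 <= limn_einf (fun n => (f_ n x)%:E))%E.
  move=> Dx; rewrite limn_einf_lim; apply: lime_ge; first exact: is_cvg_einfs.
  by apply: nearW => n; apply: le_ereal_inf_tmp => _ [k /= _ <-]; rewrite lee_fin f0.
apply: (@le_trans _ _ (\int[m]_(x in D) limn_einf (fun n => (f_ n x)%:E))%E).
  apply: ae_ge0_le_integral => //.
  - exact/measurable_EFinP.
  - rewrite (_ : (fun x => _) = (fun x => - limn_esup (fun n => - (f_ n x)%:E))%E).
      apply: measurableT_comp => //.
      apply: measurable_fun_limn_esup => n.
      by apply/(@measurable_EFinP _ _ _ _ (fun x => - f_ n x)); exact: measurable_funN.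
    apply/funext => x; rewrite /limn_einf; congr (- limn_esup _)%E.
  apply: filterS gf => x gf Dx; apply/lee_addgt0Pr => e e0.
  rewrite -leeBlDr// limn_einf_lim; apply: lime_ge; first exact: is_cvg_einfs.
  have [N _ NP] := gf Dx e e0.
  exists N => // n /= Nn; apply: le_ereal_inf_tmp => _ [k /= nk <-].
  by rewrite -EFinB lee_fin; apply: NP => /=; exact: leq_trans nk.
apply: (@le_trans _ _ (limn_einf (fun n => \int[m]_(x in D) (f_ n x)%:E))%E).
  apply: (@fatou _ _ _ m D mD (fun n x => (f_ n x)%:E)) => //.
rewrite limn_einf_lim; apply: lime_le; first exact: is_cvg_einfs.
have [N _ NP] := fC.
exists N => // n /= Nn; apply: le_trans (NP n Nn).
by apply: ereal_inf_lbound; exists n => /=.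
Qed.

End fatou_bound.

(** * Characteristic functions and convergence in probability *)

Section characteristic_function.
Context d (Omega : measurableType d) (R : realType) (P : probability Omega R).

Lemma le_norm_cosB (x y : R) : `|cos x - cos y| <= `|x - y|.
Proof.
wlog xy : x y / y <= x.
  by move=> h; case: (leP y x) => [/h//|/ltW/h]; rewrite distrC [leRHS]distrC.
have [] := @MVT_segment R cos (fun t => - sin t) y x xy.
  by apply: continuous_subspaceT; exact: continuous_cos.
move=> c _ ->; rewrite normrM normrN ler_piMl//.
by rewrite ler_norml sin_geN1 sin_le1.
Qed.

Lemma measurable_norm_ge (X Y : Omega -> R) (e : R) :
  measurable_fun setT X -> measurable_fun setT Y ->
  measurable [set w | e <= `|X w - Y w|].
Proof.
move=> mX mY; rewrite -[X in measurable X]setTI.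
apply: measurable_fun_le => //; apply: measurableT_comp => //.
exact: measurable_funB.
Qed.

(** The cosine is 1-Lipschitz, which serves where [X] and [Y] are [e]-close; elsewhere the two
    cosines differ by at most 2. *)
Lemma le_norm_Rintegral_cosB (X Y : Omega -> R) (e : R) :
  measurable_fun setT X -> measurable_fun setT Y -> 0 <= e ->
  `|\int[P]_w cos (X w) - \int[P]_w cos (Y w)| <=
    e + 2 * fine (P [set w | e <= `|X w - Y w|]).
Proof.
move=> mX mY e0; have mA := measurable_norm_ge e mX mY.
set A := [set w | _] in mA *.
have bX := bounded_measurable_cos mX; have bY := bounded_measurable_cos mY.
have bI : bounded_measurable (fun w => e + 2 * \1_A w).
  apply: bounded_measurableD; first exact: bounded_measurable_cst.
  apply: bounded_measurableM; first exact: bounded_measurable_cst.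
  exact: bounded_measurable_indic.
have IE : \int[P]_w (e + 2 * \1_A w) = e + 2 * fine (P A).
  rewrite bounded_RintegralD ?Rintegral_probability_cst; first last.
  - apply: bounded_measurableM; first exact: bounded_measurable_cst.
    exact: bounded_measurable_indic.
  - exact: bounded_measurable_cst.
  rewrite bounded_RintegralZl ?Rintegral_indic//.
  exact: bounded_measurable_indic.
have cosI (x y : R) (w : Omega) : `|x - y| = `|X w - Y w| ->
    cos x - cos y <= e + 2 * \1_A w.
  move=> xy; rewrite indicE; have [Aw|Aw] := pselect (A w).
    rewrite mem_set// mulr1.
    have := cos_le1 x; have := cos_geN1 y; lra.
  rewrite memNset// mulr0 addr0; apply: le_trans (ler_norm _) _.
  apply: le_trans (le_norm_cosB _ _) _; rewrite xy ltW// ltNge.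
  exact/negP.
rewrite -IE ler_norml; apply/andP; split.
  rewrite lerNl opprB -bounded_RintegralB//.
  apply: bounded_le_Rintegral => //; first exact: bounded_measurableB.
  by move=> w; apply: cosI; rewrite distrC.
rewrite -bounded_RintegralB//.
apply: bounded_le_Rintegral => //; first exact: bounded_measurableB.
by move=> w; apply: cosI.
Qed.

Lemma cvg_in_probability_cos (X_ : nat -> Omega -> R) (X : Omega -> R) :
  (forall n, measurable_fun setT (X_ n)) -> measurable_fun setT X ->
  cvg_in_probability P X_ X ->
  \int[P]_w cos (X_ n w) @[n --> \oo] --> \int[P]_w cos (X w).
Proof.
move=> mX_ mX XX; apply/cvgrPdist_le => e e0.
have e2 : 0 < e / 2 by rewrite divr_gt0.
have /fine_cvgP[_ /cvgrPdist_le/(_ (e / 4))] := XX _ e2.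
case=> [|N _ NP]; first by rewrite divr_gt0.
exists N => // n /NP /=; rewrite sub0r normrN => /(le_trans (ler_norm _)) Pe.
rewrite distrC.
apply: le_trans (le_norm_Rintegral_cosB (mX_ n) mX (ltW e2)) _.
by move: Pe; lra.
Qed.

Lemma cvg_in_probabilityZ (c : R) (X_ : nat -> Omega -> R) (X : Omega -> R) :
  cvg_in_probability P X_ X ->
  cvg_in_probability P (fun n w => c * X_ n w) (fun w => c * X w).
Proof.
move=> XX e e0; have [->|c0] := eqVneq c 0.
  rewrite (_ : (fun n => _) = fun=> 0%E); first exact: cvg_cst.
  apply/funext => n; rewrite (_ : [set w | _] = set0) ?measure0//.
  apply/seteqP; split=> w //=.
  by rewrite !mul0r subrr normr0 leNgt e0.
have ec : 0 < e / `|c| by rewrite divr_gt0// normr_gt0.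
have := XX _ ec.
rewrite (_ : (fun n => _) = fun n => P [set w | e <= `|c * X_ n w - c * X w|])//.
apply/funext => n; congr (P _).
apply/seteqP; split=> w /=; rewrite -mulrBr normrM ler_pdivrMr ?normr_gt0// mulrC//.
Qed.

Lemma cvg_in_probabilityB (X_ Y_ : nat -> Omega -> R) (X Y : Omega -> R) :
  (forall n, measurable_fun setT (X_ n)) -> measurable_fun setT X ->
  (forall n, measurable_fun setT (Y_ n)) -> measurable_fun setT Y ->
  cvg_in_probability P X_ X -> cvg_in_probability P Y_ Y ->
  cvg_in_probability P (fun n w => X_ n w - Y_ n w) (fun w => X w - Y w).
Proof.
move=> mX_ mX mY_ mY XX YY e e0.
have e2 : 0 < e / 2 by rewrite divr_gt0.
have h := cvgeD _ (XX _ e2) (YY _ e2).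
rewrite adde0 in h.
apply: (squeeze_cvge _ (cvg_cst _) (h _ _)) => //.
apply: nearW => n; rewrite measure_ge0/=.
have m1 := measurable_norm_ge (e / 2) (mX_ n) mX.
have m2 := measurable_norm_ge (e / 2) (mY_ n) mY.
apply: (@le_trans _ _ (P ([set w | e / 2 <= `|X_ n w - X w|] `|`
                          [set w | e / 2 <= `|Y_ n w - Y w|]))).
  apply: le_measure; rewrite ?inE.
  - apply: measurable_norm_ge; exact: measurable_funB.
  - exact: measurableU.
  - move=> w /= ew; apply/orP; rewrite -implyNb; apply/implyP; rewrite -ltNge => h1.
    have : `|X_ n w - Y_ n w - (X w - Y w)| <= `|X_ n w - X w| + `|Y_ n w - Y w|.
      apply: le_trans (ler_normB _ _); rewrite le_eqVlt; apply/orP; left; apply/eqP.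
      by congr (`|_|); ring.
    by move: h1 ew; lra.
exact: measureU2.
Qed.

End characteristic_function.

Lemma cvg_near_le (R : realType) (u : nat -> R) (l c : R) : u @ \oo --> l ->
  (\forall n \near \oo, u n <= c) -> l <= c.
Proof.
move=> ul uc; rewrite -(cvg_lim (@Rhausdorff R) ul); apply: limr_le => //.
exact: cvgP ul.
Qed.

Lemma cvg_near_ge (R : realType) (u : nat -> R) (l c : R) : u @ \oo --> l ->
  (\forall n \near \oo, c <= u n) -> c <= l.
Proof.
move=> ul uc; rewrite -(cvg_lim (@Rhausdorff R) ul); apply: limr_ge => //.
exact: cvgP ul.
Qed.

(** * Laws of limits of step integrals *)

Section limit_law.
Context d (Omega : measurableType d) (R : realType) (P : probability Omega R).
Context (T : R) (T_gt0 : 0 < T) (Z : R -> {RV P >-> R})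
  (L : set R -> {RV P >-> R}) (Lgen : generated_random_measure Z T L).
Context (psi : R -> R) (kap : R).
Hypothesis Z_cos : forall s t mu, 0 <= s -> s <= t ->
  \int[P]_w cos (mu * (Z t w - Z s w)) = expR (- ((t - s) * psi mu)).
Hypothesis Z_sin : forall s t mu, 0 <= s -> s <= t ->
  \int[P]_w sin (mu * (Z t w - Z s w)) = 0.
Hypothesis psi_ge0 : forall x, 0 <= psi x.
Hypothesis psi_subadd : forall x y, psi (x + y) <= 2 * psi x + 2 * psi y.
Hypothesis psi_le : forall x, psi x <= kap * x ^+ 2.

Local Notation D := (`]0, T]%classic : set R).
Local Notation leb := (@lebesgue_measure R).

Context (s_ : nat -> seq (R * set R)) (W : {RV P >-> R}) (g h : R -> R) (V : R).
Hypothesis s_D : forall n, step_on D (s_ n).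
Hypothesis s_W : cvg_in_probability P (fun n => step_integral L (s_ n)) W.
Hypothesis s_g : {ae leb, forall u, D u ->
  step_fun (s_ n) u @[n --> \oo] --> g u}.
Hypothesis mh : measurable_fun (D : set (measurableTypeR R)) (h : measurableTypeR R -> R).
Hypothesis h_ge0 : forall u, D u -> 0 <= h u.
Hypothesis g_h : {ae leb, forall u, D u -> g u ^+ 2 <= h u}.
Hypothesis h_V : (\int[leb]_(u in D) (h u)%:E <= V%:E)%E.

(* The exponent of the integral of [step n - step m] is small because its
   characteristic function is close to 1, the integrals being Cauchy in probability. *)
Lemma step_cauchy (mu eta : R) : 0 < eta -> \forall N \near \oo,
  forall n m, (N <= n)%N -> (N <= m)%N ->
  (\int[leb]_(u in D) (psi (mu * (step_fun (s_ n) u - step_fun (s_ m) u)))%:E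
    <= eta%:E)%E.
Proof.
move=> eta0.
(* The bound [J <= eta] amounts to [1 - expR (- J) <= dlt]. Each of the two integrals is within
   [dlt / 4] of its limit outside an event of probability at most [dlt / 8], so that
   [le_norm_Rintegral_cosB] with [e = dlt / 2] yields [dlt / 2 + 2 * (dlt / 4)]. *)
pose dlt := 1 - expR (- eta).
have dlt0 : 0 < dlt by rewrite subr_gt0 expR_lt1 oppr_lt0.
have := cvg_in_probabilityZ mu s_W => muW.
have d4 : 0 < dlt / 4 by rewrite divr_gt0.
have /fine_cvgP[_ /cvgrPdist_le/(_ (dlt / 8))] := muW _ d4.
case=> [|N _ NP]; first by rewrite divr_gt0.
exists N => // N' /= NN' n m N'n N'm.
pose s := scale_step mu (s_ n) ++ scale_step (- mu) (s_ m).
have sD : step_on D s by apply: step_on_cat; exact: step_on_scale.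
have [_ [J [J0 JE EJ]]] := step_integral_cos T_gt0 Lgen Z_cos Z_sin psi_ge0 sD.
under eq_integral => u _.
  rewrite (_ : mu * _ = step_fun s u); last first.
    by rewrite /s step_fun_cat !step_fun_scale; ring.
  over.
rewrite JE lee_fin.
have PN k : (N' <= k)%N ->
    fine (P [set w | dlt / 4 <= `|mu * step_integral L (s_ k) w - mu * W w|]) <= dlt / 8.
  by move=> N'k; have := NP k (leq_trans NN' N'k); rewrite /= sub0r normrN; exact: le_trans (ler_norm _).
have mS k : measurable_fun setT (fun w => mu * step_integral L (s_ k) w).
  by apply: measurable_funM => //; exact: measurable_step_integral.
have mW : measurable_fun setT (fun w => mu * W w) by exact: measurable_funM.
have mSS : measurable_fun setT (step_integral L s) by exact: measurable_step_integral.
have m1 := measurable_norm_ge (dlt / 4) (mS n) mW.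
have m2 := measurable_norm_ge (dlt / 4) (mS m) mW.
have d2 : 0 <= dlt / 2 by rewrite divr_ge0// ltW.
have := le_norm_Rintegral_cosB P mSS (measurable_cst (0 : R)) d2.
rewrite [X in `|_ - X|](_ : _ = 1) ?EJ; last first.
  by rewrite /= cos0 Rintegral_probability_cst.
rewrite /=.
have : fine (P [set w | dlt / 2 <= `|step_integral L s w - 0|]) <= dlt / 8 + dlt / 8.
  apply: le_trans (lerD (PN n N'n) (PN m N'm)).
  rewrite -fineD ?fin_num_measure// fine_le ?fin_num_measure//.
  - exact: (measurable_norm_ge _ mSS (measurable_cst (0 : R))).
  - by rewrite fin_numD !fin_num_measure.
  apply: (@le_trans _ _ (P ([set w | dlt / 4 <= `|mu * step_integral L (s_ n) w - mu * W w|] `|`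
                            [set w | dlt / 4 <= `|mu * step_integral L (s_ m) w - mu * W w|]))).
    apply: le_measure; rewrite ?inE.
    - exact: (measurable_norm_ge _ mSS (measurable_cst (0 : R))).
    - exact: measurableU.
    - move=> w /= ew; apply/orP; rewrite -implyNb; apply/implyP; rewrite -ltNge => h1.
      have : `|step_integral L s w - 0| <= `|mu * step_integral L (s_ n) w - mu * W w| +
           `|mu * step_integral L (s_ m) w - mu * W w|.
        apply: le_trans (ler_normB _ _); rewrite le_eqVlt; apply/orP; left; apply/eqP.
        by congr (`|_|); rewrite /s step_integral_cat !step_integral_scale; ring.
      by move: h1 ew; lra.
  exact: measureU2.
have : expR (- J) <= 1 by rewrite expR_le1 oppr_le0.
rewrite distrC => Jle1 h1; rewrite ger0_norm ?subr_ge0// => h2.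
have : expR (- eta) <= expR (- J) by move: h1 h2; rewrite /dlt; lra.
by rewrite ler_expR lerN2.
Qed.

(* [psi (step n) <= 2 psi (step n - step m) + 2 kap (step m) ^ 2]: let m tend to
   infinity and apply Fatou's lemma. *)
Lemma step_exponent_le (mu eta : R) : 0 < eta -> \forall n \near \oo,
  (\int[leb]_(u in D) (psi (mu * step_fun (s_ n) u))%:E
    <= (eta + 2 * (kap * mu ^+ 2) * V)%:E)%E.
Proof.
move=> eta0; have eta2 : 0 < eta / 2 by rewrite divr_gt0.
have kap0 : 0 <= kap.
  by have := le_trans (psi_ge0 1) (psi_le 1); rewrite expr1n mulr1.
have [N _ NP] := step_cauchy mu eta2.
have mD : measurable D by exact: measurable_itv.
pose k2 := 2 * (kap * mu ^+ 2).
have k20 : 0 <= k2 by rewrite mulr_ge0// mulr_ge0// sqr_ge0.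
have mpsi n m : measurable_fun (D : set (measurableTypeR R)) (fun u =>
    psi (mu * (step_fun (s_ n) u - step_fun (s_ m) u))).
  pose s := scale_step mu (s_ n) ++ scale_step (- mu) (s_ m).
  have sD : step_on D s by apply: step_on_cat; exact: step_on_scale.
  have [+ _] := step_integral_cos T_gt0 Lgen Z_cos Z_sin psi_ge0 sD.
  apply: eq_measurable_fun => u _ /=; congr psi.
  by rewrite /s step_fun_cat !step_fun_scale; ring.
have mpsi1 n : measurable_fun (D : set (measurableTypeR R)) (fun u => psi (mu * step_fun (s_ n) u)).
  have sD : step_on D (scale_step mu (s_ n)) by exact: step_on_scale.
  have [+ _] := step_integral_cos T_gt0 Lgen Z_cos Z_sin psi_ge0 sD.
  by apply: eq_measurable_fun => u _ /=; congr psi; rewrite step_fun_scale.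
exists N => // n /= Nn.
apply: (@fatou_bound _ (measurableTypeR R) R leb D (fun m u =>
  2 * psi (mu * (step_fun (s_ n) u - step_fun (s_ m) u)) + k2 * h u)
  (fun u => psi (mu * step_fun (s_ n) u))) => //.
- move=> m; apply: measurable_funD; first by apply: measurable_funM.
  exact: measurable_funM.
- by move=> m u Du; rewrite addr_ge0// mulr_ge0// h_ge0.
- have FF : Filter (almost_everywhere leb) by exact: (ae_filter_ringOfSetsType leb).
  apply: filterS2 s_g g_h => u sgu ghu Du e e0.
  have gu : k2 * step_fun (s_ m) u ^+ 2 @[m --> \oo] --> k2 * g u ^+ 2.
    by apply: cvgM; [exact: cvg_cst|apply: cvgM; exact: sgu].
  have /cvgrPdist_le/(_ e e0) := gu.
  apply: filterS => m; rewrite ler_distlC => /andP[_ gm].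
  have := psi_subadd (mu * (step_fun (s_ n) u - step_fun (s_ m) u))
                     (mu * step_fun (s_ m) u).
  rewrite -mulrDr subrK.
  have := psi_le (mu * step_fun (s_ m) u); rewrite exprMn.
  have : k2 * g u ^+ 2 <= k2 * h u by rewrite ler_wpM2l// ghu.
  by move: gm; rewrite /k2; lra.
- exists N => // m /= Nm.
  under eq_integral do rewrite EFinD.
  rewrite ge0_integralD//; first last.
  + by apply/measurable_EFinP; exact: measurable_funM.
  + by move=> u Du; rewrite lee_fin mulr_ge0// h_ge0.
  + by apply/measurable_EFinP; apply: measurable_funM.
  + by move=> u Du; rewrite lee_fin mulr_ge0.
  under eq_integral do rewrite EFinM.
  under [X in (_ + X)%E]eq_integral do rewrite EFinM.
  rewrite ge0_integralZl//; first last.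
  + by move=> u Du; rewrite lee_fin.
  + by apply/measurable_EFinP.
  rewrite ge0_integralZl//; last by apply/measurable_EFinP.
  rewrite [X in (_ <= X)%E]EFinD; apply: leeD.
    apply: (@le_trans _ _ (2%:E * (eta / 2)%:E)%E).
      by apply: lee_wpmul2l => //; exact: (NP N (leqnn N) n m Nn Nm).
    by rewrite -EFinM lee_fin mulrC divfK.
  by rewrite -/k2 [X in (_ <= X)%E]EFinM; apply: lee_wpmul2l.
Qed.

(** Characteristic functions pass to limits in probability, and [step_exponent_le] bounds the
    exponents of the approximations up to an arbitrary [eta]. The factor 2 stems from
    [psi_subadd]. *)
Lemma cos_limit_ge mu : expR (- (2 * (kap * mu ^+ 2) * V)) <= \int[P]_w cos (mu * W w).
Proof.
have mS k : measurable_fun setT (fun w => mu * step_integral L (s_ k) w).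
  by apply: measurable_funM => //; exact: measurable_step_integral.
have mW : measurable_fun setT (fun w => mu * W w) by exact: measurable_funM.
have cW := cvg_in_probability_cos mS mW (cvg_in_probabilityZ mu s_W).
set C := 2 * (kap * mu ^+ 2) * V.
suff : forall eta, 0 < eta -> expR (- (eta + C)) <= \int[P]_w cos (mu * W w).
  move=> H.
  have h1 : expR (- (n.+1%:R^-1 + C)) @[n --> \oo] --> expR (- (0 + C)).
    apply: continuous_cvg; first exact: continuous_expR.
    apply: cvgN; apply: cvgD; last exact: cvg_cst.
    exact: cvg_harmonic.
  rewrite add0r in h1; apply: (cvg_near_le h1).
  by apply: nearW => n; apply: H; rewrite invr_gt0.
move=> eta eta0; apply: (cvg_near_ge cW).
have := step_exponent_le mu eta0; apply: filterS => n.
have sD : step_on D (scale_step mu (s_ n)) by exact: step_on_scale.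
have [_ [J [J0 JE EJ]]] := step_integral_cos T_gt0 Lgen Z_cos Z_sin psi_ge0 sD.
under eq_integral do rewrite -step_fun_scale.
rewrite JE lee_fin => JC.
under eq_Rintegral do rewrite -step_integral_scale.
by rewrite EJ ler_expR lerN2.
Qed.

(** A quadratic [psi] gives each step integral a Gaussian characteristic function with parameter
    [J n]. Convergence at the single frequency 1, to a limit [c] that is positive by [cos_limit_ge],
    forces [J n] to converge to [- ln c], and all other frequencies follow. Here [v] is half the
    variance. *)
Lemma gaussian_limit (psi_sqr : forall x, psi x = kap * x ^+ 2) :
  exists v, [/\ 0 <= v, v <= 2 * kap * V &
    forall mu, \int[P]_w cos (mu * W w) = expR (- (v * mu ^+ 2))].
Proof.
have J_ n : {J : R | [/\ 0 <= J,
    (\int[leb]_(u in D) (psi (step_fun (s_ n) u))%:E = J%:E)%E &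
    forall mu, \int[P]_w cos (mu * step_integral L (s_ n) w) = expR (- (J * mu ^+ 2))]}.
  apply: cid; have [mp [J [J0 JE EJ]]] :=
    step_integral_cos T_gt0 Lgen Z_cos Z_sin psi_ge0 (s_D n).
  exists J; split => // mu.
  have sD : step_on D (scale_step mu (s_ n)) by exact: step_on_scale.
  have [_ [J' [_ + EJ']]] := step_integral_cos T_gt0 Lgen Z_cos Z_sin psi_ge0 sD.
  under eq_Rintegral do rewrite -step_integral_scale.
  rewrite EJ'; under eq_integral => u _.
    rewrite step_fun_scale psi_sqr exprMn mulrCA -psi_sqr EFinM; over.
  rewrite ge0_integralZl//; first last.
  - by rewrite lee_fin sqr_ge0.
  - by move=> u _; rewrite lee_fin.
  - exact/measurable_EFinP.
  by rewrite JE -EFinM => -[<-]; rewrite mulrC.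
pose J n := sval (J_ n).
have mS mu k : measurable_fun setT (fun w => mu * step_integral L (s_ k) w).
  by apply: measurable_funM => //; exact: measurable_step_integral.
have mW mu : measurable_fun setT (fun w => mu * W w) by exact: measurable_funM.
have cW mu : expR (- (J n * mu ^+ 2)) @[n --> \oo] --> \int[P]_w cos (mu * W w).
  have := cvg_in_probability_cos (mS mu) (mW mu) (cvg_in_probabilityZ mu s_W).
  rewrite (_ : (fun n => _) = fun n => expR (- (J n * mu ^+ 2)))//.
  by apply/funext => n; rewrite /J; case: (J_ n) => j [_ _ /= ->].
pose c := \int[P]_w cos (1 * W w).
have c0 : 0 < c by apply: lt_le_trans (cos_limit_ge 1); exact: expR_gt0.
have c1 : c <= 1.
  apply: (cvg_near_le (cW 1)); apply: nearW => n.
  by rewrite expR_le1 oppr_le0 /J; case: (J_ n) => j [j0 _ _] /=; rewrite mulr_ge0// sqr_ge0.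
have Jc : J n @[n --> \oo] --> - ln c.
  rewrite (_ : J = fun n => - ln (expR (- (J n * 1 ^+ 2)))); last first.
    by apply/funext => n; rewrite expRK opprK expr1n mulr1.
  by apply: cvgN; apply: continuous_cvg (cW 1); exact: continuous_ln.
exists (- ln c); split.
- by rewrite oppr_ge0 ln_le0.
- rewrite lerNl -ler_expR lnK ?posrE//; apply: le_trans (cos_limit_ge 1).
  by rewrite ler_expR expr1n mulr1.
- move=> mu; apply: (cvg_unique (@Rhausdorff R) (cW mu)).
  apply: continuous_cvg; first exact: continuous_expR.
  by apply: cvgN; apply: cvgM; [exact: Jc|exact: cvg_cst].
Qed.

End limit_law.

(** * Moments from characteristic functions *)

Section moments.
Context (R : realType).

Lemma sin_mean_value (x : R) : exists2 c, `|c| <= `|x| & sin x = cos c * x.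
Proof.
wlog x0 : x / 0 <= x.
  move=> h; case: (leP 0 x) => [/h//|x0].
  have [|c cx sx] := h (- x); first by rewrite oppr_ge0 ltW.
  exists c; first by rewrite -(normrN x).
  by apply: oppr_inj; rewrite -sinN sx mulrN.
have [] := @MVT_segment R sin cos 0 x x0.
  by apply: continuous_subspaceT; exact: continuous_sin.
move=> c; rewrite in_itv/= => /andP[c0 cx]; rewrite sin0 !subr0 => sx.
by exists c => //; rewrite !ger0_norm.
Qed.

Lemma cosDB (x h : R) : cos (x + h) + cos (x - h) = 2 * cos x * cos h.
Proof. by rewrite cosD cosB; ring. Qed.

(** [2 - 2 cos] is [4 sin ^ 2] of the half angle [x n], and [sin (x n) = cos (c n) * x n] with [c n]
    tending to 0. *)
Lemma cvg_second_difference_cos (w : R) :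
  (2 - 2 * cos (n.+1%:R^-1 * w)) * n.+1%:R ^+ 2 @[n --> \oo] --> w ^+ 2.
Proof.
pose x n := n.+1%:R^-1 * w / 2.
have /choice[c cP] n : exists c, `|c| <= `|x n| /\ sin (x n) = cos c * x n.
  by have [c c1 c2] := sin_mean_value (x n); exists c.
have xE n : (2 - 2 * cos (n.+1%:R^-1 * w)) * n.+1%:R ^+ 2 = w ^+ 2 * cos (c n) ^+ 2.
  have -> : n.+1%:R^-1 * w = x n + x n by rewrite /x -splitr.
  have := cos2Dsin2 (x n); rewrite cosD (cP n).2 => cs.
  have nz : n.+1%:R != 0 :> R by rewrite pnatr_eq0.
  have -> : 2 - 2 * (cos (x n) * cos (x n) - cos (c n) * x n * (cos (c n) * x n)) =
     4 * (cos (c n) * x n) ^+ 2 by move: cs; rewrite !expr2; lra.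
  by rewrite /x; move: nz; move: (n.+1%:R : R) => N N0; field.
have x0 : x n @[n --> \oo] --> 0.
  rewrite -(mul0r (w / 2)); under eq_fun do rewrite /x -mulrA.
  by apply: cvgM; [exact: cvg_harmonic|exact: cvg_cst].
have cc : cos (c n) @[n --> \oo] --> (1 : R).
  apply/cvgrPdist_le => e e0.
  have /cvgrPdist_le/(_ e e0) := x0; apply: filterS => n.
  rewrite sub0r normrN => xe; rewrite -cos0; apply: le_trans (le_norm_cosB _ _) _.
  by rewrite sub0r normrN; exact: le_trans (cP n).1 xe.
rewrite (_ : (fun n => _) = fun n => w ^+ 2 * cos (c n) ^+ 2); last exact/funext.
have : w ^+ 2 * cos (c n) ^+ 2 @[n --> \oo] --> w ^+ 2 * (1 * 1).
  by apply: cvgM; [exact: cvg_cst|exact: cvgM].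
by rewrite !mulr1.
Qed.

(** The sign is opposite to the usual one: on [cos (mu * w)], as a function of [mu], the operator is
    multiplication by the nonnegative number [2 - 2 * cos (h * w)]. *)
Definition second_difference (h : R) (f : R -> R) (x : R) : R :=
  2 * f x - f (x + h) - f (x - h).

(** Mean value theorem on either side of [x], then for [f'] between the two intermediate points.
    Their distance is only known to be at most [2 * h], whence the factor 2. *)
Lemma le_second_difference (f f' f'' : R -> R) (x h C : R) :
  0 <= h -> 
  (forall y : R, is_derive y 1 f (f' y)) -> (forall y : R, is_derive y 1 f' (f'' y)) ->
  (forall y, `|y - x| <= h -> `|f'' y| <= C) ->
  `|second_difference h f x| <= 2 * h ^+ 2 * C.
Proof.
move=> h0 df df' f''C.
have C0 : 0 <= C by apply: le_trans (f''C x _); rewrite ?subrr ?normr0.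
have cont (u u' : R -> R) : (forall y : R, is_derive y 1 u (u' y)) -> continuous u.
  by move=> du y; apply/differentiable_continuous/derivable1_diffP; have [] := du y.
have mvt (u u' : R -> R) (a b : R) : (forall y : R, is_derive y 1 u (u' y)) -> a <= b ->
    exists2 c, a <= c <= b & u b - u a = u' c * (b - a).
  move=> du ab; have [] := @MVT_segment R u u' a b ab.
  - by apply: continuous_subspaceT; exact: cont du.
  - by move=> c; rewrite in_itv/=; exists c.
have [|a /andP[xa ah] fa] := mvt f f' x (x + h) df; first lra.
have [|b /andP[hb bx] fb] := mvt f f' (x - h) x df; first lra.
have [|c /andP[bc ca] fc] := mvt f' f'' b a df'; first lra.
have -> : second_difference h f x = - (f'' c * (a - b) * h).
  rewrite /second_difference -fc mulrBl.
  have -> : f' a * h = f (x + h) - f x by rewrite fa; congr (_ * _); ring.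
  have -> : f' b * h = f x - f (x - h) by rewrite fb; congr (_ * _); ring.
  by ring.
rewrite normrN !normrM (ger0_norm h0).
have -> : 2 * h ^+ 2 * C = C * (2 * h) * h by ring.
rewrite ler_wpM2r// ler_pM//.
  apply: f''C; rewrite ler_norml; lra.
rewrite ger0_norm; lra.
Qed.

(** [F] lists a function with its successive derivatives. Differences commute with derivation, so
    the induction replaces the whole list by its differences; each round uses up two derivatives and
    shrinks the radius [M] by [h]. *)
Lemma le_iter_second_difference (k : nat) (F : nat -> R -> R) (h M C x : R) :
  0 <= h -> (forall i (y : R), is_derive y 1 (F i) (F i.+1 y)) ->
  (forall y, `|y| <= M -> `|F k.*2 y| <= C) -> `|x| + k%:R * h <= M ->
  `|iter k (second_difference h) (F 0%N) x| <= (2 * h ^+ 2) ^+ k * C.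
Proof.
move=> h0; elim: k F M C x => [|k IH] F M C x dF FC xM.
  rewrite expr0 mul1r; apply: FC.
  by move: xM; rewrite mul0r addr0.
rewrite iterSr exprSr -mulrA.
apply: (IH (fun i => second_difference h (F i)) (M - h)).
- move=> i y; rewrite /second_difference.
  have dshift (c : R) : is_derive y 1 (fun z => F i (z + c)) (F i.+1 (y + c)).
    have := @is_derive1_comp _ (F i) (fun z => z + c) y (F i.+1 (y + c)) 1 (dF _ _).
    rewrite mulr1; apply.
    by apply: is_derive_eq; rewrite addr0.
  have := is_deriveB (is_deriveB (is_deriveZ 2 (dF i y)) (dshift h)) (dshift (- h)).
  by [].
- move=> y yM; apply: le_second_difference h0 (dF _) (dF _) _ => z zy.
  rewrite -doubleS; apply: FC.
  have := ler_normD (z - y) y; rewrite subrK; lra.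
- by move: xM; rewrite -natr1 mulrDl mul1r; lra.
Qed.

(* Iterated derivatives of [exp (- x ^ 2)], by the three term recurrence of the
   Hermite polynomials. *)
Fixpoint hermite_pair (n : nat) (x : R) : R * R :=
  if n is n'.+1 then
    let: (a, b) := hermite_pair n' x in (b, - (2 * x * b) - 2 * n'.+1%:R * a)
  else (expR (- x ^+ 2), - (2 * x * expR (- x ^+ 2))).

Definition hermite n x := (hermite_pair n x).1.

Lemma hermiteSS n x : hermite n.+2 x =
  - (2 * x * hermite n.+1 x) - 2 * n.+1%:R * hermite n x.
Proof. by rewrite /hermite /=; case: (hermite_pair n x). Qed.

Lemma is_derive_hermite n (x : R) : is_derive x 1 (hermite n) (hermite n.+1 x).
Proof.
suff : is_derive x 1 (hermite n) (hermite n.+1 x) /\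
       is_derive x 1 (hermite n.+1) (hermite n.+2 x) by case.
have d0 (y : R) : is_derive y 1 (hermite 0) (hermite 1 y).
  rewrite /hermite /=.
  have := @is_derive1_comp _ (@expR R) (fun z => - z ^+ 2) y _ _ (is_derive_expR _) _.
  move=> /(_ (- (2 * y))).
  rewrite [in X in _ -> X](_ : - (2 * y * _) = expR (- y ^+ 2) * - (2 * y)); last by ring.
  apply.
  have := is_deriveN (is_deriveX 2 (is_derive_id y (1 : R))).
  rewrite (_ : - (_%:A) = - (2 * y)) //.
  by rewrite expr1 /GRing.scale/=; ring.
elim: n => [|n [IH1 IH2]]; split => //.
- rewrite (_ : hermite 1 = fun z => - (2 * z * hermite 0 z)); last by [].
  apply: is_derive_eq.
  by rewrite hermiteSS /GRing.scale/=; ring.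
- rewrite (_ : hermite n.+2 = fun z => - (2 * z * hermite n.+1 z) - 2 * n.+1%:R * hermite n z); last first.
    by apply/funext => z; exact: hermiteSS.
  apply: is_derive_eq.
  by rewrite !hermiteSS /GRing.scale/= -!natr1; ring.
Qed.

Lemma hermite_bounded n (M : R) : exists C, forall y, `|y| <= M -> `|hermite n y| <= C.
Proof.
have [M0|M0] := leP 0 M; last first.
  by exists 0 => y yM; have := le_lt_trans yM M0; rewrite ltNge normr_ge0.
have ch : continuous (fun y => `|hermite n y|).
  move=> y; apply: continuous_comp; last exact: norm_continuous.
  by apply/differentiable_continuous/derivable1_diffP; have [] := is_derive_hermite n y.
have [||c _ cP] := @EVT_max R (fun y => `|hermite n y|) (- M) M.
- lra.
- exact: continuous_subspaceT.
- by exists `|hermite n c| => y yM; apply: cP; rewrite in_itv/= -ler_norml.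
Qed.

End moments.

(** * Even moments from differences of the characteristic function at 0 *)

Section moment_bounds.
Context d (Omega : measurableType d) (R : realType) (P : probability Omega R).

Lemma bounded_measurable_exp f k : @bounded_measurable _ Omega R f ->
  bounded_measurable (fun w => f w ^+ k).
Proof.
move=> bf; elim: k => [|k IH].
  by under eq_fun do rewrite expr0; exact: bounded_measurable_cst.
by under eq_fun do rewrite exprS; exact: bounded_measurableM.
Qed.

Lemma iter_second_difference_cos (W : {RV P >-> R}) (phi : R -> R) (h : R) k mu :
  (forall mu, \int[P]_w cos (mu * W w) = phi mu) ->
  iter k (second_difference h) phi mu =
  \int[P]_w ((2 - 2 * cos (h * W w)) ^+ k * cos (mu * W w)).
Proof.
move=> Wphi; have mW c : measurable_fun setT (fun w => c * W w) by exact: measurable_funM.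
have bc c := bounded_measurable_cos (mW c).
have b2 : bounded_measurable (fun w => 2 - 2 * cos (h * W w)).
  apply: bounded_measurableB; first exact: bounded_measurable_cst.
  by apply: bounded_measurableM => //; exact: bounded_measurable_cst.
have bk j c : bounded_measurable (fun w => (2 - 2 * cos (h * W w)) ^+ j * cos (c * W w)).
  by apply: bounded_measurableM => //; exact: bounded_measurable_exp.
elim: k mu => [|k IH] mu.
  by rewrite /= -Wphi; apply: eq_Rintegral => w _; rewrite expr0 mul1r.
rewrite iterS /second_difference !IH -bounded_RintegralZl//.
rewrite -bounded_RintegralB//; last first.
  by apply: bounded_measurableM => //; exact: bounded_measurable_cst.
rewrite -bounded_RintegralB//; last first.
  apply: bounded_measurableB => //.
  by apply: bounded_measurableM => //; exact: bounded_measurable_cst.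
apply: eq_Rintegral => w _.
rewrite [(mu + h) * _]mulrDl [(mu - h) * _]mulrBl exprSr.
have := cosDB (mu * W w) (h * W w).
set A := cos (_ + _); set B := cos (_ - _); set c := cos _; set e := cos _ => AB.
transitivity ((2 - 2 * e) ^+ k * (2 * c - (A + B))); first by ring.
by rewrite AB; ring.
Qed.

(** With [h = 1 / (n + 1)], the functions [((2 - 2 cos (h W)) / h ^ 2) ^ k] converge to
    [(W ^ 2) ^ k]. By Fatou's lemma, finiteness of the moment is part of the conclusion. *)
Lemma le_moment (W : {RV P >-> R}) k (C : R) :
  (\forall n \near \oo, \int[P]_w ((2 - 2 * cos (n.+1%:R^-1 * W w)) ^+ k) <=
     C / (n.+1%:R ^+ 2) ^+ k) ->
  (\int[P]_w ((W w ^+ 2) ^+ k)%:E <= C%:E)%E.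
Proof.
move=> WC; have mW c : measurable_fun setT (fun w => c * W w) by exact: measurable_funM.
have bf n : bounded_measurable (fun w => (2 - 2 * cos (n.+1%:R^-1 * W w)) ^+ k).
  apply: bounded_measurable_exp.
  apply: bounded_measurableB; first exact: bounded_measurable_cst.
  by apply: bounded_measurableM; [exact: bounded_measurable_cst|exact: bounded_measurable_cos].
pose f n w := (n.+1%:R ^+ 2) ^+ k * (2 - 2 * cos (n.+1%:R^-1 * W w)) ^+ k.
have bF n : bounded_measurable (f n).
  by apply: bounded_measurableM => //; exact: bounded_measurable_cst.
apply: (@fatou_bound _ _ _ P setT f) => //.
- by move=> n; have [] := bF n.
- move=> n w _; have := cos_le1 (n.+1%:R^-1 * W w) => c1.
  by rewrite /f mulr_ge0// exprn_ge0//; lra.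
- by do 2! apply: measurable_funX.
- by move=> w _; rewrite exprn_ge0// sqr_ge0.
- apply: nearW => w _ e e0.
  have : f n w @[n --> \oo] --> (W w ^+ 2) ^+ k.
    rewrite (_ : (fun n => _) = fun n =>
      ((2 - 2 * cos (n.+1%:R^-1 * W w)) * n.+1%:R ^+ 2) ^+ k); last first.
      by apply/funext => n; rewrite /f [RHS]exprMn mulrC.
    apply: (continuous_cvg _ (@exprn_continuous _ k _)).
    exact: cvg_second_difference_cos.
  move=> /cvgrPdist_le/(_ e e0); apply: filterS => n.
  by rewrite ler_distlC => /andP[].
- apply: filterS WC => n WC.
  rewrite -bounded_EFin_Rintegral// lee_fin bounded_RintegralZl//.
  by rewrite mulrC -ler_pdivlMr// exprn_gt0// exprn_gt0.
Qed.

(** Rescaling the frequency by the square root of [v] turns the characteristic function into the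
    fixed function [hermite 0], so that [C] depends on [k] alone and [v] enters through the step of
    the differences. *)
Lemma gaussian_moment k : exists2 C, 0 <= C & forall (W : {RV P >-> R}) v, 0 <= v ->
  (forall mu, \int[P]_w cos (mu * W w) = expR (- (v * mu ^+ 2))) ->
  (\int[P]_w ((W w ^+ 2) ^+ k)%:E <= (C * v ^+ k)%:E)%E.
Proof.
(* Radius [k]: a [k]-fold difference at 0 with step at most 1, as holds for large [n], stays within
   this distance. *)
have [C HC] := @hermite_bounded R k.*2 k%:R.
have C0 : 0 <= C by apply: le_trans (HC 0 _); rewrite ?normr0.
exists (2 ^+ k * C) => [|W v v0 Wv]; first by rewrite mulr_ge0// exprn_ge0.
apply: le_moment.
have : Num.sqrt v * n.+1%:R^-1 @[n --> \oo] --> Num.sqrt v * 0.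
  by apply: cvgM; [exact: cvg_cst|exact: cvg_harmonic].
rewrite mulr0 => /cvgrPdist_le/(_ 1 ltr01); apply: filterS => n.
rewrite sub0r normrN; set h := Num.sqrt v * _ => h1.
have h0 : 0 <= h by rewrite mulr_ge0// sqrtr_ge0.
rewrite ger0_norm// in h1.
have := iter_second_difference_cos (n.+1%:R^-1) k 0 Wv.
under [X in _ = X -> _]eq_Rintegral do rewrite mul0r cos0 mulr1.
move=> <-.
have scale j x : iter j (second_difference n.+1%:R^-1) (fun mu => expR (- (v * mu ^+ 2))) x =
    iter j (second_difference h) (hermite 0) (Num.sqrt v * x).
  elim: j x => [|j IH] x.
    by rewrite /= /hermite /= exprMn sqr_sqrtr.
  by rewrite !iterS /second_difference !IH mulrDr mulrBr.
rewrite scale mulr0.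
apply: le_trans (ler_norm _) _.
apply: le_trans (le_iter_second_difference h0 (@is_derive_hermite R) HC _) _.
  by rewrite normr0 add0r ler_piMr.
have -> : 2 * h ^+ 2 = 2 * v / n.+1%:R ^+ 2.
  by rewrite /h exprMn sqr_sqrtr// exprVn mulrA.
move: (n.+1%:R ^+ 2) => N.
rewrite le_eqVlt; apply/orP; left; apply/eqP.
rewrite [in LHS]exprMn [in LHS]exprMn exprVn.
by move: (2 ^+ k) (v ^+ k) ((N ^+ k)^-1) => *; ring.
Qed.

End moment_bounds.

(** * The sub-fractional kernel *)

Lemma cvge_le_near (R : realType) (u : nat -> \bar R) (l c : \bar R) : u @ \oo --> l ->
  (\forall n \near \oo, (u n <= c)%E) -> (l <= c)%E.
Proof.
move=> ul uc; rewrite -(cvg_lim (@ereal_hausdorff R) ul); apply: lime_le => //.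
exact: cvgP ul.
Qed.

(** * Integrals of powers that are singular at an endpoint *)

Section power_integrals.
Context (R : realType).
Local Notation leb := (@lebesgue_measure R).

Lemma ge0_lebesgue_integralZl (D : set (measurableTypeR R)) (k : R)
    (f : measurableTypeR R -> R) : measurable D -> measurable_fun D f ->
  (forall x, D x -> 0 <= f x) -> 0 <= k ->
  (\int[leb]_(x in D) (k * f x)%:E = k%:E * \int[leb]_(x in D) (f x)%:E)%E.
Proof.
move=> mD mf f0 k0; under eq_integral do rewrite EFinM.
rewrite ge0_integralZl//; exact/measurable_EFinP.
Qed.

Lemma FTC_is_derive (f F : R -> R) (a b : R) : a <= b ->
  (forall x : R, a <= x <= b -> is_derive x 1 F (f x)) ->
  (forall x : R, a <= x <= b -> {for x, continuous f}) ->
  (\int[leb]_(x in `[a, b]) (f x)%:E = (F b - F a)%:E)%E.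
Proof.
rewrite le_eqVlt => /predU1P[<- _ _|ab dF cf].
  by rewrite set_itv1 integral_set1 subrr.
have cF x : a <= x <= b -> {for x, continuous F}.
  move=> /dF dFx; apply/differentiable_continuous/derivable1_diffP.
  by have [] := dFx.
rewrite (@continuous_FTC2 _ f F a b)//.
- apply: continuous_in_subspaceT => x; rewrite inE/= in_itv/= => xab.
  exact: cf.
- split.
  + by move=> x; rewrite in_itv/= => /andP[ax xb]; have [] := dF x; rewrite ?ltW.
  + by apply: cvg_at_right_filter; apply: cF; rewrite lexx ltW.
  + by apply: cvg_at_left_filter; apply: cF; rewrite lexx ltW.
- move=> x; rewrite in_itv/= => /andP[ax xb]; rewrite derive1E.
  by have [|_ ->] := dF x; rewrite ?(ltW ax) ?(ltW xb).
Qed.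

(** The powers to be integrated may blow up at an endpoint, so the fundamental theorem of calculus
    is applied on compact subintervals, and monotone convergence extends the bound to the open
    interval. *)
Lemma le_integral_oo (f : R -> R) (a b : R) (C : \bar R) :
  measurable_fun (setT : set (measurableTypeR R)) (f : measurableTypeR R -> R) ->
  (forall x, a < x < b -> 0 <= f x) -> (0 <= C)%E ->
  (forall a' b', a < a' -> a' <= b' -> b' < b ->
    (\int[leb]_(x in `[a', b']) (f x)%:E <= C)%E) ->
  (\int[leb]_(x in `]a, b[) (f x)%:E <= C)%E.
Proof.
move=> mf f0 C0 fC.
pose F n : set (measurableTypeR R) := `[a + n.+1%:R^-1, b - n.+1%:R^-1]%classic.
have FU : `]a, b[%classic = \bigcup_n F n.
  apply/seteqP; split=> x /=; last first.
    move=> [n _]; rewrite /F /= !in_itv/= => /andP[ax xb].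
    have n0 : 0 < n.+1%:R^-1 :> R by rewrite invr_gt0.
    by move: (n.+1%:R^-1 : R) n0 ax xb => e n0 ax xb; apply/andP; split; lra.
  rewrite in_itv/= => /andP[ax xb].
  have m0 : 0 < Num.min (x - a) (b - x) by rewrite lt_min !subr_gt0 ax.
  have /cvgrPdist_le/(_ _ m0)[n _ /(_ n (leqnn n))] := @cvg_harmonic R.
  rewrite /= sub0r normrN ger0_norm ?invr_ge0// le_min => /andP[h1 h2].
  exists n => //; rewrite /F /= in_itv/=.
  by move: (n.+1%:R^-1 : R) h1 h2 => e h1 h2; apply/andP; split; lra.
have ndF : nondecreasing_seq F.
  move=> m n mn; apply/subsetPset => x; rewrite /F /= !in_itv/= => /andP[h1 h2].
  have h3 : n.+1%:R^-1 <= m.+1%:R^-1 :> R by rewrite lef_pV2 ?posrE// ler_nat.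
  move: (n.+1%:R^-1 : R) (m.+1%:R^-1 : R) h1 h2 h3 => e e' h1 h2 h3.
  by apply/andP; split; lra.
have mF n : measurable (F n) by exact: measurable_itv.
have Fab n x : F n x -> a < x < b.
  by move=> Fx; have : (`]a, b[%classic : set R) x; [rewrite FU; exists n|rewrite /= in_itv].
have mfF n : measurable_fun (F n) (EFin \o f).
  by apply/measurable_EFinP; exact: measurable_funTS.
have Ff0 n x : F n x -> (0 <= (f x)%:E)%E by move=> /Fab /f0; rewrite lee_fin.
have := @ge0_nondecreasing_set_cvg_integral _ (measurableTypeR R) R F (EFin \o f) leb ndF mF mfF Ff0.
rewrite -FU => h; apply: (cvge_le_near h).
apply: nearW => n; have [ab'|ab'] := leP (a + n.+1%:R^-1) (b - n.+1%:R^-1).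
  have n0 : 0 < n.+1%:R^-1 :> R by rewrite invr_gt0.
  by apply: fC => //; move: (n.+1%:R^-1 : R) n0 {ab'} => e n0; lra.
by rewrite /F set_itv_ge ?integral_set0// bnd_simp -ltNge.
Qed.

Lemma is_derive_powR_comp (g : R -> R) (p x dg : R) : 0 < g x ->
  is_derive x 1 g dg ->
  is_derive x 1 (fun y => g y `^ p) (p * g x `^ (p - 1) * dg).
Proof.
move=> gx dgx.
exact: (@is_derive1_comp _ (@powR R ^~ p) g x _ _ (is_derive1_powR p gx) dgx).
Qed.

Lemma continuous_powR_comp (g : R -> R) (p x : R) : 0 < g x ->
  {for x, continuous g} -> {for x, continuous (fun y => g y `^ p)}.
Proof.
move=> gx cg; apply: (@continuous_comp _ _ _ g (@powR R ^~ p)) => //.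
apply/differentiable_continuous/derivable1_diffP.
by have [] := is_derive1_powR p gx.
Qed.

Lemma measurable_powR_comp (g : R -> R) (p : R) :
  measurable_fun (setT : set (measurableTypeR R)) (g : measurableTypeR R -> R) ->
  measurable_fun (setT : set (measurableTypeR R)) (fun y => g y `^ p : R).
Proof. by move=> mg; apply: (measurableT_comp (measurable_powR p) mg). Qed.

Lemma integral_powR_right (a b p : R) : a <= b -> 0 < p ->
  (\int[leb]_(x in `]a, b[) ((x - a) `^ (p - 1))%:E <= ((b - a) `^ p / p)%:E)%E.
Proof.
move=> ab p0; apply: le_integral_oo.
- by apply: measurable_powR_comp; exact: measurable_funB.
- by move=> x _; exact: powR_ge0.
- by rewrite lee_fin divr_ge0 ?powR_ge0// ltW.
- move=> a' b' aa' ab' bb'.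
  have := @FTC_is_derive (fun x => (x - a) `^ (p - 1))
    (fun x => p^-1 * (x - a) `^ p) a' b' ab'.
  case/(_ _ _)/Wrap => [x /andP[a'x _]|x /andP[a'x _]|->].
  + have xa : 0 < x - a by lra.
    have d1 : is_derive x 1 (fun y => y - a) 1.
      by apply: is_derive_eq; rewrite subr0.
    have := is_deriveZ p^-1 (is_derive_powR_comp (g := fun y => y - a) p xa d1).
    by rewrite mulr1 /GRing.scale/= mulKf ?gt_eqF.
  + apply: (@continuous_powR_comp (fun y => y - a)); first lra.
    by apply: continuousB => //; exact: cst_continuous.
  + rewrite lee_fin -mulrBr [leRHS]mulrC ler_pM2l ?invr_gt0// lerBlDr.
    rewrite (@le_trans _ _ ((b - a) `^ p))// ?lerDl ?powR_ge0//.
    by rewrite ge0_ler_powR ?nnegrE ?(ltW p0)//; lra.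
Qed.

Lemma integral_powR_left (a b p : R) : a <= b -> 0 < p ->
  (\int[leb]_(x in `]a, b[) ((b - x) `^ (p - 1))%:E <= ((b - a) `^ p / p)%:E)%E.
Proof.
move=> ab p0; apply: le_integral_oo.
- by apply: measurable_powR_comp; exact: measurable_funB.
- by move=> x _; exact: powR_ge0.
- by rewrite lee_fin divr_ge0 ?powR_ge0// ltW.
- move=> a' b' aa' ab' bb'.
  have := @FTC_is_derive (fun x => (b - x) `^ (p - 1))
    (fun x => - p^-1 * (b - x) `^ p) a' b' ab'.
  case/(_ _ _)/Wrap => [x /andP[_ xb']|x /andP[_ xb']|->].
  + have xb : 0 < b - x by lra.
    have d1 : is_derive x 1 (fun y => b - y) (- 1).
      by have := is_deriveB (is_derive_cst b x (1 : R)) (is_derive_id x (1 : R)); rewrite sub0r.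
    have := is_deriveZ (- p^-1) (is_derive_powR_comp (g := fun y => b - y) p xb d1).
    by rewrite mulrN1 /GRing.scale/= mulrNN mulKf ?gt_eqF.
  + apply: (@continuous_powR_comp (fun y => b - y)); first lra.
    by apply: continuousB => //; exact: cst_continuous.
  + rewrite lee_fin !mulNr opprK addrC -mulrBr [leRHS]mulrC ler_pM2l ?invr_gt0// lerBlDr.
    rewrite (@le_trans _ _ ((b - a) `^ p))// ?lerDl ?powR_ge0//.
    by rewrite ge0_ler_powR ?nnegrE ?(ltW p0)//; lra.
Qed.

Lemma le0_ler_powR (r x y : R) : r <= 0 -> 0 < x -> x <= y -> y `^ r <= x `^ r.
Proof.
move=> r0 x0 xy; have y0 := lt_le_trans x0 xy.
rewrite -[r]opprK !(powRN _ (- r)) lef_pV2 ?posrE ?powR_gt0//.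
by rewrite ge0_ler_powR ?nnegrE ?oppr_ge0 ?(ltW x0) ?(ltW y0).
Qed.

End power_integrals.

(** * Pointwise bounds on the kernel and its increments *)

Section subfractional_kernel.
Context (R : realType) (H C0 : R) (H_gt0 : 0 < H) (H_lt1 : H < 1) (C0_gt0 : 0 < C0).
Local Notation leb := (@lebesgue_measure R).
Local Notation al := (H - 1 / 2).
Local Notation K := (subfractional_kernel C0 H).

(** Factor [z ^ 2 - u ^ 2] and use that [z + u] lies between [z] and [2 * z]; which bound serves
    depends on the sign of the exponent. The constant 2 dominates the power [al] of 2. *)
Lemma powR_sqrB_le (z u : R) : 0 < u -> u <= z ->
  (z ^+ 2 - u ^+ 2) `^ al <= 2 * (z - u) `^ al * z `^ al.
Proof.
have [H0 H1] := (H_gt0, H_lt1).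
move=> u0 uz; have z0 := lt_le_trans u0 uz.
have zu0 : 0 <= z - u by rewrite subr_ge0.
rewrite subr_sqr powRM//; last lra.
rewrite mulrC [leRHS]mulrAC ler_wpM2r ?powR_ge0//.
have [a0|a0] := leP 0 al.
  apply: (@le_trans _ _ ((2 * z) `^ al)).
    by rewrite ge0_ler_powR ?nnegrE//; lra.
  rewrite powRM// ?(ltW z0)// ler_wpM2r ?powR_ge0//.
  apply: (@le_trans _ _ (2 `^ 1)); last by rewrite powRr1.
  have al1 : al <= 1 by lra.
  by apply: ler_powR => //; rewrite ler1n.
apply: (@le_trans _ _ (z `^ al)); last by rewrite ler_peMl ?powR_ge0//; lra.
by apply: le0_ler_powR; lra.
Qed.

(** Once [u] is replaced by [z] in the first factor, the powers of [z] combine to [z ^ -1]. This is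
    split so that one part, of exponent [- (1 - H) / 2], goes to [u] and the rest to [z - u]. Then
    [H / 2 - 1 > -1] makes the bound integrable at [z = u], and the square of the power of [u] is
    integrable at 0. *)
Lemma kernel_integrand_le (z u : R) : 0 < u -> u < z ->
  u `^ (3 / 2 - H) * (z ^- 2 * (z ^+ 2 - u ^+ 2) `^ al) <=
    2 * u `^ (- ((1 - H) / 2)) * (z - u) `^ (H / 2 - 1).
Proof.
have [H0 H1] := (H_gt0, H_lt1).
move=> u0 uz; have z0 := lt_trans u0 uz; have zu0 : 0 < z - u by rewrite subr_gt0.
have zN0 : z != 0 by rewrite gt_eqF.
have zuN0 : z - u != 0 by rewrite gt_eqF.
have h1 := powR_sqrB_le u0 (ltW uz).
have h2 : u `^ (3 / 2 - H) <= z `^ (3 / 2 - H).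
  by rewrite ge0_ler_powR ?nnegrE ?(ltW u0) ?(ltW uz) ?(ltW z0)//; lra.
have h3 : z `^ (3 / 2 - H) * z ^- 2 * z `^ al = z `^ (- ((1 - H) / 2)) * z `^ ((1 - H) / 2 - 1).
  rewrite -powR_invn ?ltW// -!powRD ?zN0 ?implybT//.
  by congr (_ `^ _); field.
have h4 : z `^ (- ((1 - H) / 2)) <= u `^ (- ((1 - H) / 2)).
  by apply: le0_ler_powR; lra.
have h5 : z `^ ((1 - H) / 2 - 1) <= (z - u) `^ ((1 - H) / 2 - 1).
  by apply: le0_ler_powR; lra.
have h6 : (z - u) `^ (H / 2 - 1) = (z - u) `^ ((1 - H) / 2 - 1) * (z - u) `^ al.
  by rewrite -powRD ?zuN0 ?implybT//; congr (_ `^ _); field.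
apply: (@le_trans _ _ (z `^ (3 / 2 - H) * (z ^- 2 * (2 * (z - u) `^ al * z `^ al)))).
  rewrite ler_pM ?powR_ge0// ?mulr_ge0 ?invr_ge0 ?exprn_ge0 ?powR_ge0 ?(ltW z0)//.
  by rewrite ler_wpM2l// invr_ge0 exprn_ge0// ltW.
rewrite (_ : _ * _ = 2 * (z `^ (3 / 2 - H) * z ^- 2 * z `^ al) * (z - u) `^ al); last by ring.
rewrite h3 h6 -!mulrA ler_wpM2l// !mulrA ler_wpM2r ?powR_ge0//.
by rewrite ler_pM ?powR_ge0.
Qed.

Lemma measurable_kernel_integrand (u : R) :
  measurable_fun (setT : set (measurableTypeR R))
    (fun z => z ^- 2 * (z ^+ 2 - u ^+ 2) `^ al : R).
Proof.
have [H0 H1] := (H_gt0, H_lt1).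
apply: measurable_funM.
  rewrite (_ : (fun z => _) = fun z => `|z| `^ (- 2%:R) : R); last first.
    by apply/funext => z; rewrite powR_invn// real_normK// num_real.
  exact: (@measurable_powR_comp _ (fun z => `|z|) _ (@normr_measurable R setT)).
by apply: measurable_powR_comp; apply: measurable_funB.
Qed.

Lemma kernel_integrand_ge0 (z u : R) : 0 <= z ^- 2 * (z ^+ 2 - u ^+ 2) `^ al.
Proof. by rewrite mulr_ge0 ?powR_ge0// invr_ge0 sqr_ge0. Qed.

Lemma integral_kernel_integrand_le (u t : R) : 0 < u -> u < t ->
  (\int[leb]_(z in `[u, t]) (u `^ (3 / 2 - H) * (z ^- 2 * (z ^+ 2 - u ^+ 2) `^ al))%:E <=
   (4 / H * u `^ (- ((1 - H) / 2)) * (t - u) `^ (H / 2))%:E)%E.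
Proof.
have [H0 H1] := (H_gt0, H_lt1).
move=> u0 ut.
have mf : measurable_fun (setT : set (measurableTypeR R))
    (fun z => u `^ (3 / 2 - H) * (z ^- 2 * (z ^+ 2 - u ^+ 2) `^ al) : R).
  by apply: measurable_funM => //; exact: measurable_kernel_integrand.
have mg : measurable_fun (setT : set (measurableTypeR R)) (fun z => (z - u) `^ (H / 2 - 1) : R).
  by apply: measurable_powR_comp; exact: measurable_funB.
rewrite integral_itv_bndoo; last by apply/measurable_EFinP; exact: measurable_funTS.
have c0 : 0 <= 2 * u `^ (- ((1 - H) / 2)) by rewrite mulr_ge0 ?powR_ge0.
apply: (@le_trans _ _ (\int[leb]_(z in `]u, t[)
    (2 * u `^ (- ((1 - H) / 2)) * (z - u) `^ (H / 2 - 1))%:E)%E).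
  apply: ge0_le_integral => //.
  - by move=> z _; rewrite lee_fin mulr_ge0 ?powR_ge0// kernel_integrand_ge0.
  - by apply/measurable_EFinP; exact: measurable_funTS.
  - by apply/measurable_EFinP; apply: measurable_funM => //; exact: measurable_funTS.
  - by move=> z; rewrite /= in_itv/= => /andP[uz _]; rewrite lee_fin kernel_integrand_le.
rewrite (ge0_lebesgue_integralZl (measurable_itv _) (measurable_funTS mg)
  (fun z _ => powR_ge0 _ _) c0).
apply: (@le_trans _ _ ((2 * u `^ (- ((1 - H) / 2)))%:E * ((t - u) `^ (H / 2) / (H / 2))%:E)%E).
  apply: lee_wpmul2l => //; apply: integral_powR_right; first exact: ltW.
  by rewrite divr_gt0.
rewrite -EFinM lee_fin le_eqVlt; apply/orP; left; apply/eqP.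
by field; rewrite gt_eqF.
Qed.

Lemma integrable_kernel_integrand (u t : R) : 0 < u -> u < t ->
  leb.-integrable `[u, t] (EFin \o (fun z => z ^- 2 * (z ^+ 2 - u ^+ 2) `^ al)).
Proof.
have [H0 H1] := (H_gt0, H_lt1).
move=> u0 ut; apply/integrableP; split.
  by apply/measurable_EFinP; exact: (measurable_funTS (measurable_kernel_integrand u)).
under eq_integral do rewrite /= ger0_norm ?kernel_integrand_ge0//.
have up : 0 < u `^ (3 / 2 - H) by rewrite powR_gt0.
have := integral_kernel_integrand_le u0 ut.
rewrite (ge0_lebesgue_integralZl (measurable_itv _)
  (measurable_funTS (measurable_kernel_integrand u))
  (fun z _ => kernel_integrand_ge0 z u) (ltW up)).
case: (\int[leb]_(z in _) _)%E => //= [r|]; first by rewrite ltry.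
by rewrite gt0_muley ?lte_fin.
Qed.

Lemma kernel_ge0 (t u : R) : 0 < u -> u < t -> 0 <= K t u.
Proof.
have [H0 H1] := (H_gt0, H_lt1).
move=> u0 ut; rewrite /subfractional_kernel mulr_ge0// ?mulr_ge0 ?powR_ge0 ?(ltW C0_gt0)//.
rewrite addr_ge0 ?mulr_ge0 ?invr_ge0 ?powR_ge0 ?(ltW (lt_trans u0 ut))//.
by apply: Rintegral_ge0 => z _; exact: kernel_integrand_ge0.
Qed.

(** In the boundary term, bounding the power [3 / 2 - H] of [u] by that of [t] makes all powers of
    [t] cancel. The integral term is [integral_kernel_integrand_le]. *)
Lemma kernel_le (t u : R) : 0 < u -> u < t ->
  K t u <= C0 * (2 * (t - u) `^ al +
                 4 / H * u `^ (- ((1 - H) / 2)) * (t - u) `^ (H / 2)).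
Proof.
have [H0 H1] := (H_gt0, H_lt1).
move=> u0 ut; have t0 := lt_trans u0 ut.
have tN0 : t != 0 by rewrite gt_eqF.
rewrite /subfractional_kernel -mulrA ler_wpM2l ?(ltW C0_gt0)// mulrDr lerD//.
  have h1 := powR_sqrB_le u0 (ltW ut).
  have h2 : u `^ (3 / 2 - H) <= t `^ (3 / 2 - H).
    by rewrite ge0_ler_powR ?nnegrE ?(ltW u0) ?(ltW ut) ?(ltW t0)//; lra.
  have h3 : t `^ (3 / 2 - H) * t^-1 * t `^ al = 1.
    rewrite -(powR_inv1 (ltW t0)) -!powRD ?tN0 ?implybT//.
    by rewrite (_ : _ + _ = 0) ?powRr0//; field.
  apply: (@le_trans _ _ (t `^ (3 / 2 - H) * (t^-1 * (2 * (t - u) `^ al * t `^ al)))).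
    rewrite ler_pM ?powR_ge0// ?mulr_ge0 ?invr_ge0 ?powR_ge0 ?(ltW t0)//.
    by rewrite ler_wpM2l// invr_ge0 ltW.
  rewrite (_ : _ * _ = 2 * (t - u) `^ al * (t `^ (3 / 2 - H) * t^-1 * t `^ al)); last by ring.
  by rewrite h3 mulr1.
rewrite -lee_fin; apply: le_trans (integral_kernel_integrand_le u0 ut).
rewrite EFinM fineK; last exact: integrable_fin_num (integrable_kernel_integrand u0 ut).
by rewrite (ge0_lebesgue_integralZl (measurable_itv _)
  (measurable_funTS (measurable_kernel_integrand u))
  (fun z _ => kernel_integrand_ge0 z u) (powR_ge0 _ _)).
Qed.

(** As [al - 1] is negative, [z + u] may be replaced by [u]; the exponents [3 / 2 - H] and [al - 1]
    of [u] then cancel. *)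
Lemma powR_sqrB_exponent_le (z u : R) : 0 < u -> u < z ->
  u `^ (3 / 2 - H) * (z ^+ 2 - u ^+ 2) `^ (al - 1) <= (z - u) `^ (al - 1).
Proof.
have [H0 H1] := (H_gt0, H_lt1).
move=> u0 uz; have zu0 : 0 <= z - u by rewrite subr_ge0 ltW.
have uN0 : u != 0 by rewrite gt_eqF.
rewrite subr_sqr powRM//; last lra.
rewrite mulrCA ler_piMr ?powR_ge0//.
apply: (@le_trans _ _ (u `^ (3 / 2 - H) * u `^ (al - 1))).
  by rewrite ler_wpM2l ?powR_ge0//; apply: le0_ler_powR; lra.
by rewrite -powRD ?uN0 ?implybT// (_ : _ + _ = 0) ?powRr0//; field.
Qed.

(** The boundary term [F] has derivative [2 * al * g - f], where [f] is the very integrand in the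
    kernel: the integral terms cancel and only the integral of [2 * al * g] over [s, t] remains. The
    parameter [th] trades the singularity at [u = s] against the power of [t - s]. *)
Lemma kernel_sub_le (th u s t : R) : 0 < th -> th <= 1 -> al <= th ->
  0 < u -> u < s -> s < t ->
  `|K t u - K s u| <= C0 * `|2 * al| / th * (s - u) `^ (al - th) * (t - s) `^ th.
Proof.
have [H0 H1] := (H_gt0, H_lt1).
move=> th0 th1 alth u0 us st; have ut := lt_trans us st.
pose f (z : R) : R := z ^- 2 * (z ^+ 2 - u ^+ 2) `^ al.
pose g (z : R) : R := (z ^+ 2 - u ^+ 2) `^ (al - 1).
pose F (z : R) : R := z^-1 * (z ^+ 2 - u ^+ 2) `^ al.
have zu0 z : s <= z -> 0 < z ^+ 2 - u ^+ 2.
  by move=> sz; rewrite subr_sqr mulr_gt0; lra.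
have z0 z : s <= z -> 0 < z by move=> sz; lra.
have dsq (z : R) : is_derive z 1 (fun y => y ^+ 2 - u ^+ 2) (2 * z).
  have := is_deriveB (is_deriveX 2 (is_derive_id z (1 : R))) (is_derive_cst (u ^+ 2) z (1 : R)).
  by rewrite subr0 expr1 /GRing.scale/= mulr1.
have dF (z : R) : s <= z <= t -> is_derive z 1 F (2 * al * g z - f z).
  move=> /andP[sz _].
  have zN0 : z != 0 by rewrite gt_eqF// z0.
  have h1 := is_deriveV zN0 (is_derive_id z (1 : R)).
  have h2 := is_derive_powR_comp (g := fun y => y ^+ 2 - u ^+ 2) al (zu0 z sz) (dsq z).
  have h3 : is_derive z 1 F _ := is_deriveM h1 h2.
  apply: is_derive_eq h3 _.
  by rewrite /GRing.scale/= /f /g; field.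
have cg (z : R) : s <= z <= t -> {for z, continuous g}.
  move=> /andP[sz _]; apply: (@continuous_powR_comp _ (fun y => y ^+ 2 - u ^+ 2)).
    exact: zu0.
  apply/differentiable_continuous/derivable1_diffP.
  by have [] := dsq z.
have cf (z : R) : s <= z <= t -> {for z, continuous f}.
  move=> /andP[sz _]; apply: continuousM.
    apply: continuousV; first by rewrite gt_eqF// exprn_gt0// z0.
    exact: exprn_continuous.
  apply: (@continuous_powR_comp _ (fun y => y ^+ 2 - u ^+ 2)); first exact: zu0.
  apply/differentiable_continuous/derivable1_diffP.
  by have [] := dsq z.
have itvP z : z \in `[s, t] -> s <= z <= t by rewrite in_itv.
have ig : leb.-integrable `[s, t] (EFin \o g).
  apply: continuous_compact_integrable; first exact: segment_compact.
  by apply: continuous_in_subspaceT => z; rewrite inE/= => /itvP; exact: cg.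
have i_f : leb.-integrable `[s, t] (EFin \o f).
  apply: continuous_compact_integrable; first exact: segment_compact.
  by apply: continuous_in_subspaceT => z; rewrite inE/= => /itvP; exact: cf.
have iag : leb.-integrable `[s, t] (EFin \o (fun z => 2 * al * g z)).
  by apply: (@integrableZl _ _ _ _ _ _ (2 * al) _ ig).
have FE : F t - F s = 2 * al * \int[leb]_(z in `[s, t]) g z - \int[leb]_(z in `[s, t]) f z.
  rewrite -RintegralZl// -RintegralB//.
  have := @FTC_is_derive _ (fun z => 2 * al * g z - f z) F s t (ltW st) dF.
  rewrite /Rintegral => ->//.
  move=> z zst; apply: continuousB; last exact: cf.
  by apply: continuousM; [exact: cst_continuous|exact: cg].
have fE : \int[leb]_(z in `[u, t]) f z - \int[leb]_(z in `[u, s]) f z =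
    \int[leb]_(z in `[s, t]) f z.
  rewrite Rintegral_itvB.
  - rewrite Rintegral_itv_obnd_cbnd//.
    by apply: integrableS i_f => //; apply: subset_itvr; rewrite bnd_simp.
  - exact: integrable_kernel_integrand.
  - by rewrite bnd_simp ltW.
  - by rewrite bnd_simp ltW.
have -> : K t u - K s u = C0 * (u `^ (3 / 2 - H) * (2 * al * \int[leb]_(z in `[s, t]) g z)).
  rewrite /subfractional_kernel -mulrBr -!mulrA; congr (_ * (_ * _)).
  rewrite opprD addrACA fE.
  by rewrite -/(F t) -/(F s) FE subrK mulrA.
have g0 z : 0 <= g z by exact: powR_ge0.
have Ig0 : 0 <= \int[leb]_(z in `[s, t]) g z by exact: Rintegral_ge0.
rewrite normrM (ger0_norm (ltW C0_gt0)) normrM (ger0_norm (powR_ge0 _ _)).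
rewrite normrM (ger0_norm Ig0) -!mulrA ler_wpM2l ?(ltW C0_gt0)//.
rewrite mulrCA ler_wpM2l//.
have mg : measurable_fun (setT : set (measurableTypeR R)) (g : measurableTypeR R -> R).
  by apply: measurable_powR_comp; apply: measurable_funB => //; exact: measurable_funX.
have mgst : measurable_fun `]s, t[ g by exact: (measurable_funTS mg).
rewrite -lee_fin EFinM fineK; last exact: integrable_fin_num ig.
rewrite integral_itv_bndoo; last exact/measurable_EFinP.
rewrite -(ge0_lebesgue_integralZl (measurable_itv _) (measurable_funTS mg)
  (fun z _ => g0 z) (powR_ge0 _ _)).
have mp : measurable_fun (setT : set (measurableTypeR R)) (fun z => (z - s) `^ (th - 1) : R).
  by apply: measurable_powR_comp; exact: measurable_funB.
apply: (@le_trans _ _ (\int[leb]_(z in `]s, t[) ((s - u) `^ (al - th) * (z - s) `^ (th - 1))%:E)%E).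
  apply: ge0_le_integral => //.
  - by move=> z _; rewrite lee_fin mulr_ge0// powR_ge0.
  - by apply/measurable_EFinP; apply: measurable_funM => //; exact: (measurable_funTS mg).
  - by apply/measurable_EFinP; apply: measurable_funM => //; exact: (measurable_funTS mp).
  - move=> z; rewrite /= in_itv/= => /andP[sz zt]; rewrite lee_fin.
    have uz := lt_trans us sz.
    apply: le_trans (powR_sqrB_exponent_le u0 uz) _.
    have zuN0 : z - u != 0 by rewrite gt_eqF// subr_gt0.
    (* Both exponents are nonpositive, so [z - u] may be decreased to [s - u] in one factor and to
       [z - s] in the other. *)
    rewrite (_ : al - 1 = (al - th) + (th - 1)); last by ring.
    rewrite powRD ?zuN0 ?implybT// ler_pM ?powR_ge0//.
      by apply: le0_ler_powR; rewrite ?subr_le0 ?subr_gt0 ?lerD2r// ltW.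
    by apply: le0_ler_powR; rewrite ?subr_le0 ?subr_gt0 ?lerD2l ?lerN2// ltW.
rewrite (ge0_lebesgue_integralZl (measurable_itv _) (measurable_funTS mp)
  (fun z _ => powR_ge0 _ _) (powR_ge0 _ _)).
apply: (@le_trans _ _ (((s - u) `^ (al - th))%:E * ((t - s) `^ th / th)%:E)%E).
  by apply: lee_wpmul2l; [rewrite lee_fin powR_ge0|apply: integral_powR_right => //; exact: ltW].
by rewrite -EFinM lee_fin le_eqVlt; apply/orP; left; apply/eqP; ring.
Qed.

End subfractional_kernel.

(** * Square integrals of kernel increments *)

Section kernel_energy.
Context (R : realType).
Local Notation leb := (@lebesgue_measure R).

Definition kernel_increment (K : R -> R -> R) (s t u : R) : R :=
  K t u * \1_(`]0, t]%classic) u - K s u * \1_(`]0, s]%classic) u.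

Lemma sqr_powR (x p : R) : 0 <= x -> (x `^ p) ^+ 2 = x `^ (p * 2).
Proof. by move=> x0; rewrite powRrM powR_mulrn ?powR_ge0. Qed.

Lemma powR_le_factor (x y p q : R) : 0 < x -> x <= y -> p <= q ->
  x `^ q <= y `^ (q - p) * x `^ p.
Proof.
move=> x0 xy pq; have y0 := lt_le_trans x0 xy.
have -> : x `^ q = x `^ (q - p) * x `^ p.
  by rewrite -powRD ?subrK// (gt_eqF x0) implybT.
by rewrite ler_wpM2r ?powR_ge0// ge0_ler_powR ?nnegrE ?subr_ge0 ?(ltW x0) ?(ltW y0).
Qed.

(** The bound is delivered through an explicit measurable majorant [h] of the squared increment, so
    that measurability in [u] of the kernel, an integral depending on a parameter, does not have to
    be established. *)
Lemma kernel_energy (H C0 T eps : R) : 0 < H -> H < 1 -> 0 < C0 -> 0 < T ->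
  0 < eps -> eps < H ->
  exists2 C, 0 <= C & forall s t, 0 <= s -> s < t -> t <= T ->
    exists h : R -> R,
    [/\ measurable_fun (`]0, T]%classic : set (measurableTypeR R)) (h : measurableTypeR R -> R),
        forall u, (`]0, T]%classic : set R) u -> 0 <= h u,
        {ae leb, forall u, (`]0, T]%classic : set R) u ->
          kernel_increment (subfractional_kernel C0 H) s t u ^+ 2 <= h u} &
        (\int[leb]_(u in (`]0%R, T]%classic : set R)) (h u)%:E <= (C * (t - s) `^ (2 * (H - eps)))%:E)%E].
Proof.
move=> H0 H1 C00 T0 e0 eH.
(* Below [s] the square of the increment is of order
   [(s - u) `^ (2 * (H - 1 / 2 - th))], integrable because [th < H]. *)
pose th := H - Num.min eps (1 / 4).
have [m0 me m4] : [/\ 0 < Num.min eps (1 / 4), Num.min eps (1 / 4) <= eps & Num.min eps (1 / 4) <= 1 / 4].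
  by split; [rewrite lt_min e0/=; lra|rewrite ge_min lexx|rewrite ge_min lexx orbT].
have thH : th < H by rewrite /th; lra.
have th0 : 0 < th by rewrite /th; lra.
have th1 : th <= 1 by rewrite /th; lra.
(* This is the purpose of the cap 1/4 in [th]. *)
have thal : H - 1 / 2 <= th by rewrite /th; lra.
have the : H - eps <= th by rewrite /th; lra.
pose q := 2 * (H - th); have q0 : 0 < q by rewrite /q; lra.
pose A := C0 * `|2 * (H - 1 / 2)| / th.
(* The first summand comes from integrating [f1]; [4 / H + 32 / H ^ 3] is
   [8 / (2 * H) + (32 / H ^ 2) / H], from the two terms of [f2]. *)
pose B := A ^+ 2 / q + C0 ^+ 2 * (4 / H + 32 / H ^+ 3).
have B0 : 0 <= B.
  rewrite /B addr_ge0//; first by rewrite divr_ge0 ?sqr_ge0 ?(ltW q0).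
  by rewrite mulr_ge0 ?sqr_ge0// addr_ge0// divr_ge0 ?exprn_ge0 ?(ltW H0).
exists (T `^ (2 * th - 2 * (H - eps)) * (T `^ q * B)).
  by rewrite !mulr_ge0 ?powR_ge0.
move=> s t s0 st tT.
have d0 : 0 < t - s by rewrite subr_gt0.
have dT : t - s <= T by lra.
pose f1 (u : R) : R := A ^+ 2 * (t - s) `^ (2 * th) * (s - u) `^ (q - 1).
pose f21 (u : R) : R := (t - u) `^ (2 * H - 1).
pose f22 (u : R) : R := (u - s) `^ (H - 1).
(* Square of the bound [kernel_le], by [(x + y) ^ 2 <= 2 * x ^ 2 + 2 * y ^ 2], after replacing [u]
   by [u - s] in the negative power and [t - u] by [t - s] in the power [H / 2]. *)
pose f2 u := C0 ^+ 2 * (8 * f21 u + 32 / H ^+ 2 * (t - s) `^ H * f22 u).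
have f1_ge0 u : 0 <= f1 u by do 2?[apply: mulr_ge0]; rewrite ?sqr_ge0 ?powR_ge0.
have f21_ge0 u : 0 <= f21 u by exact: powR_ge0.
have f22_ge0 u : 0 <= f22 u by exact: powR_ge0.
have c22_ge0 : 0 <= 32 / H ^+ 2 * (t - s) `^ H.
  by rewrite mulr_ge0 ?powR_ge0 ?divr_ge0 ?sqr_ge0.
have f2_ge0 u : 0 <= f2 u.
  by rewrite /f2 mulr_ge0 ?sqr_ge0// addr_ge0// mulr_ge0.
have mf0 : measurable_fun (setT : set (measurableTypeR R)) (fun u => (s - u) `^ (q - 1) : R).
  by apply: measurable_powR_comp; exact: measurable_funB.
have mf21 : measurable_fun (setT : set (measurableTypeR R)) (f21 : measurableTypeR R -> R).
  by apply: measurable_powR_comp; exact: measurable_funB.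
have mf22 : measurable_fun (setT : set (measurableTypeR R)) (f22 : measurableTypeR R -> R).
  by apply: measurable_powR_comp; exact: measurable_funB.
have mf1 : measurable_fun (setT : set (measurableTypeR R)) (f1 : measurableTypeR R -> R).
  exact: measurable_funM.
have mf2 : measurable_fun (setT : set (measurableTypeR R)) (f2 : measurableTypeR R -> R).
  apply: measurable_funM => //; apply: measurable_funD; exact: measurable_funM.
pose E1 : set (measurableTypeR R) := `]0, s[%classic.
pose E2 : set (measurableTypeR R) := `]s, t[%classic.
have mE1 : measurable E1 by exact: measurable_itv.
have mE2 : measurable E2 by exact: measurable_itv.
have mD : measurable (`]0, T]%classic : set (measurableTypeR R)) by exact: measurable_itv.
pose h : measurableTypeR R -> R := (f1 \_ E1) \+ (f2 \_ E2).
have r1_ge0 u : 0 <= (f1 \_ E1) u by rewrite patchE; case: ifP.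
have r2_ge0 u : 0 <= (f2 \_ E2) u by rewrite patchE; case: ifP.
have mr1 : measurable_fun (`]0, T]%classic : set (measurableTypeR R)) (f1 \_ E1).
  apply: measurable_funTS; apply/(measurable_restrictT _ mE1).
  exact: measurable_funTS.
have mr2 : measurable_fun (`]0, T]%classic : set (measurableTypeR R)) (f2 \_ E2).
  apply: measurable_funTS; apply/(measurable_restrictT _ mE2).
  exact: measurable_funTS.
exists h; split.
- exact: measurable_funD.
- by move=> u _; rewrite addr_ge0.
- have FF : Filter (almost_everywhere leb) by exact: (ae_filter_ringOfSetsType leb).
  have aeN (c : R) : {ae leb, forall u, u != c}.
    exists [set c]; split; [exact: measurable_set1|exact: lebesgue_measure_set1|].
    by move=> u /= /negP; rewrite negbK => /eqP.
  (* At [u = s] and [u = t] the kernels take conventional values; the two points are discarded as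
     negligible. *)
  apply: filterS2 (aeN s) (aeN t) => u us ut.
  rewrite /= in_itv/= => /andP[u0 uT].
  rewrite /kernel_increment !indicE.
  have [ltus|ltsu|eus] := ltgtP u s; last by rewrite eus eqxx in us.
  + have utt : u < t by lra.
    rewrite !mem_set/= ?in_itv/= ?u0 ?(ltW ltus) ?(ltW utt)// !mulr1.
    have := kernel_sub_le H0 H1 C00 th0 th1 thal u0 ltus st.
    rewrite -/A => k1; apply: (@le_trans _ _ (f1 u)); last first.
      by rewrite /h /= ler_wpDr// patchE mem_set//= /E1 /= in_itv/= u0.
    rewrite -real_normK ?num_real//.
    apply: (@le_trans _ _ ((A * (s - u) `^ (H - 1 / 2 - th) * (t - s) `^ th) ^+ 2)).
      by rewrite ler_sqr ?nnegrE ?(le_trans _ k1).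
    rewrite /f1 (mulrC 2 th) (_ : q - 1 = (H - 1 / 2 - th) * 2); last by rewrite /q; field.
    rewrite -!sqr_powR ?subr_ge0 ?(ltW ltus) ?(ltW st)//.
    by rewrite le_eqVlt; apply/orP; left; apply/eqP; ring.
  + rewrite [X in _ - _ * X](_ : _ = 0) ?mulr0 ?subr0; last first.
      by rewrite memNset//= in_itv/= u0/= leNgt ltsu.
    have [ltut|lttu|eut] := ltgtP u t; last by rewrite eut eqxx in ut.
      rewrite mem_set/= ?in_itv/= ?u0 ?(ltW ltut)// mulr1.
      have k0 := kernel_ge0 H0 H1 C00 u0 ltut.
      have k1 := kernel_le H0 H1 C00 u0 ltut.
      apply: (@le_trans _ _ (f2 u)); last first.
        by rewrite /h /= ler_wpDl// patchE mem_set//= /E2 /= in_itv/= ltsu.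
      have us0 : 0 < u - s by rewrite subr_gt0.
      have tu0 : 0 < t - u by rewrite subr_gt0.
      have k2 : subfractional_kernel C0 H t u <= C0 * (2 * (t - u) `^ (H - 1 / 2) +
          4 / H * ((u - s) `^ (- ((1 - H) / 2)) * (t - s) `^ (H / 2))).
        apply: le_trans k1 _; rewrite ler_wpM2l ?(ltW C00)// lerD2l -mulrA.
        rewrite ler_wpM2l ?divr_ge0 ?(ltW H0)// ler_pM ?powR_ge0//.
          by apply: le0_ler_powR; lra.
        by rewrite ge0_ler_powR ?nnegrE ?(ltW tu0) ?(ltW d0) ?divr_ge0 ?(ltW H0)//; lra.
      set x := (t - u) `^ (H - 1 / 2) in k2.
      set y := (u - s) `^ _ * _ in k2.
      have xE : f21 u = x ^+ 2.
        by rewrite /x sqr_powR ?(ltW tu0)// /f21; congr (_ `^ _); field.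
      have yE : (t - s) `^ H * f22 u = y ^+ 2.
        rewrite /y exprMn !sqr_powR ?(ltW us0) ?(ltW d0)// /f22 mulrC.
        by congr (_ `^ _ * _ `^ _); field.
      apply: (@le_trans _ _ ((C0 * (2 * x + 4 / H * y)) ^+ 2)).
        by rewrite ler_sqr ?nnegrE ?(le_trans _ k2).
      rewrite /f2 -[32 / H ^+ 2 * _ * _]mulrA yE xE exprMn ler_wpM2l ?sqr_ge0//.
      have -> : 32 / H ^+ 2 * y ^+ 2 = 2 * (4 / H * y) ^+ 2 by field; rewrite gt_eqF.
      have := sqr_ge0 (2 * x - 4 / H * y); move: (4 / H * y) => z; rewrite !expr2; lra.
    rewrite memNset/=; last by rewrite in_itv/= u0/= leNgt lttu.
    by rewrite mulr0 expr0n/= addr_ge0.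
- under eq_integral do rewrite EFinD.
  rewrite ge0_integralD//; last 4 first.
  + by move=> u _; rewrite lee_fin.
  + exact/measurable_EFinP.
  + by move=> u _; rewrite lee_fin.
  + exact/measurable_EFinP.
  have restrictE (f : measurableTypeR R -> R) E :
      (\int[leb]_(u in (`]0%R, T]%classic : set (measurableTypeR R))) ((f \_ E) u)%:E =
       \int[leb]_(u in (`]0%R, T]%classic : set (measurableTypeR R)) `&` E) (EFin \o f) u)%E.
    by rewrite integral_mkcondr; apply: eq_integral => x _; rewrite !patchE; case: ifP.
  rewrite !restrictE.
  have -> : `]0, T]%classic `&` E1 = E1.
    apply: setIidr => u; rewrite /E1 /= !in_itv/= => /andP[-> us]/=; lra.
  have -> : `]0, T]%classic `&` E2 = E2.
    apply: setIidr => u; rewrite /E2 /= !in_itv/= => /andP[us ut].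
    by apply/andP; split; lra.
  have c1_ge0 : 0 <= A ^+ 2 * (t - s) `^ (2 * th) by rewrite mulr_ge0 ?sqr_ge0 ?powR_ge0.
  have I1 : (\int[leb]_(u in E1) (EFin \o f1) u <=
      (A ^+ 2 * (t - s) `^ (2 * th) * (T `^ q / q))%:E)%E.
    rewrite (ge0_lebesgue_integralZl mE1 (measurable_funTS mf0) (fun z _ => powR_ge0 _ _) c1_ge0).
    rewrite [leRHS]EFinM; apply: lee_wpmul2l => //.
    apply: le_trans (integral_powR_left s0 q0) _.
    rewrite lee_fin ler_wpM2r ?invr_ge0 ?(ltW q0)// subr0.
    by rewrite ge0_ler_powR ?nnegrE ?(ltW q0) ?(ltW T0)//; lra.
  have I21 : (\int[leb]_(u in E2) (f21 u)%:E <= ((t - s) `^ (2 * H) / (2 * H))%:E)%E.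
    by apply: integral_powR_left; [exact: ltW|rewrite mulr_gt0].
  have I22 : (\int[leb]_(u in E2) (f22 u)%:E <= ((t - s) `^ H / H)%:E)%E.
    by apply: integral_powR_right => //; exact: ltW.
  have I2 : (\int[leb]_(u in E2) (EFin \o f2) u <=
      (C0 ^+ 2 * (4 / H + 32 / H ^+ 3) * (t - s) `^ (2 * H))%:E)%E.
    rewrite (ge0_lebesgue_integralZl mE2 (f := fun u => 8 * f21 u + 32 / H ^+ 2 * (t - s) `^ H * f22 u)).
    + rewrite -[(C0 ^+ 2 * _ * _)%R]mulrA [leRHS]EFinM; apply: lee_wpmul2l; first by rewrite lee_fin sqr_ge0.
      under eq_integral do rewrite EFinD.
      rewrite ge0_integralD//; last 4 first.
      * by move=> u _; rewrite lee_fin mulr_ge0.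
      * by apply/measurable_EFinP; apply: measurable_funM => //; exact: (measurable_funTS mf21).
      * by move=> u _; rewrite lee_fin mulr_ge0.
      * by apply/measurable_EFinP; apply: measurable_funM => //; exact: (measurable_funTS mf22).
      rewrite (ge0_lebesgue_integralZl mE2 (measurable_funTS mf21))//.
      rewrite (ge0_lebesgue_integralZl mE2 (measurable_funTS mf22))//.
      rewrite (_ : (4 / H + 32 / H ^+ 3) * (t - s) `^ (2 * H) =
        8 * ((t - s) `^ (2 * H) / (2 * H)) + 32 / H ^+ 2 * (t - s) `^ H * ((t - s) `^ H / H)); last first.
        have -> : (t - s) `^ (2 * H) = (t - s) `^ H ^+ 2 by rewrite sqr_powR ?(ltW d0)// mulrC.
        by field; rewrite gt_eqF.
      rewrite [leRHS]EFinD; apply: leeD; rewrite [leRHS]EFinM; apply: lee_wpmul2l => //.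
    + apply: measurable_funTS; apply: measurable_funD; exact: measurable_funM.
    + by move=> u _; rewrite addr_ge0// mulr_ge0.
    + exact: sqr_ge0.
  apply: le_trans (leeD I1 I2) _; rewrite -EFinD lee_fin.
  (* Exponents are lowered first to [2 * th], then to [2 * (H - eps)], at the cost of powers of [T],
     because [t - s <= T]. *)
  have p1 : (t - s) `^ (2 * H) <= T `^ q * (t - s) `^ (2 * th).
    rewrite (_ : q = 2 * H - 2 * th); last by rewrite /q; ring.
    by apply: powR_le_factor => //; lra.
  have p2 : (t - s) `^ (2 * th) <= T `^ (2 * th - 2 * (H - eps)) * (t - s) `^ (2 * (H - eps)).
    by apply: powR_le_factor => //; lra.
  apply: (@le_trans _ _ (T `^ q * B * (t - s) `^ (2 * th))).
    have D0 : 0 <= C0 ^+ 2 * (4 / H + 32 / H ^+ 3).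
      by rewrite mulr_ge0 ?sqr_ge0// addr_ge0// divr_ge0 ?exprn_ge0 ?(ltW H0).
    move: p1 D0; rewrite /B; move: (C0 ^+ 2 * (4 / H + 32 / H ^+ 3)) => D p1 D0.
    apply: le_trans (_ : _ <= A ^+ 2 * (t - s) `^ (2 * th) * (T `^ q / q) +
      D * (T `^ q * (t - s) `^ (2 * th))) _.
      by rewrite lerD2l ler_wpM2l.
    by rewrite le_eqVlt; apply/orP; left; apply/eqP; ring.
  rewrite [leRHS]mulrAC [leRHS]mulrC ler_wpM2l//.
  by rewrite mulr_ge0 ?powR_ge0.
Qed.

End kernel_energy.

(** * The Kolmogorov continuity criterion *)

Section mesh.
Context (R : realType) (T : R) (T_gt0 : 0 < T).

Definition mesh (n k : nat) : R := k%:R * T / 2 ^+ n.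
Definition mesh_index (n : nat) (t : R) : nat := Num.truncn (2 ^+ n * t / T).
Definition mesh_floor (n : nat) (t : R) : R := mesh n (mesh_index n t).

Lemma meshS n k : mesh n.+1 k.*2 = mesh n k.
Proof.
by rewrite /mesh -mul2n natrM exprS; field; rewrite expf_neq0.
Qed.

Lemma mesh_ge0 n k : 0 <= mesh n k.
Proof. by rewrite divr_ge0// mulr_ge0// ltW. Qed.

Lemma mesh_le n k : (k <= 2 ^ n)%N -> mesh n k <= T.
Proof.
move=> kn; rewrite ler_pdivrMr ?exprn_gt0// mulrC ler_pM2l//.
by rewrite -natrX ler_nat.
Qed.

Lemma mesh_lt n k : mesh n k < mesh n k.+1.
Proof. by rewrite ltr_pM2r ?invr_gt0 ?exprn_gt0// ltr_pM2r// ltr_nat. Qed.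

Lemma mesh_sub n k : mesh n k.+1 - mesh n k = T / 2 ^+ n.
Proof. by rewrite /mesh -natr1; ring. Qed.

Lemma mesh_floor_itv n t : 0 <= t ->
  mesh_floor n t <= t < mesh n (mesh_index n t).+1.
Proof.
move=> t0; have p2 : 0 < 2 ^+ n :> R by exact: exprn_gt0.
have /truncn_itv : 0 <= 2 ^+ n * t / T by rewrite divr_ge0 ?mulr_ge0 ?(ltW T_gt0) ?(ltW p2).
rewrite -/(mesh_index n t) /mesh_floor /mesh => /andP[h1 h2].
rewrite ler_pdivrMr// ltr_pdivlMr//.
by rewrite ler_pdivlMr// in h1; rewrite ltr_pdivrMr// in h2; rewrite [t * _]mulrC h1.
Qed.

Lemma mesh_floor_dist n t : 0 <= t -> 0 <= t - mesh_floor n t <= T / 2 ^+ n.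
Proof.
move=> /(mesh_floor_itv n)/andP[h1 h2]; rewrite subr_ge0 h1/=.
by rewrite -(mesh_sub n (mesh_index n t)) lerD2r ltW.
Qed.

Lemma mesh_index_le n t : 0 <= t -> t <= T -> (mesh_index n t <= 2 ^ n)%N.
Proof.
move=> t0 tT; rewrite -(ler_nat R) natrX.
have /truncn_itv/andP[+ _] : 0 <= 2 ^+ n * t / T.
  by rewrite divr_ge0 ?mulr_ge0 ?(ltW T_gt0) ?exprn_ge0.
move=> /le_trans; apply; rewrite ler_pdivrMr// ler_pM2l// exprn_gt0//.
Qed.

(** So the approximation of [t] from below either stays put or advances by one step of the finer
    mesh. *)
Lemma mesh_indexS n t : 0 <= t ->
  mesh_index n.+1 t = (mesh_index n t).*2 \/
  mesh_index n.+1 t = (mesh_index n t).*2.+1.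
Proof.
move=> t0; have /andP[h1 h2] := mesh_floor_itv n t0.
have /andP[h3 h4] := mesh_floor_itv n.+1 t0.
set i := mesh_index n t; set j := mesh_index n.+1 t.
have p2 : 0 < 2 ^+ n.+1 :> R by exact: exprn_gt0.
have lt_mesh k l : mesh n.+1 k < mesh n.+1 l -> (k < l)%N.
  by rewrite /mesh ltr_pM2r ?invr_gt0// ltr_pM2r// ltr_nat.
have a1 : (i.*2 < j.+1)%N by apply: lt_mesh; rewrite meshS; exact: le_lt_trans h4.
have a2 : (j < i.+1.*2)%N by apply: lt_mesh; rewrite meshS; exact: le_lt_trans h2.
move: a1 a2; rewrite ltnS leq_eqVlt doubleS => /orP[/eqP|]; first by left.
by move=> a1 a2; right; apply/eqP; rewrite eqn_leq -ltnS a2 a1.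
Qed.

Lemma mesh_index_near n s t : 0 <= s -> s <= t -> t - s <= T / 2 ^+ n ->
  mesh_index n t = mesh_index n s \/ mesh_index n t = (mesh_index n s).+1.
Proof.
move=> s0 st ts; have /andP[h1 h2] := mesh_floor_itv n s0.
have /andP[h3 h4] := mesh_floor_itv n (le_trans s0 st).
set i := mesh_index n s; set j := mesh_index n t.
have lt_mesh k l : mesh n k < mesh n l -> (k < l)%N.
  by rewrite /mesh ltr_pM2r ?invr_gt0 ?exprn_gt0// ltr_pM2r// ltr_nat.
have a1 : (i < j.+1)%N by apply: lt_mesh; exact: le_lt_trans (le_trans h1 st) h4.
have a2 : (j < i.+2)%N.
  apply: lt_mesh; apply: le_lt_trans h3 _.
  by have := mesh_sub n i.+1; rewrite -/i in h2; lra.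
move: a1; rewrite ltnS leq_eqVlt => /orP[/eqP|]; first by left.
by move=> a1; right; apply/eqP; rewrite eqn_leq -ltnS a2 a1.
Qed.

(** The last level at which the mesh width is still at least [d]; its width is comparable to [d]. *)
Lemma exists_level n0 d : 0 < d -> d <= T / 2 ^+ n0 ->
  exists2 n, (n0 <= n)%N & d <= T / 2 ^+ n < 2 * d.
Proof.
move=> d0 dn.
have ex : exists m, T / 2 ^+ m < d.
  exists (Num.bound (T / d)); rewrite ltr_pdivrMr ?exprn_gt0// mulrC -ltr_pdivrMr//.
  apply: (@lt_trans _ _ (Num.bound (T / d))%:R).
    by have := archi_boundP (divr_ge0 (ltW T_gt0) (ltW d0)).
  by rewrite -natrX ltr_nat ltn_expl.
case: (ex_minnP ex) => -[|n] nd nmin.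
  have : T / 2 ^+ n0 <= T / 2 ^+ 0.
    by rewrite ler_pM2l// lef_pV2 ?posrE ?exprn_gt0// ler_eXn2l ?ltr1n.
  by move=> h; have := lt_le_trans (lt_le_trans nd dn) h; rewrite ltxx.
have dn' : d <= T / 2 ^+ n by rewrite leNgt; apply/negP => /nmin; rewrite ltnn.
exists n; last first.
  by rewrite dn'/=; move: nd; rewrite exprS invfM; lra.
rewrite leqNgt; apply/negP => nn0; move: nd; apply/negP; rewrite -leNgt (le_trans dn)//.
by rewrite ler_pM2l// lef_pV2 ?posrE ?exprn_gt0// ler_eXn2l ?ltr1n.
Qed.

(** * Deterministic chaining along dyadic points *)

Section chaining.
Variables (f : R -> R) (kappa c : R) (n0 : nat).
Hypotheses (kappa_gt0 : 0 < kappa) (c_ge0 : 0 <= c).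
Hypothesis f_mesh : forall n k, (n0 <= n)%N -> (k < 2 ^ n)%N ->
  `|f (mesh n k.+1) - f (mesh n k)| <= c * (2 `^ (- kappa)) ^+ n.
Local Notation r := (2 `^ (- kappa) : R).

Let r_ge0 : 0 <= r. Proof. exact: powR_ge0. Qed.

Let r_lt1 : r < 1.
Proof.
rewrite powRN invf_lt1 ?powR_gt0// -[ltLHS](congr1 (@^~ kappa) (powR1 R)).
by rewrite gt0_ltr_powR ?nnegrE// ltr1n.
Qed.

Lemma mesh_floorS_le n t : (n0 <= n)%N -> 0 <= t -> t <= T ->
  `|f (mesh_floor n.+1 t) - f (mesh_floor n t)| <= c * r ^+ n.
Proof.
move=> n0n t0 tT.
have cr : 0 <= c * r ^+ n.+1 by rewrite mulr_ge0 ?exprn_ge0.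
apply: (@le_trans _ _ (c * r ^+ n.+1)); last first.
  by rewrite ler_wpM2l// exprS ler_piMl ?exprn_ge0// ltW.
have := mesh_index_le n.+1 t0 tT.
rewrite /mesh_floor -(meshS n); case: (mesh_indexS n t0) => -> jn.
  by rewrite subrr normr0.
by apply: f_mesh => //; exact: leqW.
Qed.

Lemma mesh_floor_add_le n m t : (n0 <= n)%N -> 0 <= t -> t <= T ->
  `|f (mesh_floor (m + n) t) - f (mesh_floor n t)| <= c * r ^+ n / (1 - r).
Proof.
move=> n0n t0 tT.
have r10 : 0 < 1 - r by rewrite subr_gt0.
(* The exact partial geometric sum is what the induction on [m] reproduces. *)
suff : `|f (mesh_floor (m + n) t) - f (mesh_floor n t)| <= c * r ^+ n * (1 - r ^+ m) / (1 - r).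
  move=> /le_trans; apply; rewrite ler_pM2r ?invr_gt0//.
  apply: ler_piMr; first by rewrite mulr_ge0 ?exprn_ge0.
  by rewrite gerBl exprn_ge0.
elim: m => [|m IH].
  by rewrite add0n subrr normr0 expr0 subrr mulr0 mul0r.
rewrite addSn; apply: le_trans (ler_distD (f (mesh_floor (m + n) t)) _ _) _.
apply: le_trans (lerD (mesh_floorS_le _ t0 tT) IH) _; first exact: leq_trans (leq_addl _ _).
rewrite exprD exprS le_eqVlt; apply/orP; left; apply/eqP.
by field; rewrite gt_eqF.
Qed.

Lemma cvg_mesh_floor t : 0 <= t -> t <= T -> cvgn (fun n => f (mesh_floor n t)).
Proof.
move=> t0 tT; have r10 : 0 < 1 - r by rewrite subr_gt0.
apply/cauchy_cvgP/cauchy_exP => e e0.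
have : c / (1 - r) * r ^+ n @[n --> \oo] --> (0 : R).
  by apply: cvg_geometric; rewrite ger0_norm.
move=> /cvgrPdist_lt /(_ _ e0)[N _ hN].
exists (f (mesh_floor (maxn N n0) t)); exists (maxn N n0) => // n /= nN.
rewrite /ball/= distrC -[n](subnK nN).
apply: le_lt_trans (mesh_floor_add_le _ _ t0 tT) _; first exact: leq_maxr.
have := hN (maxn N n0) (leq_maxl _ _); rewrite sub0r normrN mulrAC.
exact: le_lt_trans (ler_norm _).
Qed.

Lemma mesh_floor_lim_le n t : (n0 <= n)%N -> 0 <= t -> t <= T ->
  `|limn (fun n => f (mesh_floor n t)) - f (mesh_floor n t)| <= c * r ^+ n / (1 - r).
Proof.
move=> n0n t0 tT.
have h : (`|f (mesh_floor m t) - f (mesh_floor n t)| @[m --> \oo] -->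
    `|limn (fun n => f (mesh_floor n t)) - f (mesh_floor n t)|).
  by apply: cvg_norm; apply: cvgB; [exact: cvg_mesh_floor|exact: cvg_cst].
rewrite -(cvg_lim _ h)//; apply: limr_le; first by apply/cvg_ex; eexists; exact: h.
exists n => // m /= nm; rewrite -[m](subnK nm); exact: mesh_floor_add_le.
Qed.

Lemma mesh_floor_near_le n s t : (n0 <= n)%N -> 0 <= s -> s <= t -> t <= T ->
  t - s <= T / 2 ^+ n ->
  `|f (mesh_floor n t) - f (mesh_floor n s)| <= c * r ^+ n.
Proof.
move=> n0n s0 st tT ts; rewrite /mesh_floor.
have := mesh_index_le n (le_trans s0 st) tT.
case: (mesh_index_near s0 st ts) => -> jn; last exact: f_mesh.
by rewrite subrr normr0 mulr_ge0 ?exprn_ge0.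
Qed.

(** Increments are controlled only from level [n0] on. If [t - s] is at most the width of that
    level, chaining at a level comparable to [t - s] applies; longer increments are bounded by
    [2 * M]. *)
Lemma holder_continuous_chaining (g : R -> R) :
  (forall t, 0 <= t <= T -> g t = limn (fun n => f (mesh_floor n t))) ->
  holder_continuous T kappa g.
Proof.
move=> gE; have r10 : 0 < 1 - r by rewrite subr_gt0.
have g_le n t : (n0 <= n)%N -> 0 <= t -> t <= T ->
    `|g t - f (mesh_floor n t)| <= c * r ^+ n / (1 - r).
  by move=> n0n t0 tT; rewrite gE ?t0// mesh_floor_lim_le.
have rE n : r ^+ n = (2 ^+ n)^-1 `^ kappa.
  by rewrite -powR_mulrn// -powRrM mulrC -powR_invn// -powRrM mulNr mulrN mulrC.
(* A uniform bound on [g]: the chaining error from level [n0] plus the finitely many values of [f]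
   at that level. *)
pose M := c * r ^+ n0 / (1 - r) + \sum_(k < (2 ^ n0).+1) `|f (mesh n0 k)|.
have gM t : 0 <= t -> t <= T -> `|g t| <= M.
  move=> t0 tT; rewrite -[g t](subrK (f (mesh_floor n0 t))).
  apply: le_trans (ler_normD _ _) _; apply: lerD; first exact: g_le.
  have i : (mesh_index n0 t < (2 ^ n0).+1)%N by rewrite ltnS mesh_index_le.
  by rewrite (bigD1 (Ordinal i))//= lerDl sumr_ge0.
(* 1 for the step between the dyadic neighbours of [s] and [t], [2 / (1 - r)] for the two chaining
   errors, and [2 / T] because the width of the chosen level is less than [2 * (t - s)]. *)
pose K1 := (1 + 2 / (1 - r)) * c * (2 / T) `^ kappa.
pose K2 := 2 * M / (T / 2 ^+ n0) `^ kappa.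
have M0 : 0 <= M by apply: le_trans (gM 0 _ _) => //; exact: ltW.
have K10 : 0 <= K1.
  by rewrite mulr_ge0 ?powR_ge0// mulr_ge0// addr_ge0// divr_ge0// ltW.
have K20 : 0 <= K2 by rewrite divr_ge0 ?powR_ge0// mulr_ge0.
suff main s t : 0 <= s -> s < t -> t <= T -> `|g t - g s| <= (K1 + K2) * (t - s) `^ kappa.
  exists (K1 + K2) => s t /andP[s0 sT] /andP[t0 tT].
  have [st|ts|->] := ltgtP s t.
  - by rewrite (ger0_norm (_ : 0 <= t - s)) ?subr_ge0 ?(ltW st)//; exact: main.
  - by rewrite distrC (distrC t) (ger0_norm (_ : 0 <= s - t)) ?subr_ge0 ?(ltW ts)//; exact: main.
  - by rewrite subrr normr0 mulr_ge0 ?addr_ge0 ?powR_ge0.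
move=> s0 st tT; have d0 : 0 < t - s by rewrite subr_gt0.
have t0 := le_trans s0 (ltW st); have sT := le_trans (ltW st) tT.
have k0 : 0 <= (t - s) `^ kappa by exact: powR_ge0.
have Tn : 0 < T / 2 ^+ n0 by rewrite divr_gt0 ?exprn_gt0.
have [dn|nd] := leP (t - s) (T / 2 ^+ n0).
  have [n n0n /andP[dn1 dn2]] := exists_level d0 dn.
  apply: (@le_trans _ _ (K1 * (t - s) `^ kappa)); last by rewrite ler_wpM2r// lerDl.
  have r_le : r ^+ n <= (2 / T) `^ kappa * (t - s) `^ kappa.
    rewrite -powRM ?(ltW d0) ?divr_ge0 ?(ltW T_gt0)// rE.
    rewrite ge0_ler_powR ?nnegrE ?(ltW kappa_gt0) ?invr_ge0 ?exprn_ge0//.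
      by rewrite mulr_ge0 ?(ltW d0) ?divr_ge0 ?(ltW T_gt0).
    by rewrite mulrAC ler_pdivlMr// mulrC ltW.
  apply: (@le_trans _ _ ((1 + 2 / (1 - r)) * c * r ^+ n)); last first.
    rewrite /K1 -[leRHS]mulrA ler_wpM2l//; apply: mulr_ge0 => //.
    by apply: addr_ge0 => //; rewrite divr_ge0// ltW.
  have -> : g t - g s = (g t - f (mesh_floor n t)) +
      (f (mesh_floor n t) - f (mesh_floor n s)) - (g s - f (mesh_floor n s)) by ring.
  apply: le_trans (ler_normB _ _) _; apply: le_trans (lerD (ler_normD _ _) (lexx _)) _.
  have h1 := g_le n t n0n t0 tT; have h2 := g_le n s n0n s0 sT.
  have h3 := mesh_floor_near_le n0n s0 (ltW st) tT dn1.
  have -> : (1 + 2 / (1 - r)) * c * r ^+ n =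
    c * r ^+ n / (1 - r) + c * r ^+ n + c * r ^+ n / (1 - r) by field; rewrite gt_eqF.
  by rewrite !lerD.
apply: (@le_trans _ _ (K2 * (t - s) `^ kappa)); last by rewrite ler_wpM2r// lerDr.
apply: (@le_trans _ _ (2 * M)).
  apply: le_trans (ler_normB _ _) _.
  by have := gM t t0 tT; have := gM s s0 sT; lra.
rewrite /K2 mulrAC ler_pdivlMr ?powR_gt0// ler_wpM2l ?mulr_ge0//.
by rewrite ge0_ler_powR ?nnegrE ?(ltW kappa_gt0) ?(ltW Tn) ?(ltW d0) ?(ltW nd).
Qed.

End chaining.
End mesh.

(** * From tail bounds to a Hölder continuous modification *)

Section kolmogorov.
Context d (Omega : measurableType d) (R : realType) (P : probability Omega R).
Context (T : R) (T_gt0 : 0 < T).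

Lemma borel_cantelli_geometric (B : nat -> set Omega) (C r : R) :
  (forall n, measurable (B n)) -> 0 <= C -> 0 <= r -> r < 1 ->
  (forall n, (P (B n) <= (C * r ^+ n)%:E)%E) ->
  {ae P, forall w, \forall n \near \oo, ~ B n w}.
Proof.
move=> mB C0 r0 r1 PB.
have P0 : P (lim_sup_set B) = 0%E.
  apply: lim_sup_set_cvg0 => //.
  apply: (@le_lt_trans _ _ (\sum_(0 <= n <oo) (C * r ^+ n)%:E)%E).
    by apply: lee_nneseries => // n _; exact: PB.
  have r10 : 0 < 1 - r by rewrite subr_gt0.
  apply: (@le_lt_trans _ _ (C / (1 - r))%:E); last exact: ltry.
  apply: lime_le.
    by apply: is_cvg_nneseries => n _ _; rewrite lee_fin mulr_ge0 ?exprn_ge0.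
  apply: nearW => n; rewrite sumEFin lee_fin -mulr_sumr ler_wpM2l//.
  have : (1 - r) * \sum_(0 <= i < n) r ^+ i <= 1.
    rewrite big_mkord -opprB mulNr -subrX1 opprB.
    by rewrite gerBl exprn_ge0.
  by rewrite -ler_pdivlMl// mulr1.
exists (lim_sup_set B); split => //.
  by apply: bigcap_measurable => // n _; exact: bigcup_measurable.
move=> w /= wB n _; apply: contrapT => nB; apply: wB.
by exists n => // m /= nm Bm; apply: nB; exists m.
Qed.

Lemma ae_lt_tail (X : Omega -> R) (X_ : nat -> Omega -> R) (h_ : nat -> R) (C r : R) :
  measurable_fun setT X -> (forall n, measurable_fun setT (X_ n)) ->
  0 <= C -> 0 <= r -> r < 1 ->
  (forall n, (P [set w | (h_ n <= `|X w - X_ n w|)%R] <= (C * r ^+ n)%:E)%E) ->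
  {ae P, forall w, \forall n \near \oo, `|X w - X_ n w| < h_ n}.
Proof.
move=> mX mX_ C0 r0 r1 PX.
apply: filterS (borel_cantelli_geometric _ C0 r0 r1 PX).
  by move=> w; apply: filterS => n /negP; rewrite -ltNge.
by move=> n; exact: measurable_norm_ge.
Qed.

Variable U : R -> {RV P >-> R}.
Variable kappa0 : R.
Hypothesis kappa0_gt0 : 0 < kappa0.
Hypothesis U_tail : forall kappa, 0 < kappa -> kappa < kappa0 ->
  exists C g, [/\ 0 <= C, 0 < g & forall s t, 0 <= s -> s < t -> t <= T ->
    (P [set w | ((t - s) `^ kappa <= `|U t w - U s w|)%R] <=
      (C * (t - s) `^ (1 + g))%:E)%E].

Let mU s t : measurable_fun setT (fun w => U t w - U s w).
Proof. exact: measurable_funB. Qed.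

Let powR_mesh (p : R) n : (T / 2 ^+ n) `^ p = T `^ p * (2 `^ (- p)) ^+ n.
Proof.
rewrite powRM ?(ltW T_gt0) ?invr_ge0 ?exprn_ge0//; congr (_ * _).
by rewrite -powR_invn// -powRrM mulNr -mulrN mulrC powRrM powR_mulrn ?powR_ge0.
Qed.

Let powR2_lt1 (p : R) : 0 < p -> 2 `^ (- p) < 1 :> R.
Proof.
move=> p0; rewrite powRN invf_lt1 ?powR_gt0// -[ltLHS](congr1 (@^~ p) (powR1 R)).
by rewrite gt0_ltr_powR ?nnegrE// ltr1n.
Qed.

(** The union bound over [2 ^ n] increments uses up the exponent 1 in [1 + g]; the remaining [g]
    makes the probabilities summable. *)
Let mesh_increments_ae kappa : 0 < kappa -> kappa < kappa0 ->
  {ae P, forall w, \forall n \near \oo, forall k, (k < 2 ^ n)%N ->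
    `|U (mesh T n k.+1) w - U (mesh T n k) w| < (T / 2 ^+ n) `^ kappa}.
Proof.
move=> k0 kk; have [C [g [C0 g0 UC]]] := U_tail k0 kk.
pose B n k : set Omega := [set w | (T / 2 ^+ n) `^ kappa <= `|U (mesh T n k.+1) w - U (mesh T n k) w|].
have mB n k : measurable (B n k) by exact: measurable_norm_ge.
have PB n : (P (\big[setU/set0]_(k < 2 ^ n) B n k) <=
    (C * T `^ (1 + g) * (2 `^ (- g)) ^+ n)%:E)%E.
  have := @Boole_inequality _ _ _ P (B n) (2 ^ n) (fun k _ => mB n k); move=> /le_trans; apply.
  apply: (@le_trans _ _ (\sum_(k < 2 ^ n) (C * (T / 2 ^+ n) `^ (1 + g))%:E)%E).
    apply: lee_sum => k _; rewrite /B -(mesh_sub T n k); apply: UC.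
    - by apply: mesh_ge0.
    - by apply: mesh_lt.
    - by apply: mesh_le.
  rewrite sumEFin sumr_const card_ord lee_fin powR_mesh -[_ *+ (2 ^ n)%N]mulr_natl natrX.
  have -> : 2 `^ (- (1 + g)) = 2^-1 * 2 `^ (- g) :> R.
    by rewrite opprD powRD ?pnatr_eq0 ?implybT// powRN powRr1.
  rewrite exprMn exprVn le_eqVlt; apply/orP; left; apply/eqP.
  by field; rewrite expf_neq0.
have mU_ n : measurable (\big[setU/set0]_(k < 2 ^ n) B n k).
  by apply: bigsetU_measurable => k _; exact: mB.
have CT : 0 <= C * T `^ (1 + g) by rewrite mulr_ge0 ?powR_ge0.
apply: filterS (borel_cantelli_geometric mU_ CT (powR_ge0 _ _) (powR2_lt1 g0) PB).
move=> w; apply: filterS => n nB k kn; rewrite ltNge; apply/negP => Bk; apply: nB.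
by rewrite -bigcup_mkord; exists k.
Qed.

Let mesh_floor_ae t : 0 <= t -> t <= T ->
  {ae P, forall w, U (mesh_floor T n t) w @[n --> \oo] --> U t w}.
Proof.
move=> t0 tT; have k0 : 0 < kappa0 / 2 by rewrite divr_gt0.
have kk : kappa0 / 2 < kappa0 by rewrite ltr_pdivrMr// ltr_pMr// ltr1n.
have [C [g [C0 g0 UC]]] := U_tail k0 kk.
have g1 : 0 < 1 + g by rewrite addr_gt0.
have PX n : (P [set w | ((T / 2 ^+ n) `^ (kappa0 / 2) <= `|U t w - U (mesh_floor T n t) w|)%R] <=
    (C * T `^ (1 + g) * (2 `^ (- (1 + g))) ^+ n)%:E)%E.
  have /andP[d0 dT] := mesh_floor_dist T_gt0 n t0.
  have p2 : 0 < T / 2 ^+ n by rewrite divr_gt0 ?exprn_gt0.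
  (* The tail bound is assumed for distinct times only; for equal ones the event is empty. *)
  have [/eqP et|ne] := boolP (t == mesh_floor T n t).
    rewrite -et (_ : [set w | _] = set0) ?measure0.
      by rewrite lee_fin !mulr_ge0 ?exprn_ge0 ?powR_ge0.
    by apply/seteqP; split => // w /=; rewrite subrr normr0 leNgt powR_gt0.
  have d1 : 0 < t - mesh_floor T n t by rewrite lt_neqAle d0 eq_sym subr_eq0 ne.
  rewrite -mulrA -powR_mesh.
  apply: (@le_trans _ _ (C * (t - mesh_floor T n t) `^ (1 + g))%:E); last first.
    by rewrite lee_fin ler_wpM2l// ge0_ler_powR ?nnegrE ?(ltW g1) ?(ltW p2).
  apply: le_trans (UC _ _ _ _ tT); last 2 first.
  - exact: mesh_ge0.
  - by rewrite -subr_gt0.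
  apply: le_measure; rewrite ?inE; [exact: measurable_norm_ge..|].
  move=> w /=; apply: le_trans.
  by rewrite ge0_ler_powR ?nnegrE ?(ltW k0) ?(ltW p2).
have CT : 0 <= C * T `^ (1 + g) by rewrite mulr_ge0 ?powR_ge0.
apply: filterS (ae_lt_tail _ _ CT (powR_ge0 _ _) (powR2_lt1 g1) PX) => // w wU; apply/cvgrPdist_lt => e e0.
have : T `^ (kappa0 / 2) * (2 `^ (- (kappa0 / 2))) ^+ n @[n --> \oo] --> (0 : R).
  by apply: cvg_geometric; rewrite ger0_norm ?powR_ge0// powR2_lt1.
move=> /cvgrPdist_lt /(_ _ e0); apply: filterS2 wU => n h1 h2.
apply: lt_trans h1 _; rewrite powR_mesh; apply: le_lt_trans h2.
by rewrite sub0r normrN ler_norm.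
Qed.

(** A single modification serves all exponents and all [w]. It is the limit of [U] along dyadic
    points off a null set; at each fixed [t] this limit is almost surely [U t]. *)
Theorem kolmogorov_continuity :
  exists2 V : R -> {RV P >-> R}, modification T U V &
    forall kappa, 0 < kappa -> kappa < kappa0 ->
      forall w, holder_continuous T kappa (fun t => V t w).
Proof.
(* A sequence of exponents increasing to [kappa0]: countably many null events, hence a common null
   set for all [kappa]. *)
pose kp j : R := kappa0 * (1 - j.+2%:R^-1).
have kp_gt0 j : 0 < kp j.
  by rewrite mulr_gt0// subr_gt0 invf_lt1 ?ltr0n// ltr1n.
have kp_lt j : kp j < kappa0.
  by rewrite gtr_pMr// gtrBl invr_gt0 ltr0n.
have [G0 [mG0 PG0 G0P]] : {ae P, forall w j, \forall n \near \oo,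
    forall k, (k < 2 ^ n)%N ->
    `|U (mesh T n k.+1) w - U (mesh T n k) w| < (T / 2 ^+ n) `^ kp j}.
  by apply/ae_foralln => j; exact: mesh_increments_ae.
have chain w kappa : ~ G0 w -> 0 < kappa -> kappa < kappa0 -> exists n0,
    forall n k, (n0 <= n)%N -> (k < 2 ^ n)%N ->
    `|U (mesh T n k.+1) w - U (mesh T n k) w| <= (1 + T) `^ kappa0 * (2 `^ (- kappa)) ^+ n.
  move=> wG k0 kk; have dk : 0 < kappa0 - kappa by rewrite subr_gt0.
  (* Chosen so that [kappa0 / (j + 2) <= kappa0 - kappa], that is [kappa <= kp j]. *)
  pose j := Num.bound (kappa0 / (kappa0 - kappa)).
  have kj : kappa <= kp j.
    have : kappa0 / (kappa0 - kappa) < j%:R.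
      by apply: archi_boundP; rewrite divr_ge0// ltW.
    rewrite ltr_pdivrMr// => jb; rewrite /kp mulrBr mulr1 lerBrDr -lerBrDl.
    rewrite ler_pdivrMr ?ltr0n//; apply: (le_trans (ltW jb)).
    by rewrite mulrC ler_wpM2l ?(ltW dk)// ler_nat leqW.
  have [N _ hN] : \forall n \near \oo, forall k, (k < 2 ^ n)%N ->
      `|U (mesh T n k.+1) w - U (mesh T n k) w| < (T / 2 ^+ n) `^ kp j.
    by apply: contrapT => h; apply/wG/G0P => /(_ j).
  exists N => n k nN kn; apply: le_trans (ltW (hN n nN k kn)) _.
  rewrite powR_mesh; apply: ler_pM; rewrite ?powR_ge0 ?exprn_ge0//.
    (* A base at least 1 is monotone in the exponent, so that the constant no longer depends on
       [j]. *)
    apply: (@le_trans _ _ ((1 + T) `^ kp j)).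
      by rewrite ge0_ler_powR ?nnegrE ?(ltW (kp_gt0 j)) ?addr_ge0 ?(ltW T_gt0)// lerDr.
    by apply: ler_powR; [rewrite lerDl ltW|rewrite ltW].
  by rewrite lerXn2r ?nnegrE ?powR_ge0//; apply: ler_powR; rewrite ?ler1n// lerN2.
have c_ge0 : 0 <= (1 + T) `^ kappa0 by exact: powR_ge0.
(* Setting the approximations to 0 on the measurable null set [G0] makes them converge everywhere,
   with measurable limit and constant path there. *)
pose X t n w := \1_(~` G0) w * U (mesh_floor T n t) w.
have XE0 t n w : G0 w -> X t n w = 0.
  by move=> wG; rewrite /X indicE memNset ?mul0r//= => /(_ wG).
have XE1 t n w : ~ G0 w -> X t n w = U (mesh_floor T n t) w.
  by move=> wG; rewrite /X indicE mem_set ?mul1r.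
have XE1' t w : ~ G0 w -> X t ^~ w = fun n => U (mesh_floor T n t) w.
  by move=> wG; apply/funext => n; exact: XE1.
have cX t w : 0 <= t -> t <= T -> cvgn (X t ^~ w).
  move=> t0 tT; have [wG|wG] := pselect (G0 w).
    rewrite (_ : X t ^~ w = fun=> 0); first exact: is_cvg_cst.
    by apply/funext => n; exact: XE0.
  have k0 : 0 < kappa0 / 2 by rewrite divr_gt0.
  have kk : kappa0 / 2 < kappa0 by rewrite ltr_pdivrMr// ltr_pMr// ltr1n.
  have [n0 hn0] := chain w _ wG k0 kk.
  by rewrite XE1'//; exact: (cvg_mesh_floor T_gt0 (f := U ^~ w) k0 c_ge0 hn0).
have /choice[V VE] : forall t, exists V : {RV P >-> R},
    0 <= t -> t <= T -> forall w, V w = limn (X t ^~ w).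
  move=> t; have [/andP[t0 tT]|nt] := boolP (0 <= t <= T); last first.
    by exists (U t) => t0 tT; rewrite t0 tT in nt.
  have mV : measurable_fun setT (fun w => limn (X t ^~ w)).
    apply: (measurable_fun_cvg (h := X t)) => [n|w _]; last exact: cX.
    by apply: measurable_funM => //; apply: measurable_indic; exact: measurableC.
  by exists (mfun_Sub (mem_set mV)).
exists V.
  move=> t /andP[t0 tT].
  have aeG : {ae P, forall w, ~ G0 w} by exists G0; split => // w /contrapT.
  apply: filterS2 aeG (mesh_floor_ae t0 tT) => w wG wU.
  by rewrite VE// XE1'// (cvg_lim _ wU).
move=> kappa k0 kk w; have [wG|wG] := pselect (G0 w).
  exists 0 => s t /andP[s0 sT] /andP[t0 tT].
  have V0 u : 0 <= u -> u <= T -> V u w = 0.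
    move=> u0 uT; rewrite VE// (_ : X u ^~ w = fun=> 0) ?lim_cst//.
    by apply/funext => n; exact: XE0.
  by rewrite !V0// subrr normr0 mul0r.
have [n0 hn0] := chain w _ wG k0 kk.
apply: (holder_continuous_chaining T_gt0 (f := U ^~ w) k0 c_ge0 hn0).
by move=> t /andP[t0 tT]; rewrite VE// XE1'.
Qed.

End kolmogorov.

(** * The Lévy symbol *)

Section laws.
Context d (Omega : measurableType d) (R : realType) (P : probability Omega R).

Lemma eq_law_Rintegral (X Y : Omega -> R) (g : R -> R) :
  measurable_fun setT X -> measurable_fun setT Y ->
  (forall B : set R, measurable B -> P (X @^-1` B) = P (Y @^-1` B)) ->
  measurable_fun setT g -> (exists M, forall x, `|g x| <= M) ->
  \int[P]_w g (X w) = \int[P]_w g (Y w).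
Proof.
move=> mX mY XY mg [M gM]; congr fine.
pose X' : {RV P >-> R} := mfun_Sub (mem_set mX).
pose Y' : {RV P >-> R} := mfun_Sub (mem_set mY).
have mg' : measurable_fun [set: R] (EFin \o g) by exact/measurable_EFinP.
have ig (W : {RV P >-> R}) : P.-integrable setT ((EFin \o g) \o W).
  apply: bounded_measurable_integrable; split; first exact: measurableT_comp.
  by exists M => w.
transitivity (\int[distribution P X']_x (EFin \o g) x)%E.
  by rewrite (integral_distribution mg' (ig X')).
transitivity (\int[distribution P Y']_x (EFin \o g) x)%E; last first.
  by rewrite (integral_distribution mg' (ig Y')).
by apply: eq_measure_integral => B mB _; exact: XY.
Qed.

End laws.

Lemma exists_pushforward (R : realType)
    (m : {measure set (measurableTypeR R) -> \bar R})
    (phi : measurableTypeR R -> measurableTypeR R) : measurable_fun setT phi ->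
  exists2 m' : {measure set (measurableTypeR R) -> \bar R},
    (forall A, m' A = m (phi @^-1` A)) &
    forall f : measurableTypeR R -> \bar R, measurable_fun setT f ->
      (forall x, (0 <= f x)%E) -> (\int[m']_x f x = \int[m]_x f (phi x))%E.
Proof.
move=> mphi; unshelve eexists (pushforward m phi : {measure set _ -> \bar R}) => //.
move=> f mf f0; pose p := mfun_Sub (mem_set mphi).
rewrite (_ : pushforward m phi = pushforward m p)//.
by rewrite [LHS]ge0_integral_pushforward// => y _.
Qed.

Section symmetric_measure.
Context (R : realType) (pi : {measure set (measurableTypeR R) -> \bar R}).
Hypothesis pi_sym : symmetric_measure pi.
Local Notation RR := (measurableTypeR R).

Lemma symmetric_integralN (f : RR -> \bar R) :
  measurable_fun setT f -> (forall x, (0 <= f x)%E) ->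
  (\int[pi]_x f (- x)%R = \int[pi]_x f x)%E.
Proof.
move=> mf f0; have mN : measurable_fun (setT : set RR) (-%R : RR -> RR).
  exact: measurable_funN.
have [m mE <-//] := exists_pushforward pi mN.
by apply: eq_measure_integral => B mB _; rewrite mE; exact: pi_sym.
Qed.

(** Positive and negative parts have equal integrals. Should these be infinite, [fine] of their
    difference is 0 by convention, so integrability of [f] is not at issue. *)
Lemma symmetric_Rintegral_odd (f : RR -> R) :
  measurable_fun setT f -> (forall x, f (- x) = - f x) -> \int[pi]_x f x = 0.
Proof.
move=> mf fN; rewrite /Rintegral integralE.
have mf' : measurable_fun setT (EFin \o f) by exact/measurable_EFinP.
have -> : (\int[pi]_x (EFin \o f)^\- x = \int[pi]_x (EFin \o f)^\+ x)%E.
  rewrite -[RHS]symmetric_integralN//; last exact: measurable_funepos.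
  by apply: eq_integral => x _; rewrite funenegE funeposE /= fN EFinN.
by case: (\int[pi]_x _)%E => [r||]//=; rewrite subrr.
Qed.

End symmetric_measure.

(** * Scaling of the Lebesgue measure and of normal laws *)

Section normal_scaling.
Context (R : realType).
Local Notation leb := (@lebesgue_measure R).
Local Notation RR := (measurableTypeR R).

(** Change of variable through uniqueness: [c] times the image of the Lebesgue measure under
    multiplication by [c] has the right value on half-open intervals. *)
Lemma lebesgue_integral_scale (c : R) (f : RR -> \bar R) (B : set RR) : 0 < c ->
  measurable B -> measurable_fun B f -> (forall x, (0 <= f x)%E) ->
  (\int[leb]_(x in B) f x = c%:E * \int[leb]_(x in *%R c @^-1` B) f (c * x)%R)%E.
Proof.
move=> c0 mB mf f0.
have mc : measurable_fun (setT : set RR) ( *%R c : RR -> RR) by exact: measurable_funM.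
have [m mE mI] := exists_pushforward leb mc.
pose cn : {nonneg R} := NngNum (ltW c0).
have scaleE A : measurable A -> leb A = mscale cn m A.
  apply: lebesgue_measure_unique => X [[a b] /= ab <-].
  rewrite /mscale/= mE.
  have -> : *%R c @^-1` `]a, b]%classic = `]a / c, b / c]%classic.
    by apply/seteqP; split => x /=; rewrite !in_itv/= ltr_pdivrMr// ler_pdivlMr// mulrC.
  have L (x y : R) : leb (`]x, y]%classic : set RR) = if x < y then (y - x)%:E else 0%E.
    by apply: (eq_trans (lebesgue_measure_itv `]x, y])); rewrite /= lte_fin EFinB.
  rewrite L [X in (_ * X)%E](L (a / c) (b / c)) ltr_pM2r ?invr_gt0//; case: ifPn => _; last by rewrite mule0.
  by rewrite -EFinM; congr EFin; field; rewrite gt_eqF.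
rewrite [LHS]integral_mkcond [in RHS]integral_mkcond.
rewrite (_ : \int[leb]_x (f \_ B) x = \int[mscale cn m]_x (f \_ B) x)%E; last first.
  by apply: eq_measure_integral => A mA _; exact: scaleE.
have mfB : measurable_fun setT (f \_ B) by apply/(measurable_restrictT _ mB).
have fB0 x : (0 <= (f \_ B) x)%E by rewrite patchE; case: ifP.
by rewrite ge0_integral_mscale// mI.
Qed.

Lemma normal_pdf_scale (c sg x : R) : 0 < c -> 0 < sg ->
  c * normal_pdf 0 (c * sg) (c * x) = normal_pdf 0 sg x.
Proof.
move=> c0 s0; rewrite !normal_pdfE ?gt_eqF ?mulr_gt0//.
rewrite /normal_peak /normal_fun !subr0 mulrA.
have cs : (c * sg) ^+ 2 * trigo.pi *+ 2 = c ^+ 2 * (sg ^+ 2 * trigo.pi *+ 2).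
  by rewrite exprMn -mulrA mulrnAr.
rewrite cs sqrtrM ?sqr_ge0// sqrtr_sqr ger0_norm ?(ltW c0)// invfM mulVKf ?gt_eqF//.
have -> // : - (c * x) ^+ 2 / ((c * sg) ^+ 2 *+ 2) = - x ^+ 2 / (sg ^+ 2 *+ 2).
by rewrite !mulr2n; field; rewrite !gt_eqF ?addr_gt0 ?exprn_gt0 ?mulr_gt0.
Qed.

Lemma normal_prob_scale (c sg : R) (B : set R) : 0 < c -> 0 < sg -> measurable B ->
  normal_prob 0 (c * sg) B = normal_prob 0 sg ( *%R c @^-1` B).
Proof.
move=> c0 s0 mB; rewrite /normal_prob.
rewrite (lebesgue_integral_scale c0)//; last 2 first.
  by apply/measurable_EFinP/measurable_funTS; exact: measurable_normal_pdf.
  by move=> x; rewrite lee_fin normal_pdf_ge0.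
have mcB : measurable ( *%R c @^-1` B : set RR).
  by rewrite -[X in measurable X]setTI; apply: (measurable_funM (measurable_cst _) (@measurable_id _ RR setT)).
rewrite -ge0_integralZl//.
- apply: eq_integral => x _; rewrite -EFinM; congr EFin.
  exact: normal_pdf_scale.
- apply/measurable_EFinP; apply: measurable_funTS.
  by apply: (measurableT_comp (measurable_normal_pdf _ _)); exact: measurable_funM.
- by move=> x _; rewrite lee_fin normal_pdf_ge0.
- by rewrite lee_fin ltW.
Qed.

End normal_scaling.

Section levy_symbol.
Context (R : realType) (a : R) (pi : {measure set (measurableTypeR R) -> \bar R}).
Hypothesis a_ge0 : 0 <= a.
Hypothesis pi_levy : levy_measure pi.
Local Notation RR := (measurableTypeR R).

(** The negative of the Lévy exponent, real because [pi] is symmetric; see [levy_exponentE]. *)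
Definition levy_symbol (mu : R) : R :=
  a * mu ^+ 2 / 2 + \int[pi]_x (1 - cos (mu * x)).

Let integrableZ (c : R) (f : RR -> R) : pi.-integrable setT (EFin \o f) ->
  pi.-integrable setT (EFin \o (fun x => c * f x)).
Proof. by move=> fi; exact: (integrableZl measurableT c fi). Qed.

Lemma one_sub_cosE (x : R) : 1 - cos x = 2 * sin (x / 2) ^+ 2.
Proof.
rewrite {1}(_ : x = x / 2 + x / 2); last by field.
by rewrite cosD; have := cos2Dsin2 (x / 2); rewrite !expr2; lra.
Qed.

Lemma one_sub_cos_ge0 (x : R) : 0 <= 1 - cos x.
Proof. by rewrite subr_ge0 cos_le1. Qed.

Lemma one_sub_cos_le (x : R) : 1 - cos x <= x ^+ 2 / 2.
Proof.
have : sin (x / 2) ^+ 2 <= (x / 2) ^+ 2.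
  rewrite -(real_normK (num_real (sin _))) -(real_normK (num_real (x / 2))).
  have [c _ ->] := sin_mean_value (x / 2).
  by rewrite ler_sqr ?nnegrE// normrM ler_piMl// ler_norml cos_geN1 cos_le1.
by rewrite one_sub_cosE !expr2; lra.
Qed.

(** In terms of the half angles this is the squared addition formula for the sine. It is the source
    of the subadditivity of the symbol. *)
Lemma one_sub_cosD_le (x y : R) :
  1 - cos (x + y) <= 2 * (1 - cos x) + 2 * (1 - cos y).
Proof.
rewrite !one_sub_cosE (mulrDl x y) sinD.
move: (x / 2) (y / 2) => u v.
have := cos2Dsin2 u; have := cos2Dsin2 v.
move: (cos u) (sin u) (cos v) (sin v) => c s c' s' h h'.
have h1 : (s * c' + c * s') ^+ 2 <= 2 * (s * c') ^+ 2 + 2 * (c * s') ^+ 2.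
  by have := sqr_ge0 (s * c' - c * s'); rewrite !expr2; lra.
have h2 : (s * c') ^+ 2 <= s ^+ 2.
  by rewrite exprMn ler_piMr ?sqr_ge0//; have := sqr_ge0 s'; lra.
have h3 : (c * s') ^+ 2 <= s' ^+ 2.
  by rewrite exprMn ler_piMl ?sqr_ge0//; have := sqr_ge0 s; lra.
by lra.
Qed.

Lemma measurable_one_sub_cos mu :
  measurable_fun setT (fun x : RR => 1 - cos (mu * x)).
Proof.
apply: measurable_funB => //.
have mf : measurable_fun (setT : set RR) (fun x : RR => mu * x) by exact: measurable_funM.
exact: (bounded_measurable_cos mf).1.
Qed.

Lemma integrable_one_sub_cos mu :
  pi.-integrable setT (fun x : RR => (1 - cos (mu * x))%:E).
Proof.
have mm : measurable_fun setT (fun x : RR => Num.min (x ^+ 2) 1).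
  by apply: measurable_minr => //; exact: measurable_funX.
apply/integrableP; split; first by apply/measurable_EFinP; exact: measurable_one_sub_cos.
under eq_integral do rewrite gee0_abs ?lee_fin ?one_sub_cos_ge0//.
(* [mu ^ 2 / 2] comes from the quadratic bound near 0, and 2 from the trivial bound for large
   [x]. *)
apply: (@le_lt_trans _ _ (\int[pi]_x ((mu ^+ 2 / 2 + 2) * Num.min (x ^+ 2) 1)%:E)%E).
  apply: ge0_le_integral => //.
  - by apply/measurable_EFinP; exact: measurable_one_sub_cos.
  - by apply/measurable_EFinP; exact: measurable_funM.
  move=> x _; rewrite lee_fin.
  have h1 := one_sub_cos_le (mu * x).
  have h2 : 1 - cos (mu * x) <= 2 by have := cos_geN1 (mu * x); lra.
  rewrite mulrDl; case: (leP (x ^+ 2) 1) => x1.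
    have : (mu * x) ^+ 2 / 2 <= mu ^+ 2 / 2 * x ^+ 2 by rewrite exprMn mulrAC.
    by have := sqr_ge0 x; lra.
  by have := sqr_ge0 mu; lra.
under eq_integral do rewrite EFinM.
have k0 : 0 <= mu ^+ 2 / 2 + 2 by rewrite addr_ge0 ?divr_ge0 ?sqr_ge0.
have mm0 (x : RR) : 0 <= Num.min (x ^+ 2) 1 by rewrite le_min sqr_ge0 ler01.
rewrite ge0_integralZl_EFin//; [|by move=> x _; rewrite lee_fin|exact/measurable_EFinP].
by rewrite lte_mul_pinfty ?lee_fin//; exact: pi_levy.2.
Qed.

Lemma levy_symbol_ge0 mu : 0 <= levy_symbol mu.
Proof.
apply: addr_ge0; first by rewrite divr_ge0// (mulr_ge0 a_ge0)// sqr_ge0.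
by apply: Rintegral_ge0 => x _; exact: one_sub_cos_ge0.
Qed.

Lemma levy_symbol0 : levy_symbol 0 = 0.
Proof.
rewrite /levy_symbol expr0n/= mulr0 mul0r add0r.
under eq_Rintegral do rewrite mul0r cos0 subrr.
by rewrite Rintegral_cst// mul0r.
Qed.

Lemma levy_symbolN mu : levy_symbol (- mu) = levy_symbol mu.
Proof.
rewrite /levy_symbol sqrrN; congr (_ + _).
by apply: eq_Rintegral => x _; rewrite mulNr cosN.
Qed.

Lemma levy_symbolD_le x y : levy_symbol (x + y) <= 2 * levy_symbol x + 2 * levy_symbol y.
Proof.
have i1 := integrable_one_sub_cos x; have i2 := integrable_one_sub_cos y.
have i12 := integrable_one_sub_cos (x + y).
have : \int[pi]_u (1 - cos ((x + y) * u)) <=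
    2 * \int[pi]_u (1 - cos (x * u)) + 2 * \int[pi]_u (1 - cos (y * u)).
  rewrite -!RintegralZl// -RintegralD//; last 2 first.
    exact: integrableZ.
    exact: integrableZ.
  apply: le_Rintegral => //.
    exact: (integrableD measurableT (integrableZ 2 i1) (integrableZ 2 i2)).
  by move=> u _; rewrite mulrDl; exact: one_sub_cosD_le.
have : a * (x + y) ^+ 2 / 2 <= 2 * (a * x ^+ 2 / 2) + 2 * (a * y ^+ 2 / 2).
  by have := mulr_ge0 a_ge0 (sqr_ge0 (x - y)); rewrite !expr2; lra.
by rewrite /levy_symbol; lra.
Qed.

Lemma levy_symbol_le mu : (\int[pi]_x (x ^+ 2)%:E < +oo)%E ->
  levy_symbol mu <= (a + \int[pi]_x (x ^+ 2)) / 2 * mu ^+ 2.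
Proof.
move=> x2.
have mx2 : measurable_fun setT (fun x : RR => x ^+ 2) by exact: measurable_funX.
have i2 : pi.-integrable setT (fun x : RR => (x ^+ 2)%:E).
  apply/integrableP; split; first exact/measurable_EFinP.
  by under eq_integral do rewrite gee0_abs ?lee_fin ?sqr_ge0//.
have : \int[pi]_x (1 - cos (mu * x)) <= mu ^+ 2 / 2 * \int[pi]_x (x ^+ 2).
  rewrite -RintegralZl//; apply: le_Rintegral => //.
  - exact: integrable_one_sub_cos.
  - exact: integrableZ.
  - by move=> x _; rewrite mulrAC -exprMn; exact: one_sub_cos_le.
by rewrite /levy_symbol; lra.
Qed.

Hypothesis pi_symmetric : symmetric_measure pi.

Lemma truncationE (x : R) : truncation x = Num.max (-1) (Num.min x 1).
Proof.
rewrite /truncation; case: (leP `|x| 1) => [|x1].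
  by rewrite ler_norml => /andP[h1 h2]; rewrite min_l// max_r.
have [x0|x0] := leP 0 x.
  rewrite ger0_norm// in x1 *.
  by rewrite divff ?gt_eqF ?(lt_trans _ x1)// min_r ?(ltW x1)// max_r// lerN10.
rewrite ltr0_norm// in x1 *; rewrite invrN mulrN divff ?lt_eqF//.
by rewrite min_l ?max_l//; lra.
Qed.

Lemma measurable_truncation : measurable_fun setT (@truncation R : RR -> RR).
Proof.
rewrite (_ : @truncation R = (fun x : RR => Num.max (-1) (Num.min x 1))).
  by apply: measurable_maxr => //; exact: measurable_minr.
by apply/funext => x; exact: truncationE.
Qed.

Lemma truncationN (x : R) : truncation (- x) = - truncation x.
Proof. by rewrite /truncation normrN; case: ifP => // _; rewrite mulNr. Qed.

(** The compensator only enters the imaginary part, whose integrand is odd and integrates to 0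
    against the symmetric [pi]. *)
Lemma levy_exponentE mu : levy_exponent a pi mu = complex.Complex (- levy_symbol mu) 0.
Proof.
rewrite /levy_exponent /cintegral /levy_symbol; congr complex.Complex => /=.
  rewrite opprD; congr (_ + _).
  under eq_Rintegral do rewrite expR0 mul1r subr0 -opprB.
  rewrite -mulN1r -RintegralZl//; last exact: integrable_one_sub_cos.
  by apply: eq_Rintegral => x _; rewrite mulN1r.
rewrite add0r.
under eq_Rintegral do rewrite expR0 mul1r subr0.
apply: symmetric_Rintegral_odd => //.
  apply: measurable_funB.
    have mf : measurable_fun (setT : set RR) (fun x : RR => mu * x) by exact: measurable_funM.
    exact: (bounded_measurable_sin mf).1.
  by apply: measurable_funM => //; exact: measurable_truncation.
by move=> x; rewrite mulrN sinN truncationN; ring.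
Qed.

End levy_symbol.

(** * The symbol as exponent of the increments of the process *)

Section levy_process.
Context d (Omega : measurableType d) (R : realType) (P : probability Omega R).
Context (a : R) (pi : {measure set (measurableTypeR R) -> \bar R})
  (Z : R -> {RV P >-> R}).
Hypothesis a_ge0 : 0 <= a.
Hypotheses (pi_levy : levy_measure pi) (pi_symmetric : symmetric_measure pi).
Hypotheses (Z_levy : levy_process Z) (Z_triplet : has_triplet Z a pi).
Local Notation psi := (levy_symbol a pi).

Lemma charfun_levy t mu : 0 <= t ->
  \int[P]_w cos (mu * Z t w) = expR (- (t * psi mu)) /\
  \int[P]_w sin (mu * Z t w) = 0.
Proof.
move=> t0; have := Z_triplet mu t0.
rewrite levy_exponentE// /charfun /cintegral /cexp /=.
rewrite !mul0r mulr0 subr0 addr0 cos0 sin0 mulr1 mulr0 mulrN => -[].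
under eq_Rintegral do rewrite expR0 mul1r; move=> ->.
by under eq_Rintegral do rewrite expR0 mul1r; move=> ->.
Qed.

Lemma levy_increment_Rintegral s t (g : R -> R) : 0 <= s -> s <= t ->
  measurable_fun setT g -> (exists M, forall x, `|g x| <= M) ->
  \int[P]_w g (Z t w - Z s w) = \int[P]_w g (Z (t - s) w).
Proof.
move=> s0 st mg gM; apply: (eq_law_Rintegral _ _ _ mg gM) => [|//|B mB].
  exact: measurable_funB.
have := levy_stationary_increments Z_levy s0 _ mB (h := t - s).
by rewrite subrKC subr_ge0 => /(_ st).
Qed.

Lemma levy_increment_cos s t mu : 0 <= s -> s <= t ->
  \int[P]_w cos (mu * (Z t w - Z s w)) = expR (- ((t - s) * psi mu)).
Proof.
move=> s0 st; rewrite -(charfun_levy mu _).1 ?subr_ge0//.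
have mm : measurable_fun (setT : set R) (fun x : R => mu * x) by exact: measurable_funM.
have [mg gM] := bounded_measurable_cos mm.
exact: (levy_increment_Rintegral s0 st mg gM).
Qed.

Lemma levy_increment_sin s t mu : 0 <= s -> s <= t ->
  \int[P]_w sin (mu * (Z t w - Z s w)) = 0.
Proof.
move=> s0 st; have ts : 0 <= t - s by rewrite subr_ge0.
rewrite -[RHS](charfun_levy mu ts).2.
have mm : measurable_fun (setT : set R) (fun x : R => mu * x) by exact: measurable_funM.
have [mg gM] := bounded_measurable_sin mm.
exact: (levy_increment_Rintegral s0 st mg gM).
Qed.

(** Brownian scaling: [mu * Z 1] and [Z (mu ^ 2)] have the same law, and comparing their exponents
    gives the claim. Neither the Gaussian characteristic function nor [pi] has to be computed. *)
Lemma brownian_symbol mu : 0 < a -> brownian_motion a Z -> psi mu = psi 1 * mu ^+ 2.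
Proof.
move=> a0 BM; wlog mu0 : mu / 0 < mu.
  move=> h; have [mu0|mu0|->] := ltgtP mu 0; first 2 last.
  - by rewrite levy_symbol0 expr0n/= mulr0.
  - by rewrite -levy_symbolN h ?oppr_gt0// sqrrN.
  - exact: h.
have mu2 : 0 < mu ^+ 2 by rewrite exprn_gt0.
have cosE : \int[P]_w cos (1 * (mu * (Z 1 w - Z 0 w))) =
    \int[P]_w cos (1 * (Z (mu ^+ 2) w - Z 0 w)).
  have mm : measurable_fun (setT : set R) (fun x : R => 1 * x) by exact: measurable_funM.
  have [mg gM] := bounded_measurable_cos mm.
  apply: (eq_law_Rintegral _ _ _ mg gM) => [||B mB].
  - by apply: measurable_funM => //; exact: measurable_funB.
  - exact: measurable_funB.
  have := brownian_gaussian_increments BM (lexx 0) mu2 mB.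
  rewrite /preimage => ->.
  have mB' : measurable ( *%R mu @^-1` B : set R).
    by rewrite -[X in measurable X]setTI; apply: (measurable_funM (measurable_cst _) (@measurable_id _ R setT)).
  have := brownian_gaussian_increments BM (lexx 0) ltr01 mB'.
  rewrite /preimage/= => ->; rewrite -normal_prob_scale ?sqrtr_gt0 ?mulr_gt0 ?subr0//.
  by rewrite mulr1 mulrC sqrtrM ?ltW// sqrtr_sqr gtr0_norm.
have e1 : \int[P]_w cos (1 * (mu * (Z 1 w - Z 0 w))) = expR (- psi mu).
  have := levy_increment_cos mu (lexx 0) ler01; rewrite subr0 mul1r => <-.
  by apply: eq_Rintegral => w _; rewrite mul1r.
move: cosE; rewrite e1 levy_increment_cos ?(ltW mu2)// subr0.
by move=> /expR_inj /oppr_inj ->; rewrite mulrC.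
Qed.

End levy_process.

(** * Increments of the Volterra process *)

Section volterra.
Context d (Omega : measurableType d) (R : realType) (P : probability Omega R).
Local Notation leb := (@lebesgue_measure R).
Local Notation RR := (measurableTypeR R).

Lemma sfun_steps (L : set R -> {RV P >-> R}) (f : {sfun RR >-> R}) (D D' : set RR) :
  measurable D -> D `<=` D' -> exists s, [/\ step_on D' s,
    forall w, elementary_integral L f D w = step_integral L s w &
    forall u, step_fun s u = f u * \1_D u].
Proof.
move=> mD DD'; exists [seq (x, D `&` f @^-1` [set x]) | x <- finmap.enum_fset (fset_set (range f))]; split.
- elim: (finmap.enum_fset _) => //= x s IH; split => //.
  by move=> u [/DD'].
- move=> w; rewrite /elementary_integral fsbig_finite; last exact: fimfunP.
  by rewrite /step_integral big_map.
- move=> u; rewrite [in RHS]fimfunE fsbig_finite; last exact: fimfunP.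
  rewrite /step_fun big_map mulr_suml; apply: eq_bigr => x _ /=.
  by rewrite indicI/= [X in _ * X]mulrC mulrA.
Qed.

Lemma ae_filter_lebesgue : Filter (almost_everywhere leb).
Proof. exact: (ae_filter_ringOfSetsType leb). Qed.

Context (T : R) (T_gt0 : 0 < T) (K : R -> R -> R) (L : set R -> {RV P >-> R}).
Context (U : R -> {RV P >-> R}).
Hypothesis U_integral : forall t, 0 <= t <= T ->
  is_stochastic_integral L `]0, t]%classic (K t) (U t).

Lemma integral_steps t : 0 <= t <= T -> exists s_ : nat -> seq (R * set R),
  [/\ forall n, step_on `]0, T]%classic (s_ n),
      cvg_in_probability P (fun n => step_integral L (s_ n)) (U t) &
      {ae leb, forall u, step_fun (s_ n) u @[n --> \oo] --> K t u * \1_(`]0, t]%classic) u}].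
Proof.
move=> tT; have [f_ [f_K _ f_U]] := U_integral tT.
have Dt : `]0, t]%classic `<=` `]0, T]%classic.
  move=> u /=; rewrite !in_itv/= => /andP[-> ut]/=.
  by move/andP: tT => [_ tT]; exact: le_trans tT.
have mt : measurable (`]0, t]%classic : set RR) by exact: measurable_itv.
have /choice[s_ s_P] n := sfun_steps L (f_ n) mt Dt.
exists s_; split.
- by move=> n; have [] := s_P n.
- rewrite (_ : (fun n => _) = (fun n => elementary_integral L (f_ n) `]0, t]%classic))//.
  by apply/funext => n; apply/funext => w; have [_ ->] := s_P n.
- have FF := ae_filter_lebesgue.
  apply: filterS f_K => u f_K.
  rewrite (_ : (fun n => _) = (fun n => f_ n u * \1_(`]0, t]%classic) u)); last first.
    by apply/funext => n; have [_ _ ->] := s_P n.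
  rewrite indicE; case: (boolP (u \in _)) => [/set_mem ut|_].
    by under eq_fun do rewrite mulr1; rewrite mulr1; exact: f_K.
  by under eq_fun do rewrite mulr0; rewrite mulr0; exact: cvg_cst.
Qed.

Let mU s t : measurable_fun setT (fun w => U t w - U s w).
Proof. exact: measurable_funB. Qed.

Definition increment s t : {RV P >-> R} := mfun_Sub (mem_set (mU s t)).

(** Extending both integrands by 0 to ]0, T] puts the two integrals on a common domain, where the
    approximations can be subtracted. *)
Lemma increment_steps s t : 0 <= s -> s < t -> t <= T ->
  exists s_ : nat -> seq (R * set R),
  [/\ forall n, step_on (`]0, T]%classic : set R) (s_ n),
      cvg_in_probability P (fun n => step_integral L (s_ n)) (increment s t) &
      {ae leb, forall u, (`]0, T]%classic : set R) u ->
        step_fun (s_ n) u @[n --> \oo] --> kernel_increment K s t u}].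
Proof.
move=> s0 st tT.
have [|t_ [t_D t_U t_K]] := @integral_steps t; first by rewrite tT (le_trans s0) ?ltW.
have [|r_ [r_D r_U r_K]] := @integral_steps s; first by rewrite s0 (le_trans (ltW st)).
exists (fun n => t_ n ++ scale_step (-1) (r_ n)); split.
- by move=> n; apply: step_on_cat => //; exact: step_on_scale.
- rewrite (_ : (fun n => _) =
      (fun n w => step_integral L (t_ n) w - step_integral L (r_ n) w)).
    apply: cvg_in_probabilityB => // n; exact: measurable_step_integral.
  apply/funext => n; apply/funext => w.
  by rewrite step_integral_cat step_integral_scale mulN1r.
- have FF := ae_filter_lebesgue.
  apply: filterS2 t_K r_K => u h1 h2 _; rewrite /kernel_increment.
  rewrite (_ : (fun n => _) = (fun n => step_fun (t_ n) u - step_fun (r_ n) u)).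
    exact: (cvgB h1 h2).
  by apply/funext => n; rewrite step_fun_cat step_fun_scale mulN1r.
Qed.

Context (Z : R -> {RV P >-> R}) (Lgen : generated_random_measure Z T L).
Context (psi : R -> R) (kap : R).
Hypothesis Z_cos : forall s t mu, 0 <= s -> s <= t ->
  \int[P]_w cos (mu * (Z t w - Z s w)) = expR (- ((t - s) * psi mu)).
Hypothesis Z_sin : forall s t mu, 0 <= s -> s <= t ->
  \int[P]_w sin (mu * (Z t w - Z s w)) = 0.
Hypothesis psi_ge0 : forall x, 0 <= psi x.
Hypothesis psi_subadd : forall x y, psi (x + y) <= 2 * psi x + 2 * psi y.
Hypothesis psi_le : forall x, psi x <= kap * x ^+ 2.

Let kap_ge0 : 0 <= kap.
Proof. by have := le_trans (psi_ge0 1) (psi_le 1); rewrite expr1n mulr1. Qed.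

Context (C q : R) (C_ge0 : 0 <= C).
Hypothesis K_energy : forall s t, 0 <= s -> s < t -> t <= T -> exists h : R -> R,
  [/\ measurable_fun (`]0, T]%classic : set RR) (h : RR -> R),
      forall u, (`]0, T]%classic : set R) u -> 0 <= h u,
      {ae leb, forall u, (`]0, T]%classic : set R) u ->
        kernel_increment K s t u ^+ 2 <= h u} &
      (\int[leb]_(u in (`]0%R, T]%classic : set R)) (h u)%:E <= (C * (t - s) `^ q)%:E)%E].

(** The constant 4 is 2 from [2 - 2 cos] times 2 from [cos_limit_ge], using
    [1 - expR (- x) <= x]. *)
Lemma increment_second_moment s t : 0 <= s -> s < t -> t <= T ->
  (\int[P]_w (((U t w - U s w) ^+ 2) ^+ 1)%:E <= (4 * kap * C * (t - s) `^ q)%:E)%E.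
Proof.
move=> s0 st tT; have [s_ [s_D s_W s_g]] := increment_steps s0 st tT.
have [h [mh h0 g_h h_V]] := K_energy s0 st tT.
have cosW := cos_limit_ge T_gt0 Lgen Z_cos Z_sin psi_ge0 psi_subadd psi_le s_D s_W s_g mh h0 g_h h_V.
apply: (le_moment (W := increment s t)); apply: nearW => n; rewrite !expr1.
have m0 : 0 < n.+1%:R :> R by rewrite ltr0n.
move: (n.+1%:R) m0 => m m0.
have bc : bounded_measurable (fun w => cos (m^-1 * increment s t w)).
  by apply: bounded_measurable_cos; exact: measurable_funM.
under eq_Rintegral do rewrite expr1.
rewrite bounded_RintegralB; last 2 first.
  exact: bounded_measurable_cst.
  by apply: bounded_measurableM => //; exact: bounded_measurable_cst.
rewrite Rintegral_probability_cst bounded_RintegralZl//.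
have h1 := cosW m^-1; have h2 := expR_ge1Dx (- (2 * (kap * m^-1 ^+ 2) * (C * (t - s) `^ q))).
have -> : 4 * kap * C * (t - s) `^ q / m ^+ 2 = 2 * (2 * (kap * m^-1 ^+ 2) * (C * (t - s) `^ q)).
  by field; rewrite gt_eqF.
by have := le_trans h2 h1; lra.
Qed.

Lemma increment_gaussian_moment k : (forall x, psi x = kap * x ^+ 2) ->
  exists2 C', 0 <= C' & forall s t, 0 <= s -> s < t -> t <= T ->
  (\int[P]_w (((U t w - U s w) ^+ 2) ^+ k)%:E <= (C' * (t - s) `^ q ^+ k)%:E)%E.
Proof.
move=> psi_sqr; have [Ck Ck0 hCk] := gaussian_moment P k.
exists (Ck * (2 * kap * C) ^+ k); first by rewrite mulr_ge0 ?exprn_ge0 ?mulr_ge0.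
move=> s t s0 st tT; have [s_ [s_D s_W s_g]] := increment_steps s0 st tT.
have [h [mh h0 g_h h_V]] := K_energy s0 st tT.
have [v [v0 vV cosW]] := gaussian_limit T_gt0 Lgen Z_cos Z_sin psi_ge0 psi_subadd psi_le
  s_D s_W s_g mh h0 g_h h_V psi_sqr.
apply: le_trans (hCk (increment s t) v v0 cosW) _.
rewrite lee_fin -mulrA ler_wpM2l// -exprMn lerXn2r ?nnegrE//.
  by rewrite mulr_ge0 ?powR_ge0 ?mulr_ge0.
by rewrite -[leRHS]mulrA.
Qed.

End volterra.

(** * From even moments to real moments and Hölder paths *)

Section moments_to_holder.
Context d (Omega : measurableType d) (R : realType) (P : probability Omega R).

Lemma markov_sqr (W : {RV P >-> R}) k (e C : R) : 0 < e ->
  (\int[P]_w ((W w ^+ 2) ^+ k)%:E <= C%:E)%E ->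
  (P [set w | (e <= `|W w|)%R] <= (C / (e ^+ 2) ^+ k)%:E)%E.
Proof.
move=> e0 WC; have ek : 0 < (e ^+ 2) ^+ k by rewrite !exprn_gt0.
have := @markov _ _ _ P W (fun x => (x ^+ 2) ^+ k) e e0.
rewrite unlock => /(_ _ _ _)/le_trans => h.
have {}h : (((e ^+ 2) ^+ k)%:E * P [set w | (e <= `|W w|)%R] <= C%:E)%E.
  apply: h.
  - by apply: measurable_funX; exact: measurable_funX.
  - by move=> r _; rewrite exprn_ge0 ?sqr_ge0.
  - move=> x y x0 y0 xy; rewrite -!exprM lerXn2r//.
  - apply: le_trans WC; rewrite le_eqVlt; apply/orP; left; apply/eqP.
    by apply: eq_integral => w _ /=; rewrite real_normK ?num_real.
by rewrite mulrC EFinM lee_pdivlMl.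
Qed.

(** Compare with the scale [dl]: if [|x| > dl], the ratio exceeds 1 and its exponent may be raised
    to [2k]. Integrated with [dl] of the order of the increment, this replaces an interpolation
    between moments. *)
Lemma powR_le_moment (p dl x : R) k : 0 < dl -> 0 <= p -> p <= (k.*2)%:R ->
  `|x| `^ p <= dl `^ p * (1 + (x ^+ 2) ^+ k / (dl ^+ 2) ^+ k).
Proof.
move=> d0 p0 pk; have dk : 0 < (dl ^+ 2) ^+ k by rewrite !exprn_gt0.
have [xd|dx] := leP `|x| dl.
  apply: (@le_trans _ _ (dl `^ p)).
    by rewrite ge0_ler_powR ?nnegrE ?(ltW d0).
  rewrite ler_peMr ?powR_ge0// lerDl divr_ge0 ?(ltW dk)//.
  by rewrite exprn_ge0 ?sqr_ge0.
have -> : `|x| = dl * (`|x| / dl) by rewrite mulrC divfK ?gt_eqF.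
rewrite powRM ?(ltW d0) ?divr_ge0 ?(ltW d0)// ler_wpM2l ?powR_ge0//.
apply: (@le_trans _ _ ((`|x| / dl) `^ (k.*2)%:R)).
  by apply: ler_powR => //; rewrite ler_pdivlMr// mul1r ltW.
rewrite powR_mulrn ?divr_ge0 ?(ltW d0)// -mul2n exprM expr_div_n real_normK ?num_real//.
by rewrite expr_div_n lerDr.
Qed.

Lemma le_expectation_powR (W : {RV P >-> R}) (p dl C : R) k :
  0 < dl -> 0 <= p -> p <= (k.*2)%:R ->
  (\int[P]_w ((W w ^+ 2) ^+ k)%:E <= (C * (dl ^+ 2) ^+ k)%:E)%E ->
  ('E_P[(fun w => (`|W w| `^ p)%R)] <= ((1 + C) * dl `^ p)%:E)%E.
Proof.
move=> d0 p0 pk WC; have dk : 0 < (dl ^+ 2) ^+ k by rewrite !exprn_gt0.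
have mW : measurable_fun setT (fun w => (W w ^+ 2) ^+ k).
  by apply: measurable_funX; exact: measurable_funX.
rewrite unlock.
apply: (@le_trans _ _ (\int[P]_w (dl `^ p + dl `^ p / (dl ^+ 2) ^+ k * (W w ^+ 2) ^+ k)%:E)%E).
  apply: ge0_le_integral => //.
  - by apply/measurable_EFinP; apply: (measurableT_comp (measurable_powR p)); exact: measurableT_comp.
  - by apply/measurable_EFinP; apply: measurable_funD => //; exact: measurable_funM.
  move=> w _; rewrite lee_fin; apply: le_trans (powR_le_moment _ d0 p0 pk) _.
  by rewrite mulrDr mulr1 mulrA mulrAC.
have c0 : 0 <= dl `^ p / (dl ^+ 2) ^+ k by rewrite divr_ge0 ?powR_ge0 ?(ltW dk).
under eq_integral do rewrite EFinD EFinM.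
rewrite ge0_integralD//; last 3 first.
  by move=> w _; rewrite lee_fin powR_ge0.
  by move=> w _; rewrite -EFinM lee_fin mulr_ge0// exprn_ge0 ?sqr_ge0.
  by under eq_fun do rewrite -EFinM; apply/measurable_EFinP; exact: measurable_funM.
rewrite integral_cst// ge0_integralZl_EFin//; last 2 first.
  by move=> w _; rewrite lee_fin exprn_ge0 ?sqr_ge0.
  exact/measurable_EFinP.
have := probability_setT P; move=> /= ->.
rewrite mule1 mulrDl mul1r EFinD leeD2l//.
apply: (@le_trans _ _ ((dl `^ p / (dl ^+ 2) ^+ k)%:E * (C * (dl ^+ 2) ^+ k)%:E)%E).
  by apply: lee_wpmul2l => //; rewrite lee_fin.
by rewrite -EFinM lee_fin le_eqVlt; apply/orP; left; apply/eqP; field; rewrite gt_eqF.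
Qed.

(** Markov's inequality leaves the exponent [2 * k * (th - kappa)] on [t - s], which has to exceed
    1. The order [k] may grow as [kappa] approaches [kappa0]. *)
Lemma holder_of_moments (T kappa0 : R) (U : R -> {RV P >-> R}) :
  0 < T -> 0 < kappa0 ->
  (forall kappa, 0 < kappa -> kappa < kappa0 -> exists k C th,
    [/\ 0 <= C, 1 < 2 * k%:R * (th - kappa) &
      forall s t, 0 <= s -> s < t -> t <= T ->
      (\int[P]_w (((U t w - U s w) ^+ 2) ^+ k)%:E <= (C * (t - s) `^ (2 * th) ^+ k)%:E)%E]) ->
  exists2 V : R -> {RV P >-> R}, modification T U V &
    forall kappa, 0 < kappa -> kappa < kappa0 ->
      forall w, holder_continuous T kappa (fun t => V t w).
Proof.
move=> T0 k00 Umom; apply: kolmogorov_continuity => // kappa k0 kk.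
have [k [C [th [C0 kth UC]]]] := Umom kappa k0 kk.
exists C, (2 * k%:R * (th - kappa) - 1); split; [by []|by rewrite subr_gt0|].
move=> s t s0 st tT; have ts : 0 < t - s by rewrite subr_gt0.
have mW : measurable_fun setT (fun w => U t w - U s w) by exact: measurable_funB.
have := @markov_sqr (mfun_Sub (mem_set mW)) k ((t - s) `^ kappa) _ (powR_gt0 _ ts) (UC s t s0 st tT).
move=> /le_trans; apply; rewrite lee_fin -[leLHS]mulrA ler_wpM2l//.
rewrite !sqr_powR ?(ltW ts)// -!powR_mulrn ?powR_ge0// -!powRrM -powRN -powRD; last first.
  by rewrite (gt_eqF ts) implybT.
by rewrite le_eqVlt; apply/orP; left; apply/eqP; congr (_ `^ _); ring.
Qed.

End moments_to_holder.

Theorem proposition2 (R : realType) (d : measure_display)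
    (Omega : measurableType d) (P : probability Omega R)
    (T H eps C0 a : R)
    (pi : {measure set (measurableTypeR R) -> \bar R})
    (Z U : R -> {RV P >-> R})
    (T_gt0 : 0 < T) (H_gt0 : 0 < H) (H_lt1 : H < 1)
    (eps_gt0 : 0 < eps) (eps_ltH : eps < H) (C0_gt0 : 0 < C0) (a_ge0 : 0 <= a)
    (pi_levy : levy_measure pi) (pi_symmetric : symmetric_measure pi)
    (Z_levy : levy_process Z) (Z_triplet : has_triplet Z a pi)
    (U_integral : volterra_process Z T (subfractional_kernel C0 H) U) :
  ((0 < \int[pi]_x (x ^+ 2)%:E)%E -> (\int[pi]_x (x ^+ 2)%:E < +oo)%E ->
    (exists C : R, forall s t, 0 <= s -> s < t -> t <= T ->
      ('E_P[(fun w => (`|U t w - U s w| ^+ 2)%R)] <=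
        (C * (t - s) `^ (2 * (H - eps)))%:E)%E) /\
    (1 / 2 < H ->
      exists2 V : R -> {RV P >-> R}, modification T U V &
        forall kappa, 0 < kappa -> kappa < H - 1 / 2 ->
          forall w, holder_continuous T kappa (fun t => V t w)))
  /\
  (0 < a -> brownian_motion a Z ->
    (forall p, 2 <= p ->
      exists C : R, forall s t, 0 <= s -> s < t -> t <= T ->
        ('E_P[(fun w => (`|U t w - U s w| `^ p)%R)] <=
          (C * (t - s) `^ (p * (H - eps)))%:E)%E) /\
    exists2 V : R -> {RV P >-> R}, modification T U V &
      forall kappa, 0 < kappa -> kappa < H ->
        forall w, holder_continuous T kappa (fun t => V t w)).

Proof.
case: U_integral => L Lgen UL.
have psi0 := levy_symbol_ge0 pi a_ge0.
have psiD := levy_symbolD_le a_ge0 pi_levy.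
have Zc := levy_increment_cos pi_levy pi_symmetric Z_levy Z_triplet.
have Zs := levy_increment_sin pi_levy pi_symmetric Z_levy Z_triplet.
have KE e := kernel_energy H_gt0 H_lt1 C0_gt0 T_gt0 (eps := e).
split.
- move=> _ x2.
  have psi_le mu := levy_symbol_le a pi_levy mu x2.
  have kap0 : 0 <= (a + \int[pi]_x (x ^+ 2)) / 2.
    by have := le_trans (psi0 1) (psi_le 1); rewrite expr1n mulr1.
  (* Stated for every [e], because the Hölder exponents require values other than [eps]. *)
  have U2 e : 0 < e -> e < H -> exists2 C, 0 <= C &
      forall s t, 0 <= s -> s < t -> t <= T ->
      (\int[P]_w (((U t w - U s w) ^+ 2) ^+ 1)%:E <= (C * (t - s) `^ (2 * (H - e)))%:E)%E.
    move=> e0 eH; have [C C_ge0 K_energy] := KE e e0 eH.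
    exists (4 * ((a + \int[pi]_x (x ^+ 2)) / 2) * C); first by apply: mulr_ge0 => //; exact: mulr_ge0.
    move=> s t; exact: (increment_second_moment T_gt0 UL Lgen Zc Zs psi0 psiD psi_le K_energy).
  split.
    have [C _ UC] := U2 eps eps_gt0 eps_ltH; exists C => s t s0 st tT.
    apply: le_trans (UC s t s0 st tT); rewrite unlock le_eqVlt; apply/orP; left; apply/eqP.
    by apply: eq_integral => w _; rewrite real_normK ?num_real// expr1.
  move=> H2; apply: holder_of_moments => // [|kappa k0 kk]; first by rewrite subr_gt0.
  (* Half of the available margin: then [2 * (th - kappa)] equals [H - kappa + 1 / 2], which exceeds
     1. *)
  have [||C C_ge0 UC] := U2 ((H - 1 / 2 - kappa) / 2); [lra..|].
  exists 1%N, C, (H - (H - 1 / 2 - kappa) / 2); split => //; lra.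
- move=> a_gt0 BM.
  have psi_sqr mu := brownian_symbol pi_levy pi_symmetric Z_levy Z_triplet mu a_gt0 BM.
  have psi_le mu : levy_symbol a pi mu <= levy_symbol a pi 1 * mu ^+ 2 by rewrite -psi_sqr.
  have Uk k e : 0 < e -> e < H -> exists2 C, 0 <= C &
      forall s t, 0 <= s -> s < t -> t <= T ->
      (\int[P]_w (((U t w - U s w) ^+ 2) ^+ k)%:E <= (C * (t - s) `^ (2 * (H - e)) ^+ k)%:E)%E.
    move=> e0 eH; have [C C_ge0 K_energy] := KE e e0 eH.
    exact: (increment_gaussian_moment T_gt0 UL Lgen Zc Zs psi0 psiD psi_le C_ge0 K_energy k psi_sqr).
  split.
    move=> p p2; have p0 : 0 <= p by lra.
    pose k := Num.bound p.
    have pk : p <= (k.*2)%:R.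
      by apply: le_trans (ltW (archi_boundP p0)) _; rewrite ler_nat -addnn leq_addr.
    have [C _ UC] := Uk k eps eps_gt0 eps_ltH.
    exists (1 + C) => s t s0 st tT.
    have ts : 0 < t - s by rewrite subr_gt0.
    rewrite [p * _]mulrC powRrM.
    (* The scale is [t - s] to the power [H - eps], whose power [p] is the bound claimed. *)
    apply: (le_expectation_powR (W := increment U s t) (powR_gt0 _ ts) p0 pk).
    by rewrite sqr_powR ?(ltW ts)// [_ * 2]mulrC; exact: UC.
  apply: holder_of_moments => // kappa k0 kk.
  (* With [th - kappa = (H - kappa) / 2], the condition on the moment order becomes
     [1 < k * (H - kappa)]. *)
  pose k := Num.bound (H - kappa)^-1.
  have [||C C_ge0 UC] := Uk k ((H - kappa) / 2); [lra..|].
  exists k, C, (H - (H - kappa) / 2); split => //.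
  have Hk : 0 < H - kappa by rewrite subr_gt0.
  have := archi_boundP (ltW (_ : 0 < (H - kappa)^-1)); rewrite invr_gt0 -/k => /(_ Hk).
  by rewrite -[ltLHS]mul1r ltr_pdivrMr//; lra.
Qed.
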